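(* Let $M$ be a model of ZFA in which the set $A$ of atoms is countable and $E$ is a binary relation on $A$ (in $M$) such that $\langle A,E\rangle$ is isomorphic in $M$ to the countable random graph. In $M$, let $\Sigma$ be the group of graph automorphisms of $\langle A,E\rangle$, and let $\mathcal{F}$ be the filter of subgroups of $\Sigma$ generated by the subgroups $\operatorname{Stab}(a)$ for $a\in A$. Then Frucht's Theorem holds in the permutation model $M'=M/\mathcal{F}$ (the random graph model).
   Context: ZFA is ZF modified to allow a set $A$ of atoms (objects with no elements, distinct from each other and from $\varnothing$; extensionality is restricted to non-atoms). A bijection $\pi$ of $A$ acts on the whole universe by its given action on atoms and, recursively, $\pi[S]=\{\pi[x]\mid x\in S\}$ for sets $S$. For $S\in M$, $\operatorname{Stab}(S)=\{\sigma\in\Sigma\mid \sigma[S]=S\}$. The filter generated by the subgroups $\operatorname{Stab}(a)$ consists of all subgroups of $\Sigma$ containing a finite intersection of such stabilizers; it is a normal filter. An $S\in M$ is symmetric if $\operatorname{Stab}(S)\in\mathcal{F}$, and hereditarily symmetric if $S$ and every element of its transitive closure are symmetric. The permutation model $M/\mathcal{F}$ is the class of hereditarily symmetric elements of $M$; it is a model of ZFA with the same set of atoms. A graph is a pair $\langle V(G),E(G)\rangle$ with $V(G)$ a set and $E(G)\subseteq V(G)^2$ symmetric and irreflexive; its automorphisms are the bijections of $V(G)$ preserving edges and non-edges. Frucht's Theorem is the statement that every group is isomorphic to the automorphism group of some graph. The countable random graph is the (up to isomorphism unique) countably infinite graph in which, for any disjoint finite sets $U,W$ of vertices, there is a vertex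 outside $U\cup W$ adjacent to every vertex of $U$ and to no vertex of $W$. *)

(* Defs.v *)
Set Implicit Arguments.
Unset Strict Implicit.

(** * Structures for the language of ZFA *)

Record structure := Structure {
  carrier :> Type;
  mem : carrier -> carrier -> Prop;
  atom : carrier -> Prop
}.

Arguments mem {s} _ _.
Arguments atom {s} _.

Notation "x ∈ y" := (mem x y) (at level 70, no associativity).

(** First-order formulas, in de Bruijn style: variable [0] is bound by the
    innermost quantifier, and an assignment interprets the free variables. *)
Inductive formula :=
| fMem (i j : nat)
| fEq (i j : nat)
| fAtom (i : nat)
| fFalse
| fImp (p q : formula)
| fAnd (p q : formula)
| fOr (p q : formula)
| fAll (p : formula)
| fEx (p : formula).

Definition scons (T : Type) (x : T) (env : nat -> T) (n : nat) : T :=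
  match n with 0 => x | S k => env k end.

Fixpoint sat (M : structure) (env : nat -> M) (p : formula) : Prop :=
  match p with
  | fMem i j => env i ∈ env j
  | fEq i j => env i = env j
  | fAtom i => atom (env i)
  | fFalse => False
  | fImp p q => sat env p -> sat env q
  | fAnd p q => sat env p /\ sat env q
  | fOr p q => sat env p \/ sat env q
  | fAll p => forall x : M, sat (scons x env) p
  | fEx p => exists x : M, sat (scons x env) p
  end.

(** * Set-theoretic notions, interpreted inside a structure

    All quantifiers range over the carrier of [M], so each definition is the
    satisfaction in [M] of the corresponding formula; in particular finiteness
    and countability are those of [M]. *)

Section Internal.
Variable M : structure.
Implicit Types x y z u v e f g h k p s w X Y V R E G m c : M.

Definition is_set x : Prop := ~ atom x.

Definition subset x y : Prop := forall z, z ∈ x -> z ∈ y.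

Definition is_empty e : Prop := is_set e /\ forall z, ~ z ∈ e.

Definition is_succ s x : Prop :=
  is_set s /\ forall z, z ∈ s <-> z ∈ x \/ z = x.

Definition is_inductive w : Prop :=
  (exists e, is_empty e /\ e ∈ w) /\
  (forall x, x ∈ w -> exists s, is_succ s x /\ s ∈ w).

Definition is_omega w : Prop :=
  is_set w /\ is_inductive w /\ forall v, is_inductive v -> subset w v.

Definition is_transitive x : Prop := forall y, y ∈ x -> subset y x.

Definition in_trcl x s : Prop :=
  forall t : M, is_transitive t -> subset s t -> x ∈ t.

(** Kuratowski pairs. *)
Definition is_upair p x y : Prop :=
  is_set p /\ forall z, z ∈ p <-> z = x \/ z = y.

Definition is_pair p x y : Prop :=
  exists u v, is_upair u x x /\ is_upair v x y /\ is_upair p u v.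

Definition is_product p X Y : Prop :=
  is_set p /\
  forall z, z ∈ p <-> exists x y, x ∈ X /\ y ∈ Y /\ is_pair z x y.

(** [inrel R x y]: the pair [(x, y)] belongs to [R]; for a function [R] this
    says [R(x) = y]. *)
Definition inrel R x y : Prop := exists p, is_pair p x y /\ p ∈ R.

Definition is_relation R X Y : Prop :=
  is_set R /\
  forall p, p ∈ R -> exists x y, x ∈ X /\ y ∈ Y /\ is_pair p x y.

Definition is_function f X Y : Prop :=
  is_relation f X Y /\ forall x, x ∈ X -> exists! y, inrel f x y.

Definition is_injection f X Y : Prop :=
  is_function f X Y /\
  forall x x' y, inrel f x y -> inrel f x' y -> x = x'.

Definition is_bijection f X Y : Prop :=
  is_injection f X Y /\ forall y, y ∈ Y -> exists x, inrel f x y.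

Definition is_composite k g h : Prop :=
  forall x z, inrel k x z <-> exists y, inrel h x y /\ inrel g y z.

Definition is_finite X : Prop :=
  exists w n f : M, is_omega w /\ n ∈ w /\ is_bijection f X n.

Definition is_countable X : Prop :=
  exists w f, is_omega w /\ is_injection f X w.

Definition is_countably_infinite X : Prop :=
  exists w f, is_omega w /\ is_bijection f w X.

(** ** Groups *)

Definition is_binop m G : Prop :=
  exists P : M, is_product P G G /\ is_function m P G.

(** [opapp m x y z] says [m(x, y) = z]. *)
Definition opapp m x y z : Prop := exists p, is_pair p x y /\ inrel m p z.

Definition is_group G m : Prop :=
  is_set G /\ is_binop m G /\
  (forall x y z xy yz r r' : M,
     opapp m x y xy -> opapp m xy z r ->
     opapp m y z yz -> opapp m x yz r' -> r = r') /\
  (exists e, e ∈ G /\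
     (forall x, x ∈ G -> opapp m e x x /\ opapp m x e x) /\
     (forall x, x ∈ G -> exists y, y ∈ G /\ opapp m x y e /\ opapp m y x e)).

(** Subgroups of [(G, m)]: the operation of [(G, m)] restricts to a group
    operation on [H]. *)
Definition is_subgroup (H : M) G m : Prop :=
  is_set H /\ subset H G /\
  (exists e, e ∈ H /\
     (forall x, x ∈ G -> opapp m e x x /\ opapp m x e x) /\
     (forall x, x ∈ H -> exists y, y ∈ H /\ opapp m x y e /\ opapp m y x e)) /\
  (forall x y z, x ∈ H -> y ∈ H -> opapp m x y z -> z ∈ H).

Definition is_group_iso f G m (G' m' : M) : Prop :=
  is_bijection f G G' /\
  forall x y z x' y' z' : M,
    opapp m x y z -> inrel f x x' -> inrel f y y' -> inrel f z z' ->
    opapp m' x' y' z'.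

(** ** Graphs *)

Definition is_graph V E : Prop :=
  is_set V /\ is_relation E V V /\
  (forall x y, inrel E x y -> inrel E y x) /\
  (forall x, ~ inrel E x x).

Definition is_graph_iso f V E (V' E' : M) : Prop :=
  is_bijection f V V' /\
  forall x y x' y' : M,
    inrel f x x' -> inrel f y y' -> (inrel E x y <-> inrel E' x' y').

Definition is_automorphism g V E : Prop := is_graph_iso g V E V E.

(** [(G, c)] is the automorphism group of [(V, E)] under composition. *)
Definition is_aut_group V E G c : Prop :=
  is_set G /\ (forall g, g ∈ G <-> is_automorphism g V E) /\
  is_binop c G /\
  (forall g h k, opapp c g h k -> is_composite k g h).

Definition is_random_graph V E : Prop :=
  is_graph V E /\ is_countably_infinite V /\
  forall U W : M,
    is_set U -> is_set W -> subset U V -> subset W V ->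
    is_finite U -> is_finite W -> (forall x, ~ (x ∈ U /\ x ∈ W)) ->
    exists v, v ∈ V /\ ~ v ∈ U /\ ~ v ∈ W /\
      (forall u, u ∈ U -> inrel E v u) /\
      (forall w, w ∈ W -> ~ inrel E v w).

(** Frucht's Theorem, as a sentence evaluated in [M]. *)
Definition Frucht : Prop :=
  forall G m, is_group G m ->
    exists V E (Gam c : M) f,
      is_graph V E /\ is_aut_group V E Gam c /\ is_group_iso f G m Gam c.

(** ** The axioms of ZFA

    Only atoms are exempt from extensionality, so the sets asserted to exist
    are explicitly required not to be atoms.  Choice is not included. *)

Record ZFA : Prop := {
  zfa_atoms_empty : forall a x : M, atom a -> ~ x ∈ a;
  zfa_atoms_set : exists A : M, is_set A /\ forall x, x ∈ A <-> atom x;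
  zfa_extensionality : forall x y,
    is_set x -> is_set y -> (forall z, z ∈ x <-> z ∈ y) -> x = y;
  zfa_empty : exists e, is_empty e;
  zfa_pairing : forall x y, exists p, is_upair p x y;
  zfa_union : forall x, exists u,
    is_set u /\ forall z, z ∈ u <-> exists y, y ∈ x /\ z ∈ y;
  zfa_powerset : forall x, exists p,
    is_set p /\ forall z, z ∈ p <-> is_set z /\ subset z x;
  zfa_infinity : exists w, is_inductive w;
  zfa_foundation : forall x,
    (exists y, y ∈ x) -> exists y, y ∈ x /\ forall z, z ∈ x -> ~ z ∈ y;
  zfa_separation : forall (phi : formula) (env : nat -> M) x, exists y,
    is_set y /\ forall z, z ∈ y <-> z ∈ x /\ sat (scons z env) phi;
  zfa_replacement : forall (phi : formula) (env : nat -> M) x,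
    (forall u v v' : M, u ∈ x ->
       sat (scons u (scons v env)) phi ->
       sat (scons u (scons v' env)) phi -> v = v') ->
    exists y, is_set y /\
      forall v, v ∈ y <-> exists u, u ∈ x /\ sat (scons u (scons v env)) phi
}.

(** ** Action of permutations of the atoms, and symmetric sets *)

(** [acts pi x y] says [pi[x] = y].  The recursion is carried out inside [M]:
    [h] is an attempt at the recursion on a transitive set [t] containing [x]. *)
Definition acts (pi x y : M) : Prop :=
  exists t h : M,
    is_transitive t /\ x ∈ t /\
    (forall s, s ∈ t -> exists! r : M, inrel h s r) /\
    (forall s r : M, s ∈ t -> inrel h s r ->
       (atom s -> inrel pi s r) /\
       (is_set s ->
          is_set r /\ forall z, z ∈ r <-> exists v, v ∈ s /\ inrel h v z)) /\
    inrel h x y.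

Definition is_stab (K Sigma x : M) : Prop :=
  is_set K /\ forall pi : M, pi ∈ K <-> pi ∈ Sigma /\ acts pi x x.

(** [F] is the filter of subgroups of [(Sigma, c)] generated by the [Stab(a)]
    for [a ∈ A]. *)
Definition is_atom_stab_filter (F A Sigma c : M) : Prop :=
  is_set F /\
  forall H : M, H ∈ F <->
    is_subgroup H Sigma c /\
    exists e, is_set e /\ subset e A /\ is_finite e /\
      forall pi : M, pi ∈ Sigma ->
        (forall a K : M, a ∈ e -> is_stab K Sigma a -> pi ∈ K) -> pi ∈ H.

Definition symmetric (Sigma F x : M) : Prop :=
  exists K : M, is_stab K Sigma x /\ K ∈ F.

Definition hereditarily_symmetric (Sigma F x : M) : Prop :=
  symmetric Sigma F x /\ forall y, in_trcl y x -> symmetric Sigma F y.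

(** The substructure of hereditarily symmetric elements.  Equality in it agrees
    with equality in [M] by proof irrelevance. *)
Definition permutation_model (Sigma F : M) : structure :=
  {| carrier := {x : M | hereditarily_symmetric Sigma F x};
     mem := fun a b => proj1_sig a ∈ proj1_sig b;
     atom := fun a => atom (proj1_sig a) |}.

End Internal.

(* Main.v *)
From Corelib Require Import ssreflect.
From Stdlib Require Import FunctionalExtensionality ClassicalEpsilon Classical Lia.
Require Import Defs.
Set Implicit Arguments.
Unset Strict Implicit.

(** Frucht's theorem holds wherever the atoms carry a rigid relation, and the
    random graph is rigid in its permutation model.

    _Rigidity_ ([random_rigid]). Let [g] be an automorphism of the random graph
    that belongs to the permutation model, and let the finite set [e] of atoms
    support it. Then [g] commutes with every automorphism fixing [e] pointwise.
    By homogeneity ([moving_automorphism], a back-and-forth argument) some such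
    automorphism moves a given [a] outside [e] and fixes [g a], unless
    [g a = a]; hence [g] fixes every point outside [e]. By the extension
    property two different points are separated by a neighbour outside [e],
    so [g] is the identity. The graph itself belongs to the model because the
    acting group preserves it.

    _Frucht's theorem from a rigid relation_ ([frucht_of_rigid]). Let [T] be a
    transitive set that contains a group [G] and the atoms. Membership together
    with the rigid relation on the atoms makes [T] a rigid digraph: an
    automorphism is trivial on the atoms, and then everywhere by induction along
    membership ([T_rigid]). So the elements of [G], seen as points of [T], can
    serve as the colours of the Cayley digraph of [G], and the automorphisms of
    this coloured digraph are the left translations ([digraph_full]). A digraph
    is turned into a graph with the same automorphisms by three copies of each
    point and four auxiliary vertices ([gadget_automorphism],
    [frucht_of_digraph]).

    The second part is carried out in an arbitrary structure satisfying the
    axioms [Zer] and [has_closures], and the permutation model satisfies these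
    ([model_Zer], [model_closures]). What makes this work is that an automorphism
    [s] of the graph acts on the model as an automorphism of the structure, so a
    formula whose parameters are fixed by [s] defines, inside a set fixed by [s],
    a subset fixed by [s] ([model_separation]).

    Sets are obtained from separation and replacement for first-order formulas.
    The predicate [Dfn] says that a predicate on assignments is the satisfaction
    of some formula with parameters; its closure properties mirror the syntax
    of formulas, so the tactic [dfn] proves definability by following the shape
    of the predicate. *)

(** * Definability with parameters *)

Definition up (r : nat -> nat) (n : nat) : nat :=
  match n with 0 => 0 | S k => S (r k) end.

Fixpoint rename (r : nat -> nat) (p : formula) : formula :=
  match p with
  | fMem i j => fMem (r i) (r j)
  | fEq i j => fEq (r i) (r j)
  | fAtom i => fAtom (r i)
  | fFalse => fFalse
  | fImp p q => fImp (rename r p) (rename r q)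
  | fAnd p q => fAnd (rename r p) (rename r q)
  | fOr p q => fOr (rename r p) (rename r q)
  | fAll p => fAll (rename (up r) p)
  | fEx p => fEx (rename (up r) p)
  end.

Lemma scons_up (T : Type) (x : T) r (e : nat -> T) :
  (fun n => scons x e (up r n)) = scons x (fun n => e (r n)).
Proof. by apply: functional_extensionality; case. Qed.

Lemma sat_rename (M : structure) p : forall (r : nat -> nat) (e : nat -> M),
  sat e (rename r p) <-> sat (fun n => e (r n)) p.
Proof.
  elim: p => //=; try by move=> *; tauto.
  - move=> p IHp q IHq r e; rewrite IHp IHq; tauto.
  - move=> p IHp q IHq r e; rewrite IHp IHq; tauto.
  - move=> p IHp q IHq r e; rewrite IHp IHq; tauto.
  - by move=> p IHp r e; split=> H x; move: (H x); rewrite IHp scons_up.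
  - by move=> p IHp r e; split=> -[x H]; exists x; move: H; rewrite IHp scons_up.
Qed.

(** The variables and the parameters of a formula share one assignment: the
    former sit at the even places and the latter at the odd ones. *)
Fixpoint merge (T : Type) (e p : nat -> T) (n : nat) : T :=
  match n with
  | 0 => e 0
  | 1 => p 0
  | S (S n) => merge (fun k => e (S k)) (fun k => p (S k)) n
  end.

Fixpoint dbl n := match n with 0 => 0 | S k => S (S (dbl k)) end.

Lemma merge_even T i : forall e p : nat -> T, merge e p (dbl i) = e i.
Proof. by elim: i => //= i IH e p; rewrite IH. Qed.

Lemma merge_odd T i : forall e p : nat -> T, merge e p (S (dbl i)) = p i.
Proof. by elim: i => // i IH e p; exact: IH. Qed.

Lemma merge_comp T U (h : T -> U) n : forall e p : nat -> T,
  h (merge e p n) = merge (fun k => h (e k)) (fun k => h (p k)) n.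
Proof.
  suff [//] : (forall e p : nat -> T,
      h (merge e p n) = merge (fun k => h (e k)) (fun k => h (p k)) n) /\
    (forall e p : nat -> T, h (merge e p (S n)) =
      merge (fun k => h (e k)) (fun k => h (p k)) (S n)).
  elim: n => [|n [IH1 IH2]]; split=> // e p.
  exact: IH1.
Qed.

Lemma merge_ren T (h : nat -> T) (f g : nat -> nat) :
  (fun n => h (merge f g n)) = merge (fun i => h (f i)) (fun i => h (g i)).
Proof. by apply: functional_extensionality => n; rewrite (merge_comp h). Qed.

Lemma merge_eq T (e e' p p' : nat -> T) :
  (forall n, e n = e' n) -> (forall n, p n = p' n) -> merge e p = merge e' p'.
Proof.
  by move=> /(functional_extensionality e e') -> /(functional_extensionality p p') ->.
Qed.

Section Definability.
Variable M : structure.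
Implicit Types (P Q : (nat -> M) -> Prop) (t u v : (nat -> M) -> M).

(** [P e] is the satisfaction, under the assignment [e], of some formula with
    parameters. The premise [M] supplies parameters to formulas that have none. *)
Definition Dfn P : Prop :=
  M -> exists phi (ps : nat -> M), forall e, P e <-> sat (merge e ps) phi.

(** A term is definable when its graph is, variable [0] being the value. *)
Definition DT t : Prop := Dfn (fun e => e 0 = t (fun n => e (S n))).

Lemma Dfn_ext P Q : (forall e, P e <-> Q e) -> Dfn P -> Dfn Q.
Proof.
  move=> H HP m; have [phi [ps Hphi]] := HP m; exists phi, ps => e.
  by rewrite -H.
Qed.

Lemma Dfn_binary (op : formula -> formula -> formula) (o : Prop -> Prop -> Prop) P Q :
  (forall e p q, sat (M := M) e (op p q) <-> o (sat e p) (sat e q)) ->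
  (forall r p q, rename r (op p q) = op (rename r p) (rename r q)) ->
  (forall A B A' B' : Prop, (A <-> A') -> (B <-> B') -> (o A B <-> o A' B')) ->
  Dfn P -> Dfn Q -> Dfn (fun e => o (P e) (Q e)).
Proof.
  move=> Hop _ Hcongr HP HQ m.
  have [p [ps Hp]] := HP m; have [q [qs Hq]] := HQ m.
  exists (op (rename (merge dbl (fun i => S (dbl (dbl i)))) p)
        (rename (merge dbl (fun i => S (dbl (S (dbl i))))) q)), (merge ps qs) => e.
  rewrite Hop; apply: Hcongr; rewrite ?Hp ?Hq sat_rename.
  all: rewrite merge_ren; set e1 := merge e _; set e2 := merge _ _.
  all: have -> // : e1 = e2; apply: merge_eq => n.
  all: by rewrite ?merge_odd ?merge_even ?merge_odd.
Qed.

Lemma Dfn_and P Q : Dfn P -> Dfn Q -> Dfn (fun e => P e /\ Q e).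
Proof. apply: (@Dfn_binary fAnd and) => //; tauto. Qed.

Lemma Dfn_or P Q : Dfn P -> Dfn Q -> Dfn (fun e => P e \/ Q e).
Proof. apply: (@Dfn_binary fOr or) => //; tauto. Qed.

Lemma Dfn_imp P Q : Dfn P -> Dfn Q -> Dfn (fun e => P e -> Q e).
Proof. apply: (@Dfn_binary fImp (fun A B : Prop => A -> B)) => //; tauto. Qed.

Lemma Dfn_iff P Q : Dfn P -> Dfn Q -> Dfn (fun e => P e <-> Q e).
Proof. by move=> HP HQ; apply: Dfn_and; apply: Dfn_imp. Qed.

Lemma Dfn_False : Dfn (fun _ => False).
Proof. by move=> m; exists fFalse, (fun _ => m). Qed.

Lemma Dfn_not P : Dfn P -> Dfn (fun e => ~ P e).
Proof. move=> HP; apply: Dfn_imp => //; exact: Dfn_False. Qed.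

(** Adding a variable in front shifts the even places by two, whereas under a
    binder all places shift by one; this renaming mediates. *)
Definition mu := merge (fun i => match i with 0 => 0 | S i => S (dbl i) end)
  (fun i => S (S (dbl i))).

Lemma merge_scons x (e ps : nat -> M) :
  (fun n => scons x (merge e ps) (mu n)) = merge (scons x e) ps.
Proof.
  rewrite merge_ren; apply: merge_eq.
  - by case=> [|k] //; exact: merge_even.
  - by move=> k; exact: merge_odd.
Qed.

Lemma Dfn_formula1 (P : M -> Prop) : Dfn (fun e => P (e 0)) -> M ->
  exists phi env, forall z : M, P z <-> sat (scons z env) phi.
Proof.
  move=> HP m; have [p [ps Hp]] := HP m.
  exists (rename mu p), (merge (fun _ => m) ps) => z.
  by rewrite sat_rename merge_scons -Hp.
Qed.

Lemma Dfn_formula2 (R : M -> M -> Prop) : Dfn (fun e => R (e 0) (e 1)) -> M ->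
  exists phi env, forall u v : M, R u v <-> sat (scons u (scons v env)) phi.
Proof.
  move=> HR m; have [p [ps Hp]] := HR m.
  exists (rename (up mu) (rename mu p)), (merge (fun _ => m) ps) => u v.
  by rewrite sat_rename scons_up merge_scons sat_rename merge_scons -Hp.
Qed.

Lemma Dfn_all (P : M -> (nat -> M) -> Prop) :
  Dfn (fun e => P (e 0) (fun n => e (S n))) -> Dfn (fun e => forall x, P x e).
Proof.
  move=> HP m; have [p [ps Hp]] := HP m.
  exists (fAll (rename mu p)), ps => e /=.
  split=> H x; [rewrite sat_rename merge_scons -Hp | move: (H x); rewrite sat_rename merge_scons -Hp] => //.
  exact: H.
Qed.

Lemma Dfn_ex (P : M -> (nat -> M) -> Prop) :
  Dfn (fun e => P (e 0) (fun n => e (S n))) -> Dfn (fun e => exists x, P x e).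
Proof.
  move=> HP m; have [p [ps Hp]] := HP m.
  exists (fEx (rename mu p)), ps => e /=.
  split=> -[x H]; exists x; move: H; rewrite sat_rename merge_scons -Hp //.
Qed.

Lemma Dfn_ren P (r : nat -> nat) : Dfn P -> Dfn (fun e => P (fun n => e (r n))).
Proof.
  move=> HP m; have [p [ps Hp]] := HP m.
  exists (rename (merge (fun i => dbl (r i)) (fun i => S (dbl i))) p), ps => e.
  rewrite Hp sat_rename merge_ren.
  have -> // : merge (fun n => e (r n)) ps = merge (fun i => merge e ps (dbl (r i)))
    (fun i => merge e ps (S (dbl i))).
  by apply: merge_eq => n; rewrite ?merge_odd ?merge_even.
Qed.

(** For separation, all variables but [0] are turned into parameters. *)
Lemma Dfn_freeze P (e0 : nat -> M) : Dfn P -> Dfn (fun e => P (scons (e 0) e0)).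
Proof.
  move=> HP m; have [p [ps Hp]] := HP m.
  exists (rename (merge (fun i => match i with 0 => 0 | S i => S (dbl (S (dbl i))) end)
    (fun i => S (dbl (dbl i)))) p), (merge ps e0) => e.
  rewrite Hp sat_rename merge_ren.
  set e1 := merge _ ps; set e2 := merge _ _.
  have -> // : e1 = e2.
  apply: merge_eq => [[|n]|n] //; rewrite merge_odd ?merge_even //.
  by rewrite merge_odd.
Qed.

Lemma DT_ren t (r : nat -> nat) : DT t -> DT (fun e => t (fun n => e (r n))).
Proof. exact: (@Dfn_ren _ (up r)). Qed.

Lemma DT_shift t : DT t -> DT (fun e => t (fun n => e (S n))).
Proof. exact: DT_ren. Qed.

Lemma DT_var i : DT (fun e => e i).
Proof.
  move=> m; exists (fEq 0 (dbl (S i))), (fun _ => m) => e.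
  by rewrite /= merge_even.
Qed.

Lemma DT_const c : DT (fun _ => c).
Proof. by move=> m; exists (fEq 0 1), (fun _ => c). Qed.

(** [P (t e) e] holds iff [P x e] does for some [x] equal to [t e]. So it suffices
    to treat predicates applied to variables. *)
Lemma Dfn_sub (P : M -> (nat -> M) -> Prop) t :
  DT t -> Dfn (fun e => P (e 0) (fun n => e (S n))) -> Dfn (fun e => P (t e) e).
Proof.
  move=> Ht HP.
  apply: (@Dfn_ext (fun e => exists x, x = t e /\ P x e)).
  - by move=> e; split=> [[x [-> //]]|H]; exists (t e).
  - by apply: Dfn_ex; apply: Dfn_and.
Qed.

Lemma Dfn_mem t u : DT t -> DT u -> Dfn (fun e => t e ∈ u e).
Proof.
  move=> Ht Hu.
  apply: (@Dfn_sub (fun x e => x ∈ u e)) => //.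
  apply: (@Dfn_sub (fun y e => e 0 ∈ y)); first exact: DT_shift.
  move=> m; exists (fMem 2 0), (fun _ => m) => e //.
Qed.

Lemma Dfn_eq t u : DT t -> DT u -> Dfn (fun e => t e = u e).
Proof.
  move=> Ht Hu.
  apply: (@Dfn_sub (fun x e => x = u e)) => //.
Qed.

Lemma Dfn_atom t : DT t -> Dfn (fun e => atom (t e)).
Proof.
  move=> Ht.
  apply: (@Dfn_sub (fun x e => atom x)) => //.
  by move=> m; exists (fAtom 0), (fun _ => m).
Qed.

Lemma Dfn1_app (P : M -> Prop) t :
  Dfn (fun e => P (e 0)) -> DT t -> Dfn (fun e => P (t e)).
Proof. by move=> HP Ht; apply: (@Dfn_sub (fun x e => P x)). Qed.

Lemma Dfn2_app (P : M -> M -> Prop) t u :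
  Dfn (fun e => P (e 0) (e 1)) -> DT t -> DT u -> Dfn (fun e => P (t e) (u e)).
Proof.
  move=> HP Ht Hu; apply: (@Dfn_sub (fun x e => P x (u e))) => //.
  apply: (@Dfn_sub (fun y e => P (e 0) y)); first exact: DT_shift.
  exact: (@Dfn_ren (fun e => P (e 0) (e 1)) (fun n => match n with 0 => 1 | _ => 0 end)).
Qed.

Lemma Dfn3_app (P : M -> M -> M -> Prop) t u v :
  Dfn (fun e => P (e 0) (e 1) (e 2)) -> DT t -> DT u -> DT v ->
  Dfn (fun e => P (t e) (u e) (v e)).
Proof.
  move=> HP Ht Hu Hv; apply: (@Dfn_sub (fun x e => P x (u e) (v e))) => //.
  apply: (@Dfn_sub (fun y e => P (e 0) y (v (fun n => e (S n))))); first exact: DT_shift.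
  apply: (@Dfn_sub (fun y e => P (e 1) (e 0) y)); first exact: (DT_shift (DT_shift Hv)).
  exact: (@Dfn_ren (fun e => P (e 0) (e 1) (e 2))
    (fun n => match n with 0 => 2 | 1 => 1 | _ => 0 end)).
Qed.

Lemma DT_fun1 (S : M -> M -> Prop) (f : M -> M) t :
  (forall z x, z = f x <-> S z x) -> Dfn (fun e => S (e 0) (e 1)) ->
  DT t -> DT (fun e => f (t e)).
Proof.
  move=> Hf HS Ht.
  apply: (@Dfn_ext (fun e => S (e 0) (t (fun n => e (Datatypes.S n))))) => [e|].
  - by rewrite Hf.
  - apply: (Dfn2_app HS); [exact: DT_var | exact: DT_shift].
Qed.

Lemma DT_fun2 (S : M -> M -> M -> Prop) (f : M -> M -> M) t u :
  (forall z x y, z = f x y <-> S z x y) -> Dfn (fun e => S (e 0) (e 1) (e 2)) ->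
  DT t -> DT u -> DT (fun e => f (t e) (u e)).
Proof.
  move=> Hf HS Ht Hu.
  apply: (@Dfn_ext (fun e => S (e 0) (t (fun n => e (Datatypes.S n)))
                       (u (fun n => e (Datatypes.S n))))) => [e|].
  - by rewrite Hf.
  - apply: (Dfn3_app HS); [exact: DT_var | exact: DT_shift | exact: DT_shift].
Qed.

End Definability.

(** [dfn] reduces definability to that of the abstract predicates and terms in the
    goal, unfolding definitions by unification; [dfn_terms] is extended with the
    set-theoretic operations once they are known to be definable. *)
Ltac dfn_terms := fail.
Ltac dfn_step :=
  lazymatch goal with
  | |- DT _ =>
    first [ assumption | apply DT_const | apply DT_var | dfn_terms
          | match goal with |- DT (fun e => ?t (fun n => e (@?r n))) =>
              apply (@DT_ren _ t r) end ]
  | |- Dfn _ =>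
    first [ assumption | apply Dfn_mem | apply Dfn_eq | apply Dfn_atom
          | apply Dfn_and | apply Dfn_or | apply Dfn_not | apply Dfn_iff
          | apply Dfn_imp | apply Dfn_False | apply Dfn_all | apply Dfn_ex ]
  end.
Ltac dfn := repeat (cbn beta; dfn_step).

(** * Set theory in a structure with separation *)

(** What the construction of graphs needs from a structure. Separation is stated
    for definable classes. *)
Record Zer (N : structure) : Prop := {
  z_atoms_empty : forall a x : N, atom a -> ~ x ∈ a;
  z_ext : forall x y : N,
    is_set x -> is_set y -> (forall z, z ∈ x <-> z ∈ y) -> x = y;
  z_empty : exists e : N, is_empty e;
  z_pairing : forall x y : N, exists p, is_upair p x y;
  z_union : forall x : N, exists u,
    is_set u /\ forall z, z ∈ u <-> exists y, y ∈ x /\ z ∈ y;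
  z_power : forall x : N, exists p,
    is_set p /\ forall z, z ∈ p <-> is_set z /\ subset z x;
  z_found : forall x : N,
    (exists y, y ∈ x) -> exists y, y ∈ x /\ forall z, z ∈ x -> ~ z ∈ y;
  z_sep : forall P : N -> Prop, Dfn (fun e => P (e 0)) -> forall x, exists y,
    is_set y /\ forall z, z ∈ y <-> z ∈ x /\ P z
}.

Definition has_closures (N : structure) : Prop :=
  forall x : N, exists t, is_set t /\ is_transitive t /\ subset x t.

(** The operations are total, by Hilbert's choice operator, so that sets can be
    named by terms and the relational notions turn into equations. *)
Section Operations.
Variable N : structure.
Implicit Types x y z X Y : N.
Definition the (m : N) (P : N -> Prop) : N := epsilon (inhabits m) P.
Definition upair x y := the x (fun p => is_upair p x y).
Definition pair x y := upair (upair x x) (upair x y).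
Definition bigcup x :=
  the x (fun u => is_set u /\ forall z, z ∈ u <-> exists y, y ∈ x /\ z ∈ y).
Definition pow x := the x (fun p => is_set p /\ forall z, z ∈ p <-> is_set z /\ subset z x).
Definition cup x y := bigcup (upair x y).
Definition adjoin x y := cup x (upair y y).
Definition sep x (P : N -> Prop) :=
  the x (fun y => is_set y /\ forall z, z ∈ y <-> z ∈ x /\ P z).
Definition prod X Y :=
  sep (pow (pow (cup X Y))) (fun z => exists x y, x ∈ X /\ y ∈ Y /\ z = pair x y).
(** The part of a binary relation that lies in [X × Y]. *)
Definition graph X Y (R : N -> N -> Prop) :=
  sep (prod X Y) (fun p => exists x y, R x y /\ p = pair x y).
End Operations.

Section ZerTheory.
Variable N : structure.
Hypothesis HN : Zer N.
Implicit Types x y z u v w p X Y f g : N.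

Lemma mem_set x y : x ∈ y -> is_set y.
Proof. by move=> Hxy /(z_atoms_empty HN) H; case: (H _ Hxy). Qed.

Lemma set_ext x y : is_set x -> is_set y -> (forall z, z ∈ x <-> z ∈ y) -> x = y.
Proof. exact: (z_ext HN). Qed.

Definition emp : N := proj1_sig (constructive_indefinite_description _ (z_empty HN)).
Lemma emp_empty : is_empty emp.
Proof. exact: (proj2_sig (constructive_indefinite_description _ (z_empty HN))). Qed.
Lemma emp_set : is_set emp. Proof. exact: (proj1 emp_empty). Qed.
Lemma empP z : ~ z ∈ emp. Proof. exact: (proj2 emp_empty). Qed.

Lemma upair_spec x y : is_upair (upair x y) x y.
Proof. exact: (epsilon_spec (inhabits x) _ (z_pairing HN x y)). Qed.
Lemma upair_set x y : is_set (upair x y). Proof. exact: (proj1 (upair_spec x y)). Qed.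
Lemma upairP x y z : z ∈ upair x y <-> z = x \/ z = y.
Proof. exact: (proj2 (upair_spec x y)). Qed.

Lemma is_upairE p x y : is_upair p x y <-> p = upair x y.
Proof.
  split=> [[H1 H2]|->]; last exact: upair_spec.
  by apply: set_ext => // [|z]; [exact: upair_set | rewrite H2 upairP].
Qed.

Lemma is_pairE p x y : is_pair p x y <-> p = pair x y.
Proof.
  split=> [[u [v []]]|->].
  - by rewrite !is_upairE => -> [-> ->].
  - by exists (upair x x), (upair x y); rewrite !is_upairE.
Qed.

Lemma inrelE R x y : inrel R x y <-> pair x y ∈ R.
Proof.
  split=> [[p [/is_pairE -> //]]|H]; exists (pair x y).
  by rewrite is_pairE.
Qed.

Lemma opappE m x y z : opapp m x y z <-> pair (pair x y) z ∈ m.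
Proof.
  split=> [[p [/is_pairE -> /inrelE //]]|H]; exists (pair x y).
  by rewrite is_pairE inrelE.
Qed.

Lemma upair_inj x y x' y' : upair x y = upair x' y' ->
  (x = x' /\ y = y') \/ (x = y' /\ y = x').
Proof.
  move=> H.
  have E z : z = x \/ z = y <-> z = x' \/ z = y' by rewrite -!upairP H.
  move: (proj1 (E x) (or_introl eq_refl)) (proj1 (E y) (or_intror eq_refl))
    (proj2 (E x') (or_introl eq_refl)) (proj2 (E y') (or_intror eq_refl)).
  by case=> ? [?|?] [?|?] [?|?]; subst; auto.
Qed.

Lemma pair_inj x y x' y' : pair x y = pair x' y' -> x = x' /\ y = y'.
Proof.
  case/upair_inj => -[/upair_inj H1 /upair_inj H2].
  - by case: H1 H2 => -[? ?] [[? ?]|[? ?]]; subst.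
  - by case: H1 H2 => -[? ?] [[? ?]|[? ?]]; subst.
Qed.

Lemma pair_set x y : is_set (pair x y). Proof. exact: upair_set. Qed.

Lemma bigcup_spec x : is_set (bigcup x) /\ forall z, z ∈ bigcup x <-> exists y, y ∈ x /\ z ∈ y.
Proof. exact: (epsilon_spec (inhabits x) _ (z_union HN x)). Qed.
Lemma bigcup_set x : is_set (bigcup x). Proof. exact: (proj1 (bigcup_spec x)). Qed.
Lemma bigcupP x z : z ∈ bigcup x <-> exists y, y ∈ x /\ z ∈ y.
Proof. exact: (proj2 (bigcup_spec x)). Qed.

Lemma pow_spec x : is_set (pow x) /\ forall z, z ∈ pow x <-> is_set z /\ subset z x.
Proof. exact: (epsilon_spec (inhabits x) _ (z_power HN x)). Qed.
Lemma pow_set x : is_set (pow x). Proof. exact: (proj1 (pow_spec x)). Qed.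
Lemma powP x z : z ∈ pow x <-> is_set z /\ subset z x.
Proof. exact: (proj2 (pow_spec x)). Qed.

Lemma cup_set x y : is_set (cup x y). Proof. exact: bigcup_set. Qed.
Lemma cupP x y z : z ∈ cup x y <-> z ∈ x \/ z ∈ y.
Proof.
  rewrite bigcupP; split=> [[w [/upairP [->|->]]]|[H|H]]; auto.
  - by exists x; rewrite upairP; auto.
  - by exists y; rewrite upairP; auto.
Qed.

Lemma adjoin_set x y : is_set (adjoin x y). Proof. exact: cup_set. Qed.
Lemma adjoinP x y z : z ∈ adjoin x y <-> z ∈ x \/ z = y.
Proof. by rewrite cupP upairP; tauto. Qed.

Lemma DT_upair (t u : (nat -> N) -> N) : DT t -> DT u -> DT (fun e => upair (t e) (u e)).
Proof.
  apply: (@DT_fun2 _ (@is_upair N)) => [z x y|]; first by rewrite is_upairE.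
  dfn.
Qed.
Lemma DT_pair (t u : (nat -> N) -> N) : DT t -> DT u -> DT (fun e => pair (t e) (u e)).
Proof. by move=> Ht Hu; do !apply: DT_upair. Qed.
Lemma DT_bigcup (t : (nat -> N) -> N) : DT t -> DT (fun e => bigcup (t e)).
Proof.
  apply: (@DT_fun1 _ (fun u x => is_set u /\ forall z, z ∈ u <-> exists y, y ∈ x /\ z ∈ y)) => [z x|].
  - split=> [->|[H1 H2]]; first exact: bigcup_spec.
    by apply: set_ext => // [|w]; [exact: bigcup_set | rewrite H2 bigcupP].
  - dfn.
Qed.
Lemma DT_cup (t u : (nat -> N) -> N) : DT t -> DT u -> DT (fun e => cup (t e) (u e)).
Proof. by move=> Ht Hu; apply: DT_bigcup; apply: DT_upair. Qed.
Lemma DT_adjoin (t u : (nat -> N) -> N) : DT t -> DT u -> DT (fun e => adjoin (t e) (u e)).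
Proof. by move=> Ht Hu; apply: DT_cup => //; apply: DT_upair. Qed.
Lemma DT_pow (t : (nat -> N) -> N) : DT t -> DT (fun e => pow (t e)).
Proof.
  apply: (@DT_fun1 _ (fun u x => is_set u /\ forall z, z ∈ u <-> is_set z /\ subset z x)) => [z x|].
  - split=> [->|[H1 H2]]; first exact: pow_spec.
    by apply: set_ext => // [|w]; [exact: pow_set | rewrite H2 powP].
  - dfn.
Qed.

Section Sep.
Variable P : N -> Prop.
Hypothesis HP : Dfn (fun e => P (e 0)).
Lemma sep_spec x : is_set (sep x P) /\ forall z, z ∈ sep x P <-> z ∈ x /\ P z.
Proof. exact: (epsilon_spec (inhabits x) _ (z_sep HN HP x)). Qed.
Lemma sep_set x : is_set (sep x P). Proof. exact: (proj1 (sep_spec x)). Qed.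
Lemma sepP x z : z ∈ sep x P <-> z ∈ x /\ P z.
Proof. exact: (proj2 (sep_spec x)). Qed.
End Sep.

Lemma Dfn_prod_pred X Y : Dfn (fun e => exists x y : N, x ∈ X /\ y ∈ Y /\ e 0 = pair x y).
Proof. dfn; apply: DT_pair; dfn. Qed.

Lemma prod_set X Y : is_set (prod X Y).
Proof. exact: (sep_set (Dfn_prod_pred X Y)). Qed.

Lemma prodP X Y z : z ∈ prod X Y <-> exists x y, x ∈ X /\ y ∈ Y /\ z = pair x y.
Proof.
  rewrite (sepP (Dfn_prod_pred X Y)).
  split=> [[] //|H]; split=> //; case: H => x [y [Hx [Hy ->]]].
  rewrite powP; split=> [|u]; first exact: pair_set.
  rewrite upairP powP => -[->|->]; (split; first exact: upair_set) => v; rewrite upairP cupP.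
  - by case=> ->; auto.
  - by case=> ->; auto.
Qed.

Lemma pair_prod X Y x y : pair x y ∈ prod X Y <-> x ∈ X /\ y ∈ Y.
Proof.
  rewrite prodP; split=> [[x' [y' [Hx [Hy /pair_inj [-> ->]]]]]|[Hx Hy]] //.
  by exists x, y.
Qed.

Lemma is_productE p X Y : is_product p X Y <-> p = prod X Y.
Proof.
  split=> [[H1 H2]|->].
  - apply: set_ext => // [|z]; first exact: prod_set.
    rewrite H2 prodP; split=> -[x [y [Hx [Hy /is_pairE Hz]]]]; by exists x, y.
  - split; first exact: prod_set.
    move=> z; rewrite prodP; split=> -[x [y [Hx [Hy Hz]]]]; exists x, y; move: Hz; by rewrite is_pairE.
Qed.

Lemma DT_prod (t u : (nat -> N) -> N) : DT t -> DT u -> DT (fun e => prod (t e) (u e)).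
Proof.
  apply: (@DT_fun2 _ (@is_product N)) => [z x y|]; first by rewrite is_productE.
  dfn.
Qed.

Section Graphs.
Variable R : N -> N -> Prop.
Hypothesis HR : Dfn (fun e => R (e 0) (e 1)).
Lemma Dfn_graph_pred : Dfn (fun e => exists x y, R x y /\ e 0 = pair x y).
Proof. dfn; [apply: (Dfn2_app HR); dfn | apply: DT_pair; dfn]. Qed.
Lemma graph_set X Y : is_set (graph X Y R).
Proof. exact: (sep_set Dfn_graph_pred). Qed.
Lemma graphP X Y x y : pair x y ∈ graph X Y R <-> x ∈ X /\ y ∈ Y /\ R x y.
Proof.
  rewrite (sepP Dfn_graph_pred).
  rewrite pair_prod; split=> [[[Hx Hy] [x' [y' [H /pair_inj [E1 E2]]]]]|[Hx [Hy H]]].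
  - by subst.
  - by do !split=> //; exists x, y.
Qed.
Lemma graph_pairs X Y p : p ∈ graph X Y R -> exists x y, x ∈ X /\ y ∈ Y /\ p = pair x y.
Proof. by rewrite (sepP Dfn_graph_pred) => -[/prodP]. Qed.
End Graphs.

Lemma is_relationE R X Y : is_relation R X Y <->
  is_set R /\ forall p, p ∈ R -> exists x y, x ∈ X /\ y ∈ Y /\ p = pair x y.
Proof.
  split=> -[H1 H2]; split=> // p /H2 [x [y [Hx [Hy /is_pairE H]]]]; by exists x, y.
Qed.

Lemma rel_dom R X Y x y : is_relation R X Y -> pair x y ∈ R -> x ∈ X /\ y ∈ Y.
Proof. by move=> /is_relationE [_ H] /H [x' [y' [? [? /pair_inj [-> ->]]]]]. Qed.

Lemma rel_ext R R' X Y : is_relation R X Y -> is_relation R' X Y ->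
  (forall x y, pair x y ∈ R <-> pair x y ∈ R') -> R = R'.
Proof.
  move=> /is_relationE [H1 H2] /is_relationE [H3 H4] H; apply: set_ext => // p.
  split=> [Hp|Hp]; [case: (H2 _ Hp)|case: (H4 _ Hp)] => x [y [_ [_ E]]]; move: Hp;
    by rewrite E H.
Qed.

(** [is_function] and [is_bijection] in terms of the operation [pair]. *)
Record fun_spec f X Y : Prop := {
  fs_rel : is_relation f X Y;
  fs_ex : forall x, x ∈ X -> exists y, pair x y ∈ f;
  fs_fun : forall x y y', pair x y ∈ f -> pair x y' ∈ f -> y = y'
}.

Lemma is_functionE f X Y : is_function f X Y <-> fun_spec f X Y.
Proof.
  split=> [[Hf H]|[Hf Hex Hfun]]; split=> //.
  - by move=> x /H [y [/inrelE Hy _]]; exists y.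
  - move=> x y y' Hy Hy'; have [Hx _] := rel_dom Hf Hy.
    have [z [_ Hz]] := H _ Hx.
    by rewrite -(Hz y) ?inrelE // -(Hz y') ?inrelE.
  - move=> x /Hex [y Hy]; exists y; split; first by rewrite inrelE.
    by move=> y' /inrelE; exact: Hfun.
Qed.

Record bij_spec f X Y : Prop := {
  bs_rel : is_relation f X Y;
  bs_ex : forall x, x ∈ X -> exists y, pair x y ∈ f;
  bs_fun : forall x y y', pair x y ∈ f -> pair x y' ∈ f -> y = y';
  bs_inj : forall x x' y, pair x y ∈ f -> pair x' y ∈ f -> x = x';
  bs_onto : forall y, y ∈ Y -> exists x, pair x y ∈ f
}.

Lemma is_injectionE f X Y : is_injection f X Y <-> 
  fun_spec f X Y /\ forall x x' y, pair x y ∈ f -> pair x' y ∈ f -> x = x'.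
Proof.
  rewrite /is_injection is_functionE.
  split=> -[H H']; split=> // x x' y; have := H' x x' y; by rewrite !inrelE.
Qed.

Lemma is_bijectionE f X Y : is_bijection f X Y <-> bij_spec f X Y.
Proof.
  rewrite /is_bijection is_injectionE.
  split=> [[[[H1 H2 H3] H4] H5]|[H1 H2 H3 H4 H5]]; do !split=> //.
  - by move=> y /H5 [x /inrelE]; exists x.
  - by move=> y /H5 [x /inrelE]; exists x.
Qed.

Lemma bs_dom f X Y x y : bij_spec f X Y -> pair x y ∈ f -> x ∈ X /\ y ∈ Y.
Proof. by move=> /bs_rel; exact: rel_dom. Qed.

Lemma graph_rel X Y (R : N -> N -> Prop) :
  Dfn (fun e => R (e 0) (e 1)) -> is_relation (graph X Y R) X Y.
Proof. 
  move=> HR; rewrite is_relationE; split; first exact: graph_set.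
  by move=> p; exact: graph_pairs.
Qed.

Lemma graph_bij X Y (R : N -> N -> Prop) :
  Dfn (fun e => R (e 0) (e 1)) ->
  (forall x, x ∈ X -> exists y, y ∈ Y /\ R x y) ->
  (forall x y y', x ∈ X -> y ∈ Y -> y' ∈ Y -> R x y -> R x y' -> y = y') ->
  (forall x x' y, x ∈ X -> x' ∈ X -> y ∈ Y -> R x y -> R x' y -> x = x') ->
  (forall y, y ∈ Y -> exists x, x ∈ X /\ R x y) ->
  bij_spec (graph X Y R) X Y.
Proof.
  move=> HR Hex Hfun Hinj Honto; split.
  - exact: graph_rel.
  - by move=> x Hx; have [y [Hy H]] := Hex _ Hx; exists y; rewrite graphP.
  - by move=> x y y'; rewrite !graphP // => -[? [? ?]] [? [? ?]]; eauto.
  - by move=> x y y'; rewrite !graphP // => -[? [? ?]] [? [? ?]]; eauto.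
  - by move=> y Hy; have [x [Hx H]] := Honto _ Hy; exists x; rewrite graphP.
Qed.

Definition inverse f X Y := graph Y X (fun y x => pair x y ∈ f).

Lemma inverseP f X Y x y : bij_spec f X Y -> pair y x ∈ inverse f X Y <-> pair x y ∈ f.
Proof.
  move=> Hf; rewrite graphP; first by dfn; apply: DT_pair; dfn.
  split=> [[_ [_ //]]|H]; have [] := bs_dom Hf H; by split.
Qed.

Lemma inverse_bij f X Y : bij_spec f X Y -> bij_spec (inverse f X Y) Y X.
Proof.
  move=> Hf; apply: graph_bij.
  - by dfn; apply: DT_pair; dfn.
  - by move=> y /(bs_onto Hf) [x H]; exists x; have [] := bs_dom Hf H.
  - by move=> y x x' _ _ _; exact: (bs_inj Hf).
  - by move=> y y' x _ _ _; exact: (bs_fun Hf).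
  - by move=> x /(bs_ex Hf) [y H]; exists y; have [] := bs_dom Hf H.
Qed.

(** Composition, [f] first. *)
Definition comp f g X Z := graph X Z (fun x z => exists y, pair x y ∈ f /\ pair y z ∈ g).

Lemma compP f g X Y Z x z : bij_spec f X Y -> bij_spec g Y Z ->
  pair x z ∈ comp f g X Z <-> exists y, pair x y ∈ f /\ pair y z ∈ g.
Proof.
  move=> Hf Hg; rewrite graphP; first by dfn; apply: DT_pair; dfn.
  split=> [[_ [_ //]]|[y [H1 H2]]].
  have [? _] := bs_dom Hf H1; have [_ ?] := bs_dom Hg H2; by do !split=> //; exists y.
Qed.

Lemma comp_bij f g X Y Z : bij_spec f X Y -> bij_spec g Y Z ->
  bij_spec (comp f g X Z) X Z.
Proof.
  move=> Hf Hg; apply: graph_bij.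
  - by dfn; apply: DT_pair; dfn.
  - move=> x /(bs_ex Hf) [y H]; have [_ Hy] := bs_dom Hf H.
    have [z Hz] := bs_ex Hg Hy; have [_ ?] := bs_dom Hg Hz.
    by exists z; split=> //; exists y.
  - move=> x z z' _ _ _ [y [H1 H2]] [y' [H3 H4]].
    by move: H4; rewrite (bs_fun Hf H3 H1) => H4; exact: (bs_fun Hg H2 H4).
  - move=> x x' z _ _ _ [y [H1 H2]] [y' [H3 H4]].
    by move: H3; rewrite (bs_inj Hg H4 H2) => H3; exact: (bs_inj Hf H1 H3).
  - move=> z /(bs_onto Hg) [y H]; have [Hy _] := bs_dom Hg H.
    have [x Hx] := bs_onto Hf Hy; have [? _] := bs_dom Hf Hx.
    by exists x; split=> //; exists y.
Qed.

(** A minimal counterexample is found inside a transitive set. *)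
Lemma eps_induction (P : N -> Prop) : has_closures N -> Dfn (fun e => P (e 0)) ->
  (forall x, (forall y, y ∈ x -> P y) -> P x) -> forall x, P x.
Proof.
  move=> Htc HP Hind x.
  have HnP : Dfn (fun e => ~ P (e 0)) by dfn.
  suff Hall : forall t, is_transitive t -> forall y, y ∈ t -> P y.
    have [t [_ [Ht Hxt]]] := Htc x.
    by apply: Hind => y /Hxt; exact: Hall.
  move=> t Ht y Hy; apply: NNPP => Hn.
  have [|z []] := z_found HN (x := sep t (fun z => ~ P z)).
  - by exists y; rewrite sepP.
  - rewrite sepP // => -[Hz Hnz] Hmin; apply: Hnz; apply: Hind => w Hw.
    apply: NNPP => Hnw; apply: (Hmin w) => //; rewrite sepP //; split=> //.
    exact: (Ht _ Hz).
Qed.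

Lemma mem_asym x y : x ∈ y -> ~ y ∈ x.
Proof.
  move=> Hxy Hyx.
  have [|z []] := z_found HN (x := upair x y).
  - by exists x; rewrite upairP; auto.
  - rewrite upairP => -[->|->] H.
    + by apply: (H y) => //; rewrite upairP; auto.
    + by apply: (H x) => //; rewrite upairP; auto.
Qed.

Lemma mem_irrefl x : ~ x ∈ x.
Proof. by move=> H; exact: (mem_asym H H). Qed.

End ZerTheory.

Ltac dfn_terms ::=
  lazymatch goal with
  | |- DT (fun e => pair (@?t e) (@?u e)) => eapply DT_pair
  | |- DT (fun e => upair (@?t e) (@?u e)) => eapply DT_upair
  | |- DT (fun e => bigcup (@?t e)) => eapply DT_bigcup
  | |- DT (fun e => cup (@?t e) (@?u e)) => eapply DT_cup
  | |- DT (fun e => adjoin (@?t e) (@?u e)) => eapply DT_adjoin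
  | |- DT (fun e => pow (@?t e)) => eapply DT_pow
  | |- DT (fun e => prod (@?t e) (@?u e)) => eapply DT_prod
  end; [eassumption | ..].

(** * A graph encoding a digraph *)

Section Gadget.
Variables (X : Type) (D : X -> X -> Prop).

Inductive node := n0 (x : X) | n1 (x : X) | n2 (x : X) | leaf | hub | leaf' | hub'.

(** An edge from [x] to [y] joins [n0 x] to [n1 y], and [n2 x] joins [n0 x] to
    [n1 x]. The first hub sees all [n0] and [n1] vertices, the second one only the
    [n0] vertices, and each hub is marked by a leaf. *)
Definition half_adj (a b : node) : Prop :=
  match a, b with
  | n0 x, n2 y => x = y
  | n1 x, n2 y => x = y
  | n0 x, n1 y => D x y
  | n0 _, hub | n1 _, hub | leaf, hub => True
  | n0 _, hub' | leaf', hub' => True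
  | _, _ => False
  end.

Definition adj a b : Prop := half_adj a b \/ half_adj b a.

Definition is_leaf a : Prop := exists b, adj a b /\ forall c, adj a c -> c = b.

Lemma is_leafP (x0 : X) a : is_leaf a <-> a = leaf \/ a = leaf'.
Proof.
  split; last first.
  - case=> ->; [exists hub | exists hub'].
    + by split; [left | case; rewrite /adj /=; intuition].
    + by split; [left | case; rewrite /adj /=; intuition].
  - move=> [b [_ Hb]].
    have {Hb} two u v : adj a u -> adj a v -> u = v by move=> /Hb -> /Hb ->.
    case: a two => [x|x|x||||] two; try by auto.
    + by have := two hub hub'; rewrite /adj /=; intuition discriminate.
    + by have := two hub (n2 x); rewrite /adj /=; intuition discriminate.
    + by have := two (n0 x) (n1 x); rewrite /adj /=; intuition discriminate.
    + by have := two leaf (n0 x0); rewrite /adj /=; intuition discriminate.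
    + by have := two leaf' (n0 x0); rewrite /adj /=; intuition discriminate.
Qed.

Section Automorphism.
Variable Phi : node -> node.
Hypothesis Phi_inj : forall a b, Phi a = Phi b -> a = b.
Hypothesis Phi_onto : forall b, exists a, Phi a = b.
Hypothesis Phi_adj : forall a b, adj (Phi a) (Phi b) <-> adj a b.

Lemma Phi_leaf a : is_leaf (Phi a) <-> is_leaf a.
Proof.
  split=> -[b [Hab Hb]].
  - case: (Phi_onto b) Hab Hb => b' <- Hab Hb; exists b'.
    split; first by rewrite -Phi_adj.
    by move=> c; rewrite -Phi_adj => /Hb /Phi_inj.
  - exists (Phi b); split; first by rewrite Phi_adj.
    by move=> c; case: (Phi_onto c) => c' <-; rewrite Phi_adj => /Hb ->.
Qed.

(** The leaves and hence the hubs are recognisable; the two hubs differ since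
    only the first one has a neighbour [n1 x] that the other one misses. The
    three copies of a point are then told apart by the hubs, and the copies of
    one point are matched through its [n2] copy. *)
Lemma gadget_automorphism (x0 : X) :
  exists psi : X -> X,
    (forall x, Phi (n0 x) = n0 (psi x) /\ Phi (n1 x) = n1 (psi x) /\
               Phi (n2 x) = n2 (psi x)) /\
    (Phi leaf = leaf /\ Phi hub = hub /\ Phi leaf' = leaf' /\ Phi hub' = hub').
Proof.
  have Hlf a : a = leaf \/ a = leaf' <-> Phi a = leaf \/ Phi a = leaf'.
    by rewrite -!(is_leafP x0) Phi_leaf.
  have Hhub a : (exists l, is_leaf l /\ adj a l) <-> a = hub \/ a = hub'.
  { split=> [[l [/(is_leafP x0)]]|[->|->]].
    - by case=> ->; case: a => [x|x|x||||]; rewrite /adj /=; intuition.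
    - by exists leaf; rewrite (is_leafP x0) /adj /=; intuition.
    - by exists leaf'; rewrite (is_leafP x0) /adj /=; intuition. }
  have Hhub' a : a = hub \/ a = hub' -> Phi a = hub \/ Phi a = hub'.
    rewrite -!Hhub => -[l [Hl Hal]]; exists (Phi l).
    by rewrite Phi_leaf Phi_adj.
  have Eh' : Phi hub' = hub -> False.
    move=> E'.
    have E : Phi hub = hub'.
      case: (Hhub' hub (or_introl eq_refl)) => // E.
      by have := Phi_inj (eq_trans E (eq_sym E')).
    have H1 : adj (Phi (n1 x0)) hub' by rewrite -E Phi_adj /adj /=; auto.
    have H2 : ~ adj (Phi (n1 x0)) hub by rewrite -E' Phi_adj /adj /=; intuition.
    have H3 : ~ (Phi (n1 x0) = leaf \/ Phi (n1 x0) = leaf').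
      by rewrite -Hlf => -[].
    by case: (Phi (n1 x0)) H1 H2 H3 => [x|x|x||||]; rewrite /adj /=; intuition.
  have Eb' : Phi hub' = hub' by case: (Hhub' hub' (or_intror eq_refl)).
  have Eb : Phi hub = hub.
    case: (Hhub' hub (or_introl eq_refl)) => // E.
    by have := Phi_inj (eq_trans E (eq_sym Eb')).
  have El : Phi leaf = leaf.
    have H : adj (Phi leaf) hub by rewrite -Eb Phi_adj /adj /=; auto.
    by move: H; case: (proj1 (Hlf leaf) (or_introl eq_refl)) => ->; rewrite /adj /=; intuition.
  have El' : Phi leaf' = leaf'.
    have H : adj (Phi leaf') hub' by rewrite -Eb' Phi_adj /adj /=; auto.
    by move: H; case: (proj1 (Hlf leaf') (or_intror eq_refl)) => ->; rewrite /adj /=; intuition.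
  have E0 x : exists x', Phi (n0 x) = n0 x'.
    have H1 : adj (Phi (n0 x)) hub by rewrite -Eb Phi_adj /adj /=; auto.
    have H2 : adj (Phi (n0 x)) hub' by rewrite -Eb' Phi_adj /adj /=; auto.
    case: (Phi (n0 x)) H1 H2 => [x'|x'|x'||||] H1 H2;
      first [by exists x' | by move: H1 H2; rewrite /adj /=; intuition].
  have E1 x : exists x', Phi (n1 x) = n1 x'.
    have H1 : adj (Phi (n1 x)) hub by rewrite -Eb Phi_adj /adj /=; auto.
    have H2 : ~ adj (Phi (n1 x)) hub' by rewrite -Eb' Phi_adj /adj /=; intuition.
    have H3 : Phi (n1 x) <> leaf by rewrite -El => /Phi_inj.
    case: (Phi (n1 x)) H1 H2 H3 => [x'|x'|x'||||] H1 H2 H3;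
      first [by exists x' | by move: H1 H2 H3; rewrite /adj /=; intuition].
  have E2 x : exists x', Phi (n2 x) = n2 x'.
    have H1 : ~ adj (Phi (n2 x)) hub by rewrite -Eb Phi_adj /adj /=; intuition.
    have H3 : Phi (n2 x) <> leaf by rewrite -El => /Phi_inj.
    have H4 : Phi (n2 x) <> leaf' by rewrite -El' => /Phi_inj.
    have H5 : Phi (n2 x) <> hub by rewrite -Eb => /Phi_inj.
    have H6 : Phi (n2 x) <> hub' by rewrite -Eb' => /Phi_inj.
    case: (Phi (n2 x)) H1 H3 H4 H5 H6 => [x'|x'|x'||||] H1 H3 H4 H5 H6;
      first [by exists x' | by move: H1; rewrite /adj /=; intuition].
  exists (fun x => match Phi (n0 x) with n0 x' => x' | _ => x end).
  split=> // x; have [x' E] := E0 x; rewrite E; split=> //.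
  have [y' Ey] := E1 x; have [z' Ez] := E2 x; rewrite Ey Ez.
  have H1 : adj (Phi (n0 x)) (Phi (n2 x)) by rewrite Phi_adj /adj /=; auto.
  have H2 : adj (Phi (n1 x)) (Phi (n2 x)) by rewrite Phi_adj /adj /=; auto.
  by move: H1 H2; rewrite E Ey Ez /adj /= => -[] // -> [] // ->.
Qed.

End Automorphism.
End Gadget.
Arguments leaf {X}. Arguments hub {X}. Arguments leaf' {X}. Arguments hub' {X}.

Lemma sig_eq (T : Type) (P : T -> Prop) (a b : {x | P x}) :
  proj1_sig a = proj1_sig b -> a = b.
Proof.
  case: a b => [a Ha] [b Hb] /= E; move: Ha Hb; rewrite E => Ha Hb.
  by rewrite (proof_irrelevance _ Ha Hb).
Qed.

(** * Automorphism groups *)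

Section AutGroup.
Variable N : structure.
Hypothesis HN : Zer N.
Implicit Types V E g h k : N.

Record aut_spec g V E : Prop := {
  as_bij : bij_spec g V V;
  as_edge : forall u v u' v', pair u u' ∈ g -> pair v v' ∈ g ->
    (pair u v ∈ E <-> pair u' v' ∈ E)
}.

Lemma is_automorphismE g V E : is_automorphism g V E <-> aut_spec g V E.
Proof.
  rewrite /is_automorphism /is_graph_iso is_bijectionE //.
  split=> [[Hb He]|[Hb He]]; split=> // u v u' v'.
  - by have := He u v u' v'; rewrite !inrelE.
  - by have := He u v u' v'; rewrite !inrelE.
Qed.

Lemma is_compositeE k g h : is_composite k g h <->
  forall x z, pair x z ∈ k <-> exists y, pair x y ∈ h /\ pair y z ∈ g.
Proof.
  split=> H x z; have := H x z; rewrite inrelE // => ->.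
  - by split=> -[y [H1 H2]]; exists y; move: H1 H2; rewrite !inrelE.
  - by split=> -[y [H1 H2]]; exists y; move: H1 H2; rewrite !inrelE.
Qed.

Lemma comp_aut g h V E : aut_spec g V E -> aut_spec h V E ->
  aut_spec (comp h g V V) V E.
Proof.
  move=> [Hg Hge] [Hh Hhe]; split; first exact: comp_bij Hh Hg.
  move=> u v u' v'; rewrite !(compP HN _ _ Hh Hg) => -[a [H1 H2]] [b [H3 H4]].
  by rewrite (Hhe _ _ _ _ H1 H3) (Hge _ _ _ _ H2 H4).
Qed.

Lemma comp_composite g h V : bij_spec g V V -> bij_spec h V V ->
  is_composite (comp h g V V) g h.
Proof. by move=> Hg Hh; rewrite is_compositeE => x z; rewrite (compP HN _ _ Hh Hg). Qed.

Lemma aut_group_exists V E : exists Gam c,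
  is_aut_group V E Gam c /\
  forall g h k, g ∈ Gam -> h ∈ Gam -> k ∈ Gam -> is_composite k g h -> opapp c g h k.
Proof.
  pose Gam := sep (pow (prod V V)) (fun g => is_automorphism g V E).
  have HP : Dfn (fun e : nat -> N => is_automorphism (e 0) V E) by dfn.
  have HGam g : g ∈ Gam <-> is_automorphism g V E.
    rewrite sepP //; split=> [[] //|Hg]; split=> //; rewrite powP //.
    have /is_automorphismE [/bs_rel /(is_relationE HN) [H1 H2] _] := Hg.
    split=> // p /H2 [x [y [Hx [Hy ->]]]]; by rewrite pair_prod.
  pose R p k : Prop := exists g h : N, p = pair g h /\ is_composite k g h.
  have HR : Dfn (fun e => R (e 0) (e 1)) by rewrite /R; dfn.
  exists Gam, (graph (prod Gam Gam) Gam R).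
  have Happ g h k : opapp (graph (prod Gam Gam) Gam R) g h k <->
      g ∈ Gam /\ h ∈ Gam /\ k ∈ Gam /\ is_composite k g h.
    rewrite opappE // graphP // pair_prod // /R.
    split=> [[[Hg Hh] [Hk [g' [h' [/(pair_inj HN) [E1 E2] H]]]]]|[? [? [? ?]]]].
      by subst.
    by split=> //; split=> //; exists g, h.
  split; last by move=> g h k *; rewrite Happ.
  split; first exact: sep_set.
  split=> //; split; last by move=> g h k /Happ [_ [_ [_ ?]]].
  exists (prod Gam Gam); rewrite is_productE //; split=> //.
  rewrite is_functionE //; split; first exact: graph_rel.
  - move=> p; rewrite prodP // => -[g [h [Hg [Hh ->]]]].
    move: (Hg) (Hh); rewrite !HGam !is_automorphismE => Ag Ah.
    exists (comp h g V V); rewrite graphP // pair_prod //.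
    split=> //; split; first by rewrite HGam is_automorphismE; exact: comp_aut.
    by exists g, h; split=> //; apply: comp_composite; apply: as_bij; eassumption.
  - move=> p k k'; rewrite !graphP // => -[_ [Hk [g [h [-> Hkgh]]]]] [_ [Hk' [g' [h' [E' Hkgh']]]]].
    case: (pair_inj HN E') => ? ?; subst g' h'.
    move: Hk Hk'; rewrite !HGam !is_automorphismE => /as_bij /bs_rel Hk /as_bij /bs_rel Hk'.
    apply: (rel_ext HN Hk Hk') => x y.
    by move/is_compositeE: Hkgh => ->; move/is_compositeE: Hkgh' => ->.
Qed.

End AutGroup.

(** * Groups *)

Section Groups.
Variable N : structure.
Hypothesis HN : Zer N.
Implicit Types G m : N.

Definition mul m (x y z : N) := pair (pair x y) z ∈ m.

Record group_spec G m (one : N) : Prop := {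
  gs_dom : forall x y z, mul m x y z -> x ∈ G /\ y ∈ G /\ z ∈ G;
  gs_ex : forall x y, x ∈ G -> y ∈ G -> exists z, mul m x y z;
  gs_fun : forall x y z z', mul m x y z -> mul m x y z' -> z = z';
  gs_assoc : forall x y z xy yz r r',
    mul m x y xy -> mul m xy z r -> mul m y z yz -> mul m x yz r' -> r = r';
  gs_one : one ∈ G;
  gs_onel : forall x, x ∈ G -> mul m one x x;
  gs_oner : forall x, x ∈ G -> mul m x one x;
  gs_inv : forall x, x ∈ G -> exists y, y ∈ G /\ mul m x y one /\ mul m y x one
}.

Lemma group_specE G m : is_group G m -> exists one, group_spec G m one.
Proof.
  move=> [_ [[P [/(is_productE HN) -> /(is_functionE HN) [Hrel Hex Hfun]]]
    [Hassoc [one [H1 [Hone Hinv]]]]]]; exists one; split=> //.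
  - move=> x y z /(rel_dom HN Hrel) [/(pair_prod HN) [Hx Hy] Hz] //.
  - by move=> x y Hx Hy; apply: Hex; rewrite pair_prod.
  - by move=> x y z z'; exact: Hfun.
  - by move=> x y z xy yz r r'; have := Hassoc x y z xy yz r r'; rewrite !opappE.
  - by move=> x /Hone []; rewrite !opappE.
  - by move=> x /Hone []; rewrite !opappE.
  - by move=> x /Hinv [y]; rewrite !opappE // => H; exists y.
Qed.

End Groups.

(** * From a digraph to a graph *)

(** The assumptions say that [Act] is a faithful action of the group on the
    digraph [(X, D)] and that every automorphism of the digraph comes from it. *)
Section Digraph.
Variable N : structure.
Hypothesis HN : Zer N.
Variables (G m one : N).
Hypothesis HG : group_spec G m one.
Variables (X : N) (D : N -> N -> Prop) (Act : N -> N -> N -> Prop).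
Hypothesis DD : Dfn (fun e => D (e 0) (e 1)).
Hypothesis DAct : Dfn (fun e => Act (e 0) (e 1) (e 2)).
Hypothesis X_inh : exists x, x ∈ X.
Hypothesis Act_ex : forall k x, k ∈ G -> x ∈ X -> exists y, y ∈ X /\ Act k x y.
Hypothesis Act_fun : forall k x y y', k ∈ G -> x ∈ X -> Act k x y -> Act k x y' -> y = y'.
Hypothesis Act_one : forall x, x ∈ X -> Act one x x.
Hypothesis Act_mul : forall k l kl x y z, mul m k l kl -> x ∈ X ->
  Act l x y -> Act k y z -> Act kl x z.
Hypothesis Act_D : forall k x y x' y', k ∈ G -> x ∈ X -> y ∈ X ->
  Act k x x' -> Act k y y' -> (D x y <-> D x' y').
Hypothesis Act_faithful : forall k l, k ∈ G -> l ∈ G ->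
  (forall x y, x ∈ X -> Act k x y -> Act l x y) -> k = l.
Hypothesis Act_full : forall phi, bij_spec phi X X ->
  (forall x y x' y', pair x x' ∈ phi -> pair y y' ∈ phi -> (D x y <-> D x' y')) ->
  exists k, k ∈ G /\ forall x y, pair x y ∈ phi -> Act k x y.

(** Four distinct objects that tag the sorts of vertices. *)
Let c0 := emp HN.
Let c1 := upair c0 c0.
Let c2 := upair c1 c1.
Let c3 := upair c2 c2.

Lemma c01 : c0 <> c1.
Proof. by move=> E; apply: (empP (HN := HN) (z := c0)); rewrite -/c0 {2}E upairP; auto. Qed.
Lemma c02 : c0 <> c2.
Proof. by move=> E; apply: (empP (HN := HN) (z := c1)); rewrite -/c0 E upairP; auto. Qed.
Lemma c03 : c0 <> c3.
Proof. by move=> E; apply: (empP (HN := HN) (z := c2)); rewrite -/c0 E upairP; auto. Qed.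
Lemma c12 : c1 <> c2.
Proof. by case/(upair_inj HN) => -[/c01]. Qed.
Lemma c13 : c1 <> c3.
Proof. by case/(upair_inj HN) => -[/c02]. Qed.
Lemma c23 : c2 <> c3.
Proof. by case/(upair_inj HN) => -[/c12]. Qed.

Let Xt := {x : N | x ∈ X}.
Let Dt (a b : Xt) := D (proj1_sig a) (proj1_sig b).
Let nd := node Xt.

Definition code (a : nd) : N :=
  match a with
  | n0 x => pair c0 (proj1_sig x)
  | n1 x => pair c1 (proj1_sig x)
  | n2 x => pair c2 (proj1_sig x)
  | leaf => pair c3 c0
  | hub => pair c3 c1
  | leaf' => pair c3 c2
  | hub' => pair c3 c3
  end.

Lemma code_inj a b : code a = code b -> a = b.
Proof.
  have [H01 [H02 [H03 [H12 [H13 H23]]]]] :=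
    conj c01 (conj c02 (conj c03 (conj c12 (conj c13 c23)))).
  by case: a b => [[x Hx]|[x Hx]|[x Hx]||||] [[y Hy]|[y Hy]|[y Hy]||||] /= /(pair_inj HN) [E1 E2];
    try (by case: H01); try (by case: H02); try (by case: H03); try (by case: H12);
    try (by case: H13); try (by case: H23) => //; f_equal; exact: sig_eq.
Qed.

Let tags := adjoin (adjoin (upair c0 c1) c2) c3.
Lemma tagsP z : z ∈ tags <-> z = c0 \/ z = c1 \/ z = c2 \/ z = c3.
Proof. by rewrite !adjoinP // upairP //; tauto. Qed.

Let is_vertex (p : N) : Prop :=
  (exists i x, (i = c0 \/ i = c1 \/ i = c2) /\ x ∈ X /\ p = pair i x) \/
  exists i, i ∈ tags /\ p = pair c3 i.
Let V := sep (prod tags (cup X tags)) is_vertex.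

Lemma Dfn_is_vertex : Dfn (fun e => is_vertex (e 0)).
Proof. by rewrite /is_vertex; dfn. Qed.

Lemma is_vertexP p : is_vertex p <-> exists a, p = code a.
Proof.
  split=> [[[i [x [Hi [Hx ->]]]]|[i [/tagsP Hi ->]]]|[a ->]].
  - by case: Hi => [->|[->|->]]; [exists (n0 (exist _ x Hx)) | exists (n1 (exist _ x Hx))
      | exists (n2 (exist _ x Hx))].
  - by case: Hi => [->|[->|[->|->]]]; [exists leaf | exists hub | exists leaf' | exists hub'].
  - case: a => [[x Hx]|[x Hx]|[x Hx]||||] /=; rewrite /is_vertex.
    + by left; exists c0, x; auto.
    + by left; exists c1, x; auto.
    + by left; exists c2, x; auto.
    + by right; exists c0; rewrite tagsP; auto.
    + by right; exists c1; rewrite tagsP; auto.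
    + by right; exists c2; rewrite tagsP; auto.
    + by right; exists c3; rewrite tagsP; auto 6.
Qed.

Lemma VP p : p ∈ V <-> exists a, p = code a.
Proof.
  rewrite /V (sepP HN Dfn_is_vertex) -is_vertexP; split=> [[_ H] //|H]; split=> //.
  case: H => [[i [x [Hi [Hx ->]]]]|[i [Hi ->]]]; rewrite pair_prod // cupP //; split; auto.
  - by rewrite tagsP; tauto.
  - by rewrite tagsP; tauto.
Qed.

Lemma code_V a : code a ∈ V. Proof. by rewrite VP; exists a. Qed.

(** [half_adj] on codes, as a formula. *)
Let half_edge (u v : N) : Prop :=
  (exists x, x ∈ X /\ (u = pair c0 x \/ u = pair c1 x) /\ v = pair c2 x) \/
  (exists x y, x ∈ X /\ y ∈ X /\ D x y /\ u = pair c0 x /\ v = pair c1 y) \/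
  (exists x, x ∈ X /\ (u = pair c0 x \/ u = pair c1 x) /\ v = pair c3 c1) \/
  (exists x, x ∈ X /\ u = pair c0 x /\ v = pair c3 c3) \/
  (u = pair c3 c0 /\ v = pair c3 c1) \/ (u = pair c3 c2 /\ v = pair c3 c3).

Lemma half_edgeP u v : half_edge u v <->
  exists a b, u = code a /\ v = code b /\ half_adj Dt a b.
Proof.
  split.
  - case=> [[x [Hx [Hu ->]]]|H].
      by case: Hu => ->; [exists (n0 (exist _ x Hx)) | exists (n1 (exist _ x Hx))];
        exists (n2 (exist _ x Hx)).
    case: H => [[x [y [Hx [Hy [H [-> ->]]]]]]|H].
      by exists (n0 (exist _ x Hx)), (n1 (exist _ y Hy)).
    case: H => [[x [Hx [Hu ->]]]|H].
      by case: Hu => ->; [exists (n0 (exist _ x Hx)) | exists (n1 (exist _ x Hx))];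
        exists hub.
    case: H => [[x [Hx [-> ->]]]|H].
      by exists (n0 (exist _ x Hx)), hub'.
    by case: H => -[-> ->]; [exists leaf, hub | exists leaf', hub'].
  - move=> [a [b [-> [-> H]]]].
    case: a b H => [[x Hx]|[x Hx]|[x Hx]||||] [[y Hy]|[y Hy]|[y Hy]||||] //= H; rewrite /half_edge.
    + by right; left; exists x, y.
    + by case: H => E; left; exists x; subst; auto.
    + by right; right; left; exists x; auto.
    + by right; right; right; left; exists x; auto.
    + by case: H => E; left; exists x; subst; auto.
    + by right; right; left; exists x; auto.
    + by do 4!right; left.
    + by do 5!right.
Qed.

Let edge u v := half_edge u v \/ half_edge v u.
Lemma Dfn_edge : Dfn (fun e => edge (e 0) (e 1)).
Proof.
  by rewrite /edge /half_edge; dfn; apply: (Dfn2_app DD); dfn.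
Qed.
Let E := graph V V edge.

Lemma edgeP a b : pair (code a) (code b) ∈ E <-> adj Dt a b.
Proof.
  rewrite (graphP HN Dfn_edge).
  rewrite /edge !half_edgeP; split=> [[_ [_ [H|H]]]|[H|H]].
  - by case: H => [a' [b' [/code_inj <- [/code_inj <- H]]]]; left.
  - by case: H => [a' [b' [/code_inj <- [/code_inj <- H]]]]; right.
  - by split; [exact: code_V | split; [exact: code_V | left; exists a, b]].
  - by split; [exact: code_V | split; [exact: code_V | right; exists b, a]].
Qed.

Lemma V_E_graph : is_graph V E.
Proof.
  split; first exact: (sep_set HN Dfn_is_vertex).
  have Hrel : is_relation E V V by exact: (graph_rel HN _ _ Dfn_edge).
  split=> //; split=> x.
  - move=> y; rewrite !inrelE // => H; have [] := rel_dom HN Hrel H.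
    by rewrite !VP => -[a Ea] [b Eb]; move: H; rewrite Ea Eb !edgeP /adj; tauto.
  - rewrite inrelE // => H; have [] := rel_dom HN Hrel H.
    rewrite !VP => -[a Ea] _; move: H; rewrite Ea edgeP.
    by case: a {Ea} => [x'|x'|x'||||]; rewrite /adj /=; tauto.
Qed.

Let Gt := {k : N | k ∈ G}.

Lemma Xt_mem (x : Xt) : proj1_sig x ∈ X. Proof. exact: (proj2_sig x). Qed.
Lemma Gt_mem (k : Gt) : proj1_sig k ∈ G. Proof. exact: (proj2_sig k). Qed.

Lemma alpha_exists (k : Gt) (x : Xt) :
  exists y : Xt, Act (proj1_sig k) (proj1_sig x) (proj1_sig y).
Proof.
  have [y [Hy H]] := Act_ex (Gt_mem k) (Xt_mem x).
  by exists (exist _ y Hy).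
Qed.

Definition alpha k x := proj1_sig (constructive_indefinite_description _ (alpha_exists k x)).

Lemma alpha_Act k x : Act (proj1_sig k) (proj1_sig x) (proj1_sig (alpha k x)).
Proof. exact: (proj2_sig (constructive_indefinite_description _ (alpha_exists k x))). Qed.

Lemma alphaE k x y : Act (proj1_sig k) (proj1_sig x) (proj1_sig y) -> y = alpha k x.
Proof.
  move=> H; apply: sig_eq; apply: (Act_fun (proj2_sig k) (proj2_sig x) H).
  exact: alpha_Act.
Qed.

Lemma alpha_mul (k l kl : Gt) x :
  mul m (proj1_sig k) (proj1_sig l) (proj1_sig kl) -> alpha kl x = alpha k (alpha l x).
Proof.
  move=> H; apply: eq_sym; apply: alphaE; apply: (Act_mul H (proj2_sig x)); exact: alpha_Act.
Qed.

Lemma alpha_inv (k : Gt) : exists k' : Gt,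
  (forall x, alpha k (alpha k' x) = x) /\ (forall x, alpha k' (alpha k x) = x).
Proof.
  have [y [Hy [H1 H2]]] := gs_inv HG (proj2_sig k).
  pose k' : Gt := exist _ y Hy; pose e : Gt := exist _ one (gs_one HG).
  have He x : alpha e x = x.
    by apply: eq_sym; apply: alphaE; apply: Act_one; exact: Xt_mem.
  by exists k'; split=> x; rewrite -(@alpha_mul _ _ e).
Qed.

Definition nmap (f : Xt -> Xt) (a : nd) : nd :=
  match a with
  | n0 x => n0 (f x) | n1 x => n1 (f x) | n2 x => n2 (f x)
  | leaf => leaf | hub => hub | leaf' => leaf' | hub' => hub'
  end.

(** The graph of [nmap (alpha k)] on codes, as a formula in [k], [u] and [v]. *)
Let moves k u v : Prop :=
  (exists i x y, (i = c0 \/ i = c1 \/ i = c2) /\ x ∈ X /\ y ∈ X /\ Act k x y /\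
     u = pair i x /\ v = pair i y) \/
  exists i, i ∈ tags /\ u = pair c3 i /\ v = u.

Lemma movesP (k : Gt) u v : moves (proj1_sig k) u v <->
  exists a, u = code a /\ v = code (nmap (alpha k) a).
Proof.
  split=> [[[i [x [y [Hi [Hx [Hy [H [-> ->]]]]]]]]|[i [/tagsP Hi [-> ->]]]]|[a [-> ->]]].
  - have E1 := alphaE (x := exist _ x Hx) (y := exist _ y Hy) H.
    by case: Hi => [->|[->|->]]; [exists (n0 (exist _ x Hx)) | exists (n1 (exist _ x Hx))
      | exists (n2 (exist _ x Hx))]; rewrite /= -E1.
  - by case: Hi => [->|[->|[->|->]]]; [exists leaf | exists hub | exists leaf' | exists hub'].
  - have HA x : proj1_sig x ∈ X /\ proj1_sig (alpha k x) ∈ X /\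
        Act (proj1_sig k) (proj1_sig x) (proj1_sig (alpha k x)).
      by split; [exact: Xt_mem | split; [exact: Xt_mem | exact: alpha_Act]].
    case: a => [x|x|x||||] /=; rewrite /moves.
    + by left; exists c0, (proj1_sig x), (proj1_sig (alpha k x)); have := HA x; tauto.
    + by left; exists c1, (proj1_sig x), (proj1_sig (alpha k x)); have := HA x; tauto.
    + by left; exists c2, (proj1_sig x), (proj1_sig (alpha k x)); have := HA x; tauto.
    + by right; exists c0; rewrite tagsP; auto.
    + by right; exists c1; rewrite tagsP; auto.
    + by right; exists c2; rewrite tagsP; auto.
    + by right; exists c3; rewrite tagsP; auto 6.
Qed.

Lemma Dfn_moves : Dfn (fun e => moves (e 0) (e 1) (e 2)).
Proof. by rewrite /moves; dfn; apply: (Dfn3_app DAct); dfn. Qed.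

Lemma Dfn_moves_k k : Dfn (fun e => moves k (e 0) (e 1)).
Proof. by apply: (Dfn3_app Dfn_moves); dfn. Qed.

Let aut k := graph V V (moves k).

Lemma autP (k : Gt) u v : pair u v ∈ aut (proj1_sig k) <->
  exists a, u = code a /\ v = code (nmap (alpha k) a).
Proof.
  rewrite (graphP HN (Dfn_moves_k _)) movesP; split=> [[_ [_ //]]|H].
  by case: (H) => a [-> ->]; split; [exact: code_V | split; [exact: code_V | exists a]].
Qed.

Lemma aut_code (k : Gt) a v : pair (code a) v ∈ aut (proj1_sig k) <->
  v = code (nmap (alpha k) a).
Proof. by rewrite autP; split=> [[b [/code_inj <-]]|->] //; exists a. Qed.

Lemma nmap_comp f g a : nmap f (nmap g a) = nmap (fun x => f (g x)) a.
Proof. by case: a. Qed.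

Lemma nmap_ext f g : (forall x, f x = g x) -> forall a, nmap f a = nmap g a.
Proof. by move=> H [x|x|x||||] /=; rewrite ?H. Qed.

Lemma nmap_id f : (forall x, f x = x) -> forall a, nmap f a = a.
Proof. by move=> H [x|x|x||||] /=; rewrite ?H. Qed.

Lemma nmap_adj (k : Gt) a b : adj Dt (nmap (alpha k) a) (nmap (alpha k) b) <-> adj Dt a b.
Proof.
  have [k' [_ Hk]] := alpha_inv k.
  have Hinj x y : alpha k x = alpha k y <-> x = y.
    by split=> [H|->] //; rewrite -(Hk x) H Hk.
  have HD x y : Dt (alpha k x) (alpha k y) <-> Dt x y.
    rewrite /Dt -(Act_D (proj2_sig k) (proj2_sig x) (proj2_sig y)) //; exact: alpha_Act.
  by case: a b => [x|x|x||||] [y|y|y||||]; rewrite /adj /= ?Hinj ?HD.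
Qed.

Lemma aut_aut (k : Gt) : aut_spec (aut (proj1_sig k)) V E.
Proof.
  have [k' [Hk' Hk]] := alpha_inv k; split; first split.
  - exact: (graph_rel HN _ _ (Dfn_moves_k _)).
  - by move=> u /VP [a ->]; exists (code (nmap (alpha k) a)); rewrite aut_code.
  - by move=> u v v' /autP [a [-> ->]]; rewrite aut_code.
  - move=> u u' v /autP [a [-> ->]] /autP [b [-> /code_inj Eab]].
    by rewrite -(nmap_id Hk a) -nmap_comp Eab nmap_comp (nmap_id Hk).
  - move=> v /VP [a ->]; exists (code (nmap (alpha k') a)).
    by rewrite aut_code nmap_comp (nmap_id Hk').
  - by move=> u v u' v' /autP [a [-> ->]] /autP [b [-> ->]]; rewrite !edgeP nmap_adj.
Qed.

(** An automorphism of the graph restricts, along the [n0] copies, to an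
    automorphism of the digraph. *)
Lemma aut_onto g : aut_spec g V E -> exists k : Gt, g = aut (proj1_sig k).
Proof.
  move=> [Hg Hedge].
  have Hex a : exists b, pair (code a) (code b) ∈ g.
    have [v Hv] := bs_ex Hg (code_V a).
    by have [_ /VP [b Eb]] := bs_dom HN Hg Hv; exists b; rewrite -Eb.
  pose Phi a := proj1_sig (constructive_indefinite_description _ (Hex a)).
  have HPhi a : pair (code a) (code (Phi a)) ∈ g.
    exact: (proj2_sig (constructive_indefinite_description _ (Hex a))).
  have HPhiE a b : pair (code a) (code b) ∈ g -> b = Phi a.
    by move=> H; apply: code_inj; exact: (bs_fun Hg H (HPhi a)).
  have [x0 Hx0] := X_inh.
  have [|||psi [Hpsi [El [Eh [El' Eh']]]]] :=
    @gadget_automorphism Xt Dt Phi _ _ _ (exist _ x0 Hx0).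
  { move=> a b Eab; apply: code_inj; apply: (bs_inj Hg (HPhi a)).
    by rewrite Eab; exact: HPhi. }
  { move=> b; have [u Hu] := bs_onto Hg (code_V b).
    have [/VP [a Ea] _] := bs_dom HN Hg Hu; exists a.
    by apply: eq_sym; apply: HPhiE; rewrite -Ea. }
  { by move=> a b; rewrite -!edgeP; apply: iff_sym; apply: Hedge; exact: HPhi. }
  have HPhin a : Phi a = nmap psi a.
    by case: a => [x|x|x||||] //=; have [? [? ?]] := Hpsi x.
  pose R x y := pair (pair c0 x) (pair c0 y) ∈ g.
  have HR : Dfn (fun e => R (e 0) (e 1)) by rewrite /R; dfn.
  have HRP (x y : Xt) : R (proj1_sig x) (proj1_sig y) <-> y = psi x.
  { split=> [H|->].
    - have := HPhiE (n0 x) (n0 y) H; rewrite HPhin => -[] //.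
    - by have := HPhi (n0 x); rewrite HPhin. }
  pose phi := graph X X R.
  have Hphi (x y : Xt) : pair (proj1_sig x) (proj1_sig y) ∈ phi <-> y = psi x.
    by rewrite graphP // HRP; split=> [[_ [_ //]]|H]; do !split=> //; exact: Xt_mem.
  have HphiX x y : pair x y ∈ phi -> x ∈ X /\ y ∈ X.
    by rewrite graphP // => -[? [? _]].
  have Hbij : bij_spec phi X X.
  { split; first exact: graph_rel.
    - move=> x Hx; exists (proj1_sig (psi (exist _ x Hx))).
      exact/(Hphi (exist _ x Hx)).
    - move=> x y y'; rewrite !graphP // => -[_ [_ H]] [_ [_ H']].
      by have [] := pair_inj HN (bs_fun Hg H H').
    - move=> x x' y; rewrite !graphP // => -[_ [_ H]] [_ [_ H']].
      by have [] := pair_inj HN (bs_inj Hg H H').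
    - move=> y Hy; have [u Hu] := bs_onto Hg (code_V (n0 (exist _ y Hy))).
      have [/VP [a Ea] _] := bs_dom HN Hg Hu; subst u.
      have := HPhiE a _ Hu; rewrite HPhin; case: a Hu => // x Hu [Ex].
      by exists (proj1_sig x); apply/(Hphi x (exist _ y Hy)). }
  have [|k [Hk Hphik]] := Act_full Hbij.
  { move=> x y x' y' Hxx Hyy; have [Hx Hx'] := HphiX _ _ Hxx; have [Hy Hy'] := HphiX _ _ Hyy.
    have Ex := proj1 (Hphi (exist _ x Hx) (exist _ x' Hx')) Hxx.
    have Ey := proj1 (Hphi (exist _ y Hy) (exist _ y' Hy')) Hyy.
    have H0 := HPhi (n0 (exist _ x Hx)); have H1 := HPhi (n1 (exist _ y Hy)).
    have := Hedge _ _ _ _ H0 H1; rewrite !edgeP !HPhin /= -Ex -Ey /adj /= /Dt /=; tauto. }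
  pose k' : Gt := exist _ k Hk; exists k'.
  have Hpsik x : psi x = alpha k' x by apply: alphaE; apply: Hphik; apply/Hphi.
  apply: (rel_ext HN (bs_rel Hg) (bs_rel (as_bij (aut_aut k')))) => u v.
  rewrite autP; split=> [H|[a [-> ->]]].
  - have [/VP [a Ea] /VP [b Eb]] := bs_dom HN Hg H; subst u v; exists a; split=> //.
    by rewrite (HPhiE _ _ H) HPhin (nmap_ext Hpsik).
  - by rewrite -(nmap_ext Hpsik) -HPhin.
Qed.

Lemma aut_inj (k l : Gt) : aut (proj1_sig k) = aut (proj1_sig l) -> k = l.
Proof.
  move=> Ekl; apply: sig_eq; apply: Act_faithful; try exact: Gt_mem.
  move=> x y Hx Hxy.
  have [y' [Hy' H]] := Act_ex (proj2_sig k) Hx.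
  have Ey := Act_fun (proj2_sig k) Hx Hxy H; subst y'.
  have E1 := alphaE (x := exist _ x Hx) (y := exist _ y Hy') Hxy.
  have : pair (code (n0 (exist _ x Hx))) (code (n0 (exist _ y Hy'))) ∈ aut (proj1_sig l).
    by rewrite -Ekl aut_code /= -E1.
  by rewrite aut_code => /code_inj [E2]; have := alpha_Act l (exist _ x Hx); rewrite -E2.
Qed.

(** The isomorphism sends [k] to [aut k]. *)
Lemma frucht_of_digraph : exists V E Gam c f,
  is_graph V E /\ is_aut_group V E Gam c /\ is_group_iso f G m Gam c.
Proof.
  have [Gam [c [Hc Hcomp]]] := aut_group_exists HN V E.
  have HGam g : g ∈ Gam <-> aut_spec g V E.
    by rewrite -is_automorphismE //; case: Hc => _ [].
  pose R k phi := is_set phi /\ forall p : N, p ∈ phi <->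
    p ∈ prod V V /\ exists u v, moves k u v /\ p = pair u v.
  have HR : Dfn (fun e => R (e 0) (e 1)).
    by rewrite /R; dfn; apply: (Dfn3_app DAct); dfn.
  have HRP k phi : R k phi <-> phi = aut k.
  { split=> [[H1 H2]|->].
    - apply: (set_ext HN) => // [|p]; first exact: (graph_set HN (Dfn_moves_k k)).
      rewrite H2 /aut /graph (sepP HN) //; first exact: (Dfn_graph_pred HN (Dfn_moves_k k)).
    - split=> [|p]; first exact: (graph_set HN (Dfn_moves_k k)).
      rewrite /aut /graph (sepP HN) //; first exact: (Dfn_graph_pred HN (Dfn_moves_k k)). }
  pose f := graph G Gam R.
  have HfP k phi : pair k phi ∈ f <-> k ∈ G /\ phi = aut k.
    rewrite graphP // HRP; split=> [[? [_ ?]] //|[Hk ->]]; do !split=> //.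
    by rewrite HGam; exact: (aut_aut (exist _ k Hk)).
  exists V, E, Gam, c, f; split; first exact: V_E_graph.
  split=> //; split.
  - rewrite is_bijectionE //; split; first exact: graph_rel.
    + by move=> k Hk; exists (aut k); rewrite HfP.
    + by move=> k y y'; rewrite !HfP => -[_ ->] [_ ->].
    + by move=> k l y; rewrite !HfP => -[Hk ->] [Hl /(@aut_inj (exist _ k Hk) (exist _ l Hl)) []].
    + by move=> g; rewrite HGam => /aut_onto [[k Hk] ->]; exists k; rewrite HfP.
  - move=> x y z x' y' z'; rewrite opappE // !inrelE // !HfP.
    move=> Hxyz [Hx ->] [Hy ->] [Hz ->].
    pose xt : Gt := exist _ x Hx; pose yt : Gt := exist _ y Hy; pose zt : Gt := exist _ z Hz.
    apply: Hcomp; try by rewrite HGam; first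
      [exact: (aut_aut xt) | exact: (aut_aut yt) | exact: (aut_aut zt)].
    have Ez a : nmap (alpha zt) a = nmap (alpha xt) (nmap (alpha yt) a).
      by rewrite nmap_comp; apply: nmap_ext => t; exact: alpha_mul.
    rewrite is_compositeE // => u w; rewrite (autP zt); split.
    + move=> [a [-> ->]]; exists (code (nmap (alpha yt) a)).
      by rewrite (aut_code yt) (aut_code xt) Ez.
    + move=> [v [/(autP yt) [a [-> ->]] /(aut_code xt) ->]]; exists a.
      by rewrite Ez.
Qed.

End Digraph.

(** * Frucht's theorem from a rigid relation on the atoms *)

Section Rigid.
Variable N : structure.
Hypothesis HN : Zer N.
Hypothesis Htc : has_closures N.
Variables (A R : N).
Hypothesis AP : forall x, x ∈ A <-> atom x.
Hypothesis R_dom : forall a b, pair a b ∈ R -> a ∈ A /\ b ∈ A.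
Hypothesis R_irr : forall a, ~ pair a a ∈ R.
Hypothesis R_cycle : forall a, a ∈ A -> exists b, pair a b ∈ R /\ pair b a ∈ R.
Hypothesis R_rigid : forall g, bij_spec g A A ->
  (forall x y x' y', pair x x' ∈ g -> pair y y' ∈ g -> (pair x y ∈ R <-> pair x' y' ∈ R)) ->
  forall x y, pair x y ∈ g -> x = y.

Section Group.
Variables (G m one : N).
Hypothesis HG : group_spec G m one.
Variable T0 : N.
Hypothesis T0_trans : is_transitive T0.
Hypothesis T0_G : subset G T0.

Let T := cup T0 A.
Let r t t' := t ∈ t' \/ pair t t' ∈ R.
Let c0 := emp HN.
Let c1 := upair c0 c0.
Let inT t := pair c0 t.
Let inQ a b := pair c1 (pair a b).

Lemma inT_inj t t' : inT t = inT t' -> t = t'.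
Proof. by case/(pair_inj HN). Qed.
Lemma inQ_inj a b a' b' : inQ a b = inQ a' b' -> a = a' /\ b = b'.
Proof. by case/(pair_inj HN) => _ /(pair_inj HN). Qed.
Lemma inT_inQ t a b : inT t <> inQ a b.
Proof.
  case/(pair_inj HN) => E _; apply: (empP (HN := HN) (z := c0)).
  by rewrite -/c0 {2}E upairP; auto.
Qed.
Lemma inQ_inT t a b : inQ a b <> inT t.
Proof. by move=> E; exact: (@inT_inQ t a b). Qed.

Let is_vertex p : Prop :=
  (exists t, t ∈ T /\ p = inT t) \/ (exists a b, a ∈ G /\ b ∈ G /\ p = inQ a b).
Let X := sep (prod (upair c0 c1) (cup T (prod G G))) is_vertex.

(** The loops of this digraph are the vertices [inQ a a]; the vertex [inQ a b]
    lies between the loops at [a] and at [b], and if [a] and [b] differ it points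
    to the group element [t] with [a t = b]. *)
Let D p q : Prop :=
  (exists t t', p = inT t /\ q = inT t' /\ r t t') \/
  (exists a b d, p = inQ a b /\ q = inQ b d /\ (a = b \/ b = d)) \/
  (exists a b t, p = inQ a b /\ q = inT t /\ mul m a t b /\ a <> b).
Let Act k p q : Prop :=
  (exists t, p = inT t /\ q = p) \/
  (exists a b a' b', p = inQ a b /\ q = inQ a' b' /\ mul m k a a' /\ mul m k b b').

Lemma XP p : p ∈ X <-> is_vertex p.
Proof.
  rewrite /X (sepP HN); first by rewrite /is_vertex /inT /inQ; dfn.
  split=> [[] //|H]; split=> //; case: H => [[t [Ht ->]]|[a [b [Ha [Hb ->]]]]];
    rewrite pair_prod // upairP // cupP // ?pair_prod //; auto.
Qed.

Lemma inT_X t : inT t ∈ X <-> t ∈ T.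
Proof.
  rewrite XP; split=> [[[t' [H /inT_inj -> //]]|[a [b [_ [_ /inT_inQ []]]]]]|H].
  by left; exists t.
Qed.
Lemma inQ_X a b : inQ a b ∈ X <-> a ∈ G /\ b ∈ G.
Proof.
  rewrite XP; split=> [[[t' [H /inQ_inT []]]|[a' [b' [Ha [Hb /inQ_inj [-> ->]]]]]]|[Ha Hb]] //.
  by right; exists a, b.
Qed.

Lemma D_TT t t' : D (inT t) (inT t') <-> r t t'.
Proof.
  split=> [[[u [u' [/inT_inj -> [/inT_inj -> //]]]]|[[a [b [d [/inT_inQ []]]]]|
     [a [b [u [/inT_inQ []]]]]]]|H].
  by left; exists t, t'.
Qed.
Lemma D_TQ t a b : ~ D (inT t) (inQ a b).
Proof.
  by case=> [[u [u' [_ [/inQ_inT []]]]]|[[? [? [? [/inT_inQ []]]]]|[? [? [? [/inT_inQ []]]]]]].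
Qed.
Lemma D_QQ a b c d : D (inQ a b) (inQ c d) <-> b = c /\ (a = b \/ c = d).
Proof.
  split=> [[[u [u' [/inQ_inT []]]]|[[a' [b' [d' [/inQ_inj [-> ->] [/inQ_inj [-> ->] H]]]]]|
     [? [? [? [_ [/inQ_inT []]]]]]]]|[<- H]] //.
  by right; left; exists a, b, d.
Qed.
Lemma D_QT a b t : D (inQ a b) (inT t) <-> mul m a t b /\ a <> b.
Proof.
  split=> [[[u [u' [/inQ_inT []]]]|[[? [? [? [_ [/inT_inQ []]]]]]|
     [a' [b' [t' [/inQ_inj [-> ->] [/inT_inj -> H]]]]]]]|H] //.
  by right; right; exists a, b, t.
Qed.
Lemma Act_T k t q : Act k (inT t) q <-> q = inT t.
Proof.
  split=> [[[u [_ ->]] //|[? [? [? [? [/inT_inQ []]]]]]]|->].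
  by left; exists t.
Qed.
Lemma Act_Q k a b q : Act k (inQ a b) q <->
  exists a' b', q = inQ a' b' /\ mul m k a a' /\ mul m k b b'.
Proof.
  split=> [[[u [/inQ_inT []]]|[u [v [a' [b' [/inQ_inj [-> ->] [-> [H1 H2]]]]]]]]|[a' [b' [-> [H1 H2]]]]].
  - by exists a', b'.
  - by right; exists a, b, a', b'.
Qed.

Lemma mul_assoc k l kl a la kla :
  mul m k l kl -> mul m l a la -> (mul m k la kla <-> mul m kl a kla).
Proof.
  move=> H1 H2.
  have [Hk [Hl Hkl]] := gs_dom HG H1; have [_ [Ha Hla]] := gs_dom HG H2.
  have [x Hx] := gs_ex HG Hk Hla; have [y Hy] := gs_ex HG Hkl Ha.
  have Exy := gs_assoc HG H1 Hy H2 Hx; subst y.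
  by split=> H; [rewrite (gs_fun HG H Hx) | rewrite (gs_fun HG H Hy)].
Qed.

Lemma mul_cancel k a b c : mul m k a c -> mul m k b c -> a = b.
Proof.
  move=> Ha Hb; have [Hk [HaG _]] := gs_dom HG Ha; have [_ [HbG _]] := gs_dom HG Hb.
  have [k' [_ [_ Hk']]] := gs_inv HG Hk.
  have [_ [_ Hc]] := gs_dom HG Ha; have [Hk'G _] := gs_dom HG Hk'.
  have [x Hx] := gs_ex HG Hk'G Hc.
  have H1 := proj1 (mul_assoc _ Hk' Ha) Hx; have H2 := proj1 (mul_assoc _ Hk' Hb) Hx.
  by rewrite (gs_fun HG (gs_onel HG HaG) H1) (gs_fun HG (gs_onel HG HbG) H2).
Qed.

Lemma T_trans t t' : t' ∈ T -> t ∈ t' -> t ∈ T.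
Proof.
  rewrite !(cupP HN) => -[H1|/AP H1] H2; first by left; exact: (T0_trans H1 H2).
  by case: (z_atoms_empty HN H1 H2).
Qed.

(** A 2-cycle of [r] through a point that is not an atom would be a 2-cycle of
    membership. *)
Lemma atom_cycle t : t ∈ A <-> exists b, b ∈ T /\ r t b /\ r b t.
Proof.
  split=> [/R_cycle [b [H1 H2]]|[b [_ [[H1|/R_dom []] // [H2|/R_dom []] //]]]].
  - exists b; split; last by rewrite /r; auto.
    by rewrite cupP //; right; have [] := R_dom H1.
  - by case: (mem_asym HN H1 H2).
Qed.

(** A permutation of the transitive set [T] that preserves [r] is trivial: on
    the atoms because the relation on them is rigid, and then by induction
    along membership. *)
Lemma T_rigid (S : N -> N -> Prop) :
  Dfn (fun e => S (e 0) (e 1)) ->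
  (forall t t', S t t' -> t ∈ T /\ t' ∈ T) ->
  (forall t, t ∈ T -> exists t', S t t') ->
  (forall t t' t'', S t t' -> S t t'' -> t' = t'') ->
  (forall t t' t'', S t t'' -> S t' t'' -> t = t') ->
  (forall t, t ∈ T -> exists t', S t' t) ->
  (forall t u t' u', S t t' -> S u u' -> (r t u <-> r t' u')) ->
  forall t t', S t t' -> t = t'.
Proof.
  move=> HS Sdom Sex Sfun Sinj Sonto Sr.
  have SA t t' : S t t' -> (t ∈ A <-> t' ∈ A).
  { move=> H; rewrite !atom_cycle; split=> -[b [Hb [H1 H2]]].
    - have [b' Hb'] := Sex _ Hb; exists b'; split; first by have [] := Sdom _ _ Hb'.
      by rewrite -(Sr _ _ _ _ H Hb') -(Sr _ _ _ _ Hb' H).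
    - have [b' Hb'] := Sonto _ Hb; exists b'; split; first by have [] := Sdom _ _ Hb'.
      by rewrite (Sr _ _ _ _ H Hb') (Sr _ _ _ _ Hb' H). }
  have AT a : a ∈ A -> a ∈ T by rewrite cupP //; auto.
  have rA t t' : t' ∈ A -> (r t t' <-> pair t t' ∈ R).
    by move=> Ht'; split=> [[/(z_atoms_empty HN (proj1 (AP _) Ht')) //|//]|]; right.
  have rS t t' : ~ t' ∈ A -> (r t t' <-> t ∈ t').
    by move=> Ht'; split=> [[//|/R_dom [] //]|]; left.
  have Satom t t' : t ∈ A -> S t t' -> t = t'.
  { move=> Ht Htt'; apply: (R_rigid (g := graph A A S)).
    - apply: graph_bij => //.
      + by move=> x Hx; have [y Hy] := Sex _ (AT _ Hx); exists y; rewrite -(SA _ _ Hy).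
      + by move=> x y y' _ _ _; exact: Sfun.
      + by move=> x x' y _ _ _; exact: Sinj.
      + by move=> y Hy; have [x Hx] := Sonto _ (AT _ Hy); exists x; rewrite (SA _ _ Hx).
    - move=> x y x' y'; rewrite !graphP // => -[Hx [Hx' Hxx]] [Hy [Hy' Hyy]].
      by rewrite -!rA //; exact: Sr.
    - by rewrite graphP //; split=> //; split=> //; rewrite -(SA _ _ Htt'). }
  suff H : forall t t', S t t' -> t = t' by exact: H.
  apply: (eps_induction HN (P := fun t => forall t', S t t' -> t = t') Htc).
    by dfn; apply: (Dfn2_app HS); dfn.
  move=> t IH t' Htt'.
  have [HtA|HtA] := classic (t ∈ A); first exact: Satom.
  have Ht'A : ~ t' ∈ A by rewrite -(SA _ _ Htt').
  have [HtT Ht'T] := Sdom _ _ Htt'.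
  apply: (set_ext HN); [by rewrite /is_set -AP | by rewrite /is_set -AP | move=> z].
  split=> Hz.
  - have [z' Hzz'] := Sex _ (T_trans HtT Hz).
    have Ez := IH _ Hz _ Hzz'; subst z'.
    by rewrite -rS // -(Sr _ _ _ _ Hzz' Htt') rS.
  - have [w Hw] := Sonto _ (T_trans Ht'T Hz).
    have Hwt : w ∈ t by rewrite -rS // (Sr _ _ _ _ Hw Htt') rS.
    by rewrite -(IH _ Hwt _ Hw).
Qed.

Lemma r_irr t : ~ r t t.
Proof. by case=> [/(mem_irrefl HN)|/R_irr]. Qed.

(** An automorphism preserves the loops, so it permutes the points [inQ a a] by
    some map [a |-> a']. Then it sends [inQ a b] to [inQ a' b'], as this vertex lies
    between two loops, and [T] to itself, as no point of [T] has an edge from a loop.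
    It is trivial on [T], so the edges from [inQ one a] to the elements of [G] in
    [T] show that [a'] is [k a], where [k] is the image of [one]. *)
Lemma digraph_full phi : bij_spec phi X X ->
  (forall x y x' y', pair x x' ∈ phi -> pair y y' ∈ phi -> (D x y <-> D x' y')) ->
  exists k, k ∈ G /\ forall x y, pair x y ∈ phi -> Act k x y.
Proof.
  move=> Hphi HD.
  have Hloop p : p ∈ X -> D p p -> exists a, a ∈ G /\ p = inQ a a.
    move=> /XP [[t [_ ->]] /D_TT /r_irr //|[a [b [Ha [Hb ->]]]] /D_QQ [-> _]].
    by exists a.
  have Hpoint a : a ∈ G -> exists a', a' ∈ G /\ pair (inQ a a) (inQ a' a') ∈ phi.
    move=> Ha; have [|p Hp] := bs_ex Hphi (x := inQ a a); first by rewrite inQ_X.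
    have [||a' [Ha' E]] := Hloop p; first by have [] := bs_dom HN Hphi Hp.
      by rewrite -(HD _ _ _ _ Hp Hp) D_QQ; auto.
    by exists a'; rewrite -E.
  have Hpoint' a : a ∈ G -> exists a', a' ∈ G /\ pair (inQ a' a') (inQ a a) ∈ phi.
    move=> Ha; have [|p Hp] := bs_onto Hphi (y := inQ a a); first by rewrite inQ_X.
    have [||a' [Ha' E]] := Hloop p; first by have [] := bs_dom HN Hphi Hp.
      by rewrite (HD _ _ _ _ Hp Hp) D_QQ; auto.
    by exists a'; rewrite -E.
  have Hpair a b a' b' : pair (inQ a a) (inQ a' a') ∈ phi ->
      pair (inQ b b) (inQ b' b') ∈ phi -> pair (inQ a b) (inQ a' b') ∈ phi.
    move=> Ha Hb.
    have HabX : inQ a b ∈ X.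
      have [/inQ_X [? _] _] := bs_dom HN Hphi Ha; have [/inQ_X [? _] _] := bs_dom HN Hphi Hb.
      by rewrite inQ_X.
    have [p Hp] := bs_ex Hphi HabX; have [_ /XP Hpv] := bs_dom HN Hphi Hp.
    have H1 : D (inQ a' a') p by rewrite -(HD _ _ _ _ Ha Hp) D_QQ; auto.
    have H2 : D p (inQ b' b') by rewrite -(HD _ _ _ _ Hp Hb) D_QQ; auto.
    case: Hpv H1 H2 Hp => [[t [_ ->]] /D_QT [_ []] //|[u [v [_ [_ ->]]]]].
    by move=> /D_QQ [-> _] /D_QQ [-> _].
  have HT t p : t ∈ T -> pair (inT t) p ∈ phi -> exists t', t' ∈ T /\ p = inT t'.
    move=> Ht Hp; have [_ /XP [//|[a [b [Ha [_ E]]]]]] := bs_dom HN Hphi Hp; subst p.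
    have [a' [_ Ha']] := Hpoint' _ Ha.
    have : D (inQ a' a') (inT t) by rewrite (HD _ _ _ _ Ha' Hp) D_QQ; auto.
    by rewrite D_QT => -[_ []].
  have HT' t p : t ∈ T -> pair p (inT t) ∈ phi -> exists t', t' ∈ T /\ p = inT t'.
    move=> Ht Hp; have [/XP [//|[a [b [Ha [Hb E]]]]] _] := bs_dom HN Hphi Hp; subst p.
    have [a' [_ Ha']] := Hpoint _ Ha; have [b' [_ Hb']] := Hpoint _ Hb.
    by have /inT_inQ := bs_fun Hphi Hp (Hpair _ _ _ _ Ha' Hb').
  have Hid t p : pair (inT t) p ∈ phi -> p = inT t.
  { move=> Hp; have [/inT_X Ht _] := bs_dom HN Hphi Hp.
    have [t' [Ht' Ep]] := HT _ _ Ht Hp; subst p.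
    have H := @T_rigid (fun t t' => pair (inT t) (inT t') ∈ phi).
    rewrite (H _ _ _ _ _ _ _ t t') //.
    - by rewrite /inT; dfn.
    - by move=> u u' /(bs_dom HN Hphi); rewrite !inT_X.
    - move=> u Hu; have [|q Hq] := bs_ex Hphi (x := inT u); first by rewrite inT_X.
      by have [u' [_ E]] := HT _ _ Hu Hq; exists u'; rewrite -E.
    - by move=> u u' u'' H1 H2; exact: inT_inj (bs_fun Hphi H1 H2).
    - by move=> u u' u'' H1 H2; exact: inT_inj (bs_inj Hphi H1 H2).
    - move=> u Hu; have [|q Hq] := bs_onto Hphi (y := inT u); first by rewrite inT_X.
      by have [u' [_ E]] := HT' _ _ Hu Hq; exists u'; rewrite -E.
    - by move=> u v u' v' H1 H2; rewrite -!D_TT; exact: HD. }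
  have [k [Hk Hk1]] := Hpoint _ (gs_one HG); exists k; split=> //.
  have Hmul a a' : pair (inQ a a) (inQ a' a') ∈ phi -> mul m k a a'.
  { move=> Ha; have [/inQ_X [HaG _] _] := bs_dom HN Hphi Ha.
    have [Eone|Hne] := classic (one = a).
    - subst a; have [<- _] := inQ_inj (bs_fun Hphi Hk1 Ha); exact: (gs_oner HG).
    - have H1 := Hpair _ _ _ _ Hk1 Ha.
      have [|p Hp] := bs_ex Hphi (x := inT a); first by rewrite inT_X cupP //; left; exact: T0_G.
      have Ep := Hid _ _ Hp; subst p.
      have : D (inQ one a) (inT a) by rewrite D_QT; split=> //; exact: (gs_onel HG).
      by rewrite (HD _ _ _ _ H1 Hp) D_QT => -[]. }
  move=> x y Hxy; have [/XP [[t [Ht E]]|[a [b [Ha [Hb E]]]]] _] := bs_dom HN Hphi Hxy; subst x.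
  - by rewrite Act_T; exact: Hid.
  - have [a' [_ Ha']] := Hpoint _ Ha; have [b' [_ Hb']] := Hpoint _ Hb.
    rewrite Act_Q; exists a', b'; split; last by split; exact: Hmul.
    exact: (bs_fun Hphi Hxy (Hpair _ _ _ _ Ha' Hb')).
Qed.

Lemma frucht_group : exists V E Gam c f,
  is_graph V E /\ is_aut_group V E Gam c /\ is_group_iso f G m Gam c.
Proof.
  apply: (@frucht_of_digraph N HN G m one HG X D Act).
  - rewrite /D /r /inT /inQ /mul; dfn.
  - rewrite /Act /inT /inQ /mul; dfn.
  - by exists (inQ one one); rewrite inQ_X; split; exact: (gs_one HG).
  - move=> k x Hk /XP [[t [Ht ->]]|[a [b [Ha [Hb ->]]]]].
    + by exists (inT t); rewrite inT_X Act_T.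
    + have [a' Ha'] := gs_ex HG Hk Ha; have [b' Hb'] := gs_ex HG Hk Hb.
      exists (inQ a' b'); rewrite inQ_X Act_Q.
      have [_ [_ ?]] := gs_dom HG Ha'; have [_ [_ ?]] := gs_dom HG Hb'.
      by split=> //; exists a', b'.
  - move=> k x y y' Hk /XP [[t [Ht ->]]|[a [b [Ha [Hb ->]]]]].
    + by move=> /Act_T -> /Act_T ->.
    + move=> /Act_Q [a1 [b1 [-> [H1 H2]]]] /Act_Q [a2 [b2 [-> [H3 H4]]]].
      by rewrite (gs_fun HG H1 H3) (gs_fun HG H2 H4).
  - move=> x /XP [[t [Ht ->]]|[a [b [Ha [Hb ->]]]]]; first by rewrite Act_T.
    by rewrite Act_Q; exists a, b; split=> //; split; exact: (gs_onel HG).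
  - move=> k l kl x y z Hkl /XP [[t [Ht ->]]|[a [b [Ha [Hb ->]]]]].
    + by move=> /Act_T -> /Act_T ->; rewrite Act_T.
    + move=> /Act_Q [a1 [b1 [-> [H1 H2]]]] /Act_Q [a2 [b2 [-> [H3 H4]]]].
      rewrite Act_Q; exists a2, b2; split=> //.
      by rewrite -(mul_assoc _ Hkl H1) -(mul_assoc _ Hkl H2).
  - move=> k x y x' y' Hk.
    have Eq p q p' q' : mul m k p p' -> mul m k q q' -> (p = q <-> p' = q').
      move=> Hp Hq; split=> E; subst; first exact: (gs_fun HG Hp Hq).
      exact: (mul_cancel Hp Hq).
    move=> /XP [[t [Ht ->]]|[a [b [Ha [Hb ->]]]]] /XP [[u [Hu ->]]|[c [d [Hc [Hd ->]]]]].
    + by move=> /Act_T -> /Act_T ->.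
    + move=> /Act_T -> /Act_Q [c1' [d1 [-> _]]].
      by split=> /D_TQ.
    + move=> /Act_Q [a1 [b1 [-> [H1 H2]]]] /Act_T ->.
      rewrite !D_QT (Eq _ _ _ _ H1 H2); split=> -[H Hne]; split=> //.
        exact/(mul_assoc _ H1 H).
      have [_ [HuG _]] := gs_dom HG H; have [w Hw] := gs_ex HG Ha HuG.
      by rewrite (mul_cancel H2 (proj2 (mul_assoc _ H1 Hw) H)).
    + move=> /Act_Q [a1 [b1 [-> [H1 H2]]]] /Act_Q [c2 [d2 [-> [H3 H4]]]].
      by rewrite !D_QQ (Eq _ _ _ _ H2 H3) (Eq _ _ _ _ H1 H2) (Eq _ _ _ _ H3 H4).
  - move=> k l Hk Hl H.
    have H1 : one ∈ G := gs_one HG.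
    have : Act l (inQ one one) (inQ k k).
      apply: H; first by rewrite inQ_X.
      by rewrite Act_Q; exists k, k; split=> //; split; exact: (gs_oner HG).
    rewrite Act_Q => -[a [b [/inQ_inj [-> _] [Ha _]]]].
    by rewrite (gs_fun HG Ha (gs_oner HG Hl)).
  - exact: digraph_full.
Qed.

End Group.

Theorem frucht_of_rigid : Frucht N.
Proof.
  move=> G m Hgrp; have [one HG] := group_specE HN Hgrp.
  have [T0 [_ [Htr Hsub]]] := Htc G.
  exact: (@frucht_group G m one HG T0).
Qed.
End Rigid.

(** * Natural numbers, recursion and finite sets in a model of ZFA *)

Section ZFAModel.
Variable M : structure.
Hypothesis HM : ZFA M.
Implicit Types x y z u v w n k X Y f h : M.

Lemma ZFA_Zer : Zer M.
Proof.
  case: HM => [H1 _ H3 H4 H5 H6 H7 _ H9 H10 _]; split=> //.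
  move=> P HP x; have [phi [env Hphi]] := Dfn_formula1 HP x.
  have [y [Hy HyP]] := H10 phi env x; exists y; split=> // z.
  by rewrite Hphi.
Qed.
Let HZ := ZFA_Zer.

Lemma replacement (R : M -> M -> Prop) x :
  Dfn (fun e => R (e 0) (e 1)) ->
  (forall u v v', u ∈ x -> R u v -> R u v' -> v = v') ->
  exists y, is_set y /\ forall v, v ∈ y <-> exists u, u ∈ x /\ R u v.
Proof.
  move=> HR Hfun; have [phi [env Hphi]] := Dfn_formula2 HR x.
  have [|y [Hy HyP]] := zfa_replacement HM (phi := phi) (env := env) (x := x).
    by move=> u v v' Hu; rewrite -!Hphi; exact: Hfun.
  exists y; split=> // v; rewrite HyP.
  by split=> -[u [Hu H]]; exists u; move: H; rewrite Hphi.
Qed.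

Lemma omega_exists : exists w : M, is_omega w.
Proof.
  have [v Hv] := zfa_infinity HM.
  pose P x := forall u, is_inductive u -> x ∈ u.
  have HP : Dfn (fun e => P (e 0)) by rewrite /P; dfn.
  exists (sep v P); split; first exact: sep_set.
  have Hin x : P x -> x ∈ sep v P by move=> H; rewrite sepP //; split=> //; exact: H.
  split; last by move=> u Hu z; rewrite sepP // => -[_]; exact.
  split.
  - exists (emp HZ); split; first exact: emp_empty.
    apply: Hin => u [[e [He Heu]] _].
    have -> // : emp HZ = e.
    apply: (set_ext HZ (@emp_set _ HZ) (proj1 He)) => z.
    by split=> [/(empP (HN := HZ))|/(proj2 He)].
  - move=> x; rewrite sepP // => -[_ Hx].
    have Hs s t : is_succ s x -> is_succ t x -> s = t.
      by move=> [Hs1 Hs2] [Ht1 Ht2]; apply: (set_ext HZ) => // z; rewrite Hs2 Ht2.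
    have [s [Hs1 Hsv]] := proj2 Hv x (Hx _ Hv); exists s; split=> //.
    apply: Hin => u Hu; have [t [Ht Htu]] := proj2 Hu x (Hx _ Hu).
    by rewrite (Hs _ _ Hs1 Ht).
Qed.

Definition om : M := proj1_sig (constructive_indefinite_description _ omega_exists).
Lemma om_omega : is_omega om.
Proof. exact: (proj2_sig (constructive_indefinite_description _ omega_exists)). Qed.

Lemma is_omegaE w : is_omega w <-> w = om.
Proof.
  split=> [[H1 [H2 H3]]|->]; last exact: om_omega.
  have [H4 [H5 H6]] := om_omega.
  by apply: (set_ext HZ) => // z; split; [exact: H3 | exact: H6].
Qed.

Definition zero : M := emp HZ.
Definition succ n := adjoin n n.

Lemma is_emptyE e : is_empty e <-> e = zero.
Proof.
  split=> [[H1 H2]|->]; last exact: emp_empty.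
  apply: (set_ext HZ) => // [|z]; first exact: emp_set.
  by split=> [/H2|/(empP (HN := HZ))].
Qed.

Lemma is_succE s x : is_succ s x <-> s = succ x.
Proof.
  split=> [[H1 H2]|->].
  - by apply: (set_ext HZ) => // [|z]; [exact: adjoin_set | rewrite H2 adjoinP].
  - by split; [exact: adjoin_set | move=> z; rewrite adjoinP].
Qed.

Lemma is_inductiveE w : is_inductive w <-> zero ∈ w /\ forall x, x ∈ w -> succ x ∈ w.
Proof.
  split=> [[[e [/is_emptyE -> He]] H]|[H1 H2]]; split=> //.
  - by move=> x /H [s [/is_succE ->]].
  - by exists zero; rewrite is_emptyE.
  - by move=> x /H2 H; exists (succ x); rewrite is_succE.
Qed.

Lemma om_zero : zero ∈ om.
Proof. by have [_ [/is_inductiveE [] ]] := om_omega. Qed.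
Lemma om_succ n : n ∈ om -> succ n ∈ om.
Proof. by have [_ [/is_inductiveE [_ H] _]] := om_omega; exact: H. Qed.

Lemma om_ind (P : M -> Prop) : Dfn (fun e => P (e 0)) -> P zero ->
  (forall n, n ∈ om -> P n -> P (succ n)) -> forall n, n ∈ om -> P n.
Proof.
  move=> HP H0 HS n Hn; have [_ [_ Hmin]] := om_omega.
  have : n ∈ sep om P; last by rewrite sepP // => -[].
  apply: Hmin => //; rewrite is_inductiveE !sepP //.
  split=> [|x]; first by split; first exact: om_zero.
  by rewrite !sepP // => -[Hx HPx]; split; [exact: om_succ | exact: HS].
Qed.

Lemma succP n z : z ∈ succ n <-> z ∈ n \/ z = n.
Proof. exact: adjoinP. Qed.

Lemma zeroP z : ~ z ∈ zero. Proof. exact: empP. Qed.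

Lemma succ_zero n : succ n <> zero.
Proof. by move=> E; apply: (zeroP (z := n)); rewrite -E succP; auto. Qed.

Lemma succ_inj n k : succ n = succ k -> n = k.
Proof.
  move=> E; have : n ∈ succ k by rewrite -E succP; auto.
  have : k ∈ succ n by rewrite E succP; auto.
  by rewrite !succP => -[H1|//] [/(mem_asym HZ H1)|].
Qed.

Lemma om_trichotomy n k : n ∈ om -> k ∈ om -> n ∈ k \/ n = k \/ k ∈ n.
Proof.
  move=> Hn; move: n Hn k.
  apply: (om_ind (P := fun n => forall k, k ∈ om -> n ∈ k \/ n = k \/ k ∈ n)); first by dfn.
  - apply: om_ind; first by dfn.
    + by auto.
    + by move=> k Hk; rewrite !succP => -[|[|/zeroP]]; auto.
  - move=> n Hn IH; apply: om_ind; first by rewrite /succ; dfn.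
    + by right; right; rewrite succP; case: (IH _ om_zero) => [/zeroP|[]]; auto.
    + move=> k Hk [|[|]].
      * by rewrite !succP; auto.
      * by move=> <-; rewrite !succP; auto.
      * rewrite succP => -[H|->]; last by auto.
        case: (IH _ (om_succ Hk)) => [/succP [H'|E]|[E|H']].
        -- by case: (mem_asym HZ H H').
        -- by subst; case: (mem_irrefl HZ H).
        -- by rewrite E; right; right; rewrite succP; auto.
        -- by right; right; rewrite succP; auto.
Qed.

Lemma om_least (P : M -> Prop) : Dfn (fun e => P (e 0)) ->
  (exists n, n ∈ om /\ P n) ->
  exists n, n ∈ om /\ P n /\ forall k, k ∈ om -> P k -> ~ k ∈ n.
Proof.
  move=> HP [n [Hn HPn]].
  have [|k []] := z_found HZ (x := sep om P).
    by exists n; rewrite sepP.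
  rewrite sepP // => -[Hk HPk] Hmin; exists k; do !split=> //.
  by move=> i Hi HPi; apply: Hmin; rewrite sepP.
Qed.

(** Recursion along [om] for a possibly partial step relation: the witness [h]
    contains with each pair the pairs that it is obtained from, so no
    attempt needs to be a function. *)
Section Recursion.
Variables (a : M) (S : M -> M -> M -> Prop).
Hypothesis DS : Dfn (fun e => S (e 0) (e 1) (e 2)).
Hypothesis S_fun : forall n u v v', n ∈ om -> S n u v -> S n u v' -> v = v'.

Definition justified h : Prop := forall p, p ∈ h -> p = pair zero a \/
  exists n u v, n ∈ om /\ pair n u ∈ h /\ S n u v /\ p = pair (succ n) v.
Definition Rec n y : Prop := exists h, justified h /\ pair n y ∈ h.

Lemma Dfn_Rec : Dfn (fun e => Rec (e 0) (e 1)).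
Proof. by rewrite /Rec /justified /succ; dfn; apply: (Dfn3_app DS); dfn. Qed.

Lemma Rec_zero : Rec zero a.
Proof.
  exists (upair (pair zero a) (pair zero a)); split; last by rewrite upairP; auto.
  by move=> p; rewrite upairP // => -[]; auto.
Qed.

Lemma Rec_succ n u v : n ∈ om -> Rec n u -> S n u v -> Rec (succ n) v.
Proof.
  move=> Hn [h [Hh Hnu]] HS; exists (adjoin h (pair (succ n) v)).
  split; last by rewrite adjoinP; auto.
  move=> p; rewrite adjoinP // => -[/Hh [->|[k [w [w' [Hk [Hkw [HS' ->]]]]]]]|->]; first by auto.
  - by right; exists k, w, w'; rewrite adjoinP; auto.
  - by right; exists n, u, v; rewrite adjoinP; auto.
Qed.

Lemma Rec_zero_inv y : Rec zero y -> y = a.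
Proof.
  move=> [h [Hh /Hh [|[n [u [v [_ [_ [_ ]]]]]]]]] /(pair_inj HZ) [] //.
  by move=> E; case: (succ_zero (eq_sym E)).
Qed.

Lemma Rec_succ_inv n y : Rec (succ n) y -> exists u, Rec n u /\ S n u y.
Proof.
  move=> [h [Hh /Hh [|[k [u [v [Hk [Hu [HS ]]]]]]]]] /(pair_inj HZ) [].
  - by move=> E; case: (succ_zero E).
  - by move=> /succ_inj -> ->; exists u; split=> //; exists h.
Qed.

Lemma Rec_fun n y y' : n ∈ om -> Rec n y -> Rec n y' -> y = y'.
Proof.
  move=> Hn; move: n Hn y y'; apply: om_ind.
    by do 2!apply: Dfn_all; do 2!(apply: Dfn_imp; first by apply: (Dfn2_app Dfn_Rec); dfn); dfn.
  - by move=> y y' /Rec_zero_inv -> /Rec_zero_inv ->.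
  - move=> n Hn IH y y' /Rec_succ_inv [u [Hu HS]] /Rec_succ_inv [u' [Hu' HS']].
    by move: HS'; rewrite (IH _ _ Hu' Hu) => HS'; exact: S_fun HS HS'.
Qed.

Lemma Rec_inv (I : M -> Prop) : Dfn (fun e => I (e 0)) -> I a ->
  (forall n u, n ∈ om -> I u -> exists v, S n u v /\ I v) ->
  forall n, n ∈ om -> exists y, Rec n y /\ I y.
Proof.
  move=> DI Ia HI; apply: om_ind.
    by apply: Dfn_ex; apply: Dfn_and; [apply: (Dfn2_app Dfn_Rec) | apply: (Dfn1_app DI)]; dfn.
  - by exists a; split=> //; exact: Rec_zero.
  - move=> n Hn [u [Hu HIu]]; have [v [Hv HIv]] := HI _ _ Hn HIu.
    by exists v; split=> //; exact: Rec_succ Hn Hu Hv.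
Qed.
End Recursion.

(** The iterated unions of [x] form a set by recursion and replacement, and their
    union is transitive. *)
Lemma ZFA_closures : has_closures M.
Proof.
  move=> x; pose S n u v := v = bigcup u.
  have DS : Dfn (fun e => S (e 0) (e 1) (e 2)) by rewrite /S; dfn.
  have S_fun n u v v' : n ∈ om -> S n u v -> S n u v' -> v = v' by move=> _ -> ->.
  have [y [_ Hy]] := replacement (Dfn_Rec x DS) (x := om)
    (fun n v v' Hn => Rec_fun DS S_fun Hn).
  exists (bigcup y); split; first exact: bigcup_set; split.
  - move=> z; rewrite bigcupP // => -[u [/Hy [n [Hn Hu]] Hz]] w Hw.
    rewrite bigcupP //; exists (bigcup u); rewrite Hy; split; last by rewrite bigcupP //; exists z.
    by exists (succ n); split; [exact: om_succ | exact: Rec_succ Hn Hu _].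
  - move=> z Hz; rewrite bigcupP //; exists x; split=> //; rewrite Hy.
    by exists zero; split; [exact: om_zero | exact: Rec_zero].
Qed.

(** ** Finite sets *)

Lemma is_finiteE X : is_finite X <-> exists n f, n ∈ om /\ is_bijection f X n.
Proof.
  split=> [[w [n [f [/is_omegaE -> H]]]]|[n [f H]]]; first by exists n, f.
  by exists om, n, f; split=> //; exact: om_omega.
Qed.

Lemma fin_empty : is_finite zero.
Proof.
  rewrite is_finiteE; exists zero, (graph zero zero (fun x y => x = y)).
  split; first exact: om_zero.
  rewrite is_bijectionE //; apply: graph_bij => //; first by dfn.
  - by move=> x /zeroP.
  - by move=> x y y' /zeroP.
  - by move=> x x' y /zeroP.
  - by move=> y /zeroP.
Qed.

Lemma fin_adjoin X x : is_finite X -> is_finite (adjoin X x).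
Proof.
  rewrite !is_finiteE => -[n [f [Hn]]]; rewrite is_bijectionE // => Hf.
  have [Hx|Hx] := classic (x ∈ X).
  - exists n, f; split=> //; have -> : adjoin X x = X.
      apply: (set_ext HZ); [exact: adjoin_set | exact: (mem_set HZ Hx) | move=> z].
      by rewrite adjoinP //; split=> [[//|->]|]; auto.
    by rewrite is_bijectionE.
  - pose R u v := pair u v ∈ f \/ (u = x /\ v = n).
    exists (succ n), (graph (adjoin X x) (succ n) R); split; first exact: om_succ.
    rewrite is_bijectionE //; apply: graph_bij => //; first by rewrite /R; dfn.
    + move=> u; rewrite adjoinP // => -[Hu|->].
      * have [v Hv] := bs_ex Hf Hu; exists v; rewrite succP /R.
        by have [_ ?] := bs_dom HZ Hf Hv; auto.
      * by exists n; rewrite succP /R; auto.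
    + move=> u v v' _ _ _ [H|[Eu Ev]] [H'|[Eu' Ev']]; subst => //.
      * exact: (bs_fun Hf H H').
      * by have [] := bs_dom HZ Hf H.
      * by have [] := bs_dom HZ Hf H'.
    + move=> u u' v _ _ _ [H|[Eu Ev]] [H'|[Eu' Ev']]; subst => //.
      * exact: (bs_inj Hf H H').
      * by have [_ /(mem_irrefl HZ)] := bs_dom HZ Hf H.
      * by have [_ /(mem_irrefl HZ)] := bs_dom HZ Hf H'.
    + move=> v; rewrite succP => -[Hv|->].
      * have [u Hu] := bs_onto Hf Hv; exists u; rewrite adjoinP // /R.
        by have [? _] := bs_dom HZ Hf Hu; auto.
      * by exists x; rewrite adjoinP // /R; auto.
Qed.

(** Induction on the number of elements: the element sent to the top of [succ n]
    by a bijection is taken away. *)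
Lemma fin_ind (P : M -> Prop) : Dfn (fun e => P (e 0)) -> P zero ->
  (forall X x, is_set X -> is_finite X -> P X -> P (adjoin X x)) ->
  forall X, is_set X -> is_finite X -> P X.
Proof.
  move=> DP P0 PS X HX /is_finiteE [n [f [Hn]]].
  move: n Hn f X HX.
  apply: (om_ind (P := fun n => forall f X, is_set X -> is_bijection f X n -> P X)).
    by dfn; apply: (Dfn1_app DP); dfn.
  - move=> f X HX; rewrite is_bijectionE // => Hf.
    have -> // : X = zero.
    apply: (set_ext HZ) => // [|z]; first exact: emp_set.
    split=> [Hz|/zeroP //]; have [v Hv] := bs_ex Hf Hz.
    by have [_ /zeroP] := bs_dom HZ Hf Hv.
  - move=> n Hn IH f X HX; rewrite is_bijectionE // => Hf.
    have [|x Hx] := bs_onto Hf (y := n); first by rewrite succP; auto.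
    have DQ : Dfn (fun e => e 0 <> x) by dfn.
    pose X' := sep X (fun z => z <> x).
    have EX : X = adjoin X' x.
      apply: (set_ext HZ) => // [|z]; first exact: adjoin_set.
      rewrite adjoinP // sepP //; split=> [Hz|[[//]|->]].
        by have [->|] := classic (z = x); auto.
      by have [] := bs_dom HZ Hf Hx.
    have HX' : is_set X' by exact: sep_set.
    have Hbij : is_bijection (graph X' n (fun u v => pair u v ∈ f)) X' n.
    { rewrite is_bijectionE //; apply: graph_bij => //; first by dfn.
      - move=> u; rewrite sepP // => -[Hu Hne]; have [v Hv] := bs_ex Hf Hu.
        have [_ /succP [?|E]] := bs_dom HZ Hf Hv; first by exists v.
        by rewrite E in Hv; case: Hne; exact: (bs_inj Hf Hv Hx).
      - by move=> u v v' _ _ _; exact: (bs_fun Hf).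
      - by move=> u u' v _ _ _; exact: (bs_inj Hf).
      - move=> v Hv; have [|u Hu] := bs_onto Hf (y := v); first by rewrite succP; auto.
        exists u; split=> //; rewrite sepP //; split; first by have [] := bs_dom HZ Hf Hu.
        by move=> E; rewrite E in Hu; move: Hv; rewrite (bs_fun Hf Hu Hx) => /(mem_irrefl HZ). }
    rewrite EX; apply: PS => //; last exact: IH HX' Hbij.
    by rewrite is_finiteE; exists n, (graph X' n (fun u v => pair u v ∈ f)).
Qed.

Lemma fin_image (R : M -> M -> Prop) X Y : Dfn (fun e => R (e 0) (e 1)) ->
  (forall x y y', R x y -> R x y' -> y = y') ->
  is_set X -> is_finite X -> is_set Y ->
  (forall y, y ∈ Y -> exists x, x ∈ X /\ R x y) -> is_finite Y.
Proof.
  move=> DR Rfun HX HfX; move: X HX HfX Y.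
  apply: (fin_ind (P := fun X => forall Y, is_set Y ->
    (forall y, y ∈ Y -> exists x, x ∈ X /\ R x y) -> is_finite Y)).
    by dfn; apply: (Dfn2_app DR); dfn.
  - move=> Y HY H; have -> : Y = zero; last exact: fin_empty.
    apply: (set_ext HZ) => // [|z]; first exact: emp_set.
    by split=> [/H [x [/zeroP]]|/zeroP].
  - move=> X x HX HfX IH Y HY H.
    have DQ : Dfn (fun e => exists u, u ∈ X /\ R u (e 0)).
      by dfn; apply: (Dfn2_app DR); dfn.
    pose Y' := sep Y (fun y => exists u, u ∈ X /\ R u y).
    have HY' : is_set Y' by exact: sep_set.
    have HfY' : is_finite Y' by apply: IH => // y; rewrite sepP // => -[].
    have [[y [Hy Hxy]]|Hn] := classic (exists y, y ∈ Y /\ R x y).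
    + have -> : Y = adjoin Y' y; last exact: fin_adjoin.
      apply: (set_ext HZ) => // [|z]; first exact: adjoin_set.
      rewrite adjoinP // sepP //; split=> [Hz|[[] //|-> //]].
      have [u []] := H _ Hz; rewrite adjoinP // => -[Hu|->] Huz.
        by left; split=> //; exists u.
      by right; exact: Rfun Huz Hxy.
    + have -> // : Y = Y'; apply: (set_ext HZ) => // z.
      rewrite sepP //; split=> [Hz|[] //]; split=> //.
      have [u []] := H _ Hz; rewrite adjoinP // => -[Hu|->] Huz; first by exists u.
      by case: Hn; exists z.
Qed.

Lemma fin_sub X Y : is_set X -> is_finite X -> is_set Y -> subset Y X -> is_finite Y.
Proof.
  move=> HX HfX HY H; apply: (fin_image (R := fun x y => x = y)) HX HfX HY _.
  - by dfn.
  - by move=> x y y' <-.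
  - by move=> y /H Hy; exists y.
Qed.

Lemma fin_cup X Y : is_set X -> is_finite X -> is_set Y -> is_finite Y ->
  is_finite (cup X Y).
Proof.
  move=> HX HfX HY HfY; move: X HX HfX; apply: fin_ind; first by dfn.
  - have -> // : cup zero Y = Y; apply: (set_ext HZ) => // [|z]; first exact: cup_set.
    by rewrite cupP //; split=> [[/zeroP|]|]; auto.
  - move=> X x HX _ IH.
    have -> : cup (adjoin X x) Y = adjoin (cup X Y) x; last exact: fin_adjoin.
    apply: (set_ext HZ); [exact: cup_set | exact: adjoin_set | move=> z].
    by rewrite (adjoinP HZ (cup X Y)) (cupP HZ (adjoin X x)) (adjoinP HZ X) (cupP HZ X Y); tauto.
Qed.

End ZFAModel.

(** * Back and forth in the random graph *)

Section BackForth.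
Variable M : structure.
Hypothesis HM : ZFA M.
Let HZ := ZFA_Zer HM.
Let om := om HM.
Variables (A E enum : M).
Implicit Types x y z u v w n k p q a b U W : M.
Hypothesis E_sym : forall x y, pair x y ∈ E -> pair y x ∈ E.
Hypothesis E_irr : forall x, ~ pair x x ∈ E.
Hypothesis enum_bij : bij_spec enum om A.
Hypothesis extension : forall U W, is_set U -> is_set W -> subset U A -> subset W A ->
  is_finite U -> is_finite W -> (forall x, ~ (x ∈ U /\ x ∈ W)) ->
  exists v, v ∈ A /\ ~ v ∈ U /\ ~ v ∈ W /\
    (forall u, u ∈ U -> pair v u ∈ E) /\ (forall w, w ∈ W -> ~ pair v w ∈ E).

(** Finite partial isomorphisms. *)
Definition partial p : Prop :=
  is_set p /\ is_finite p /\
  (forall z, z ∈ p -> exists x y, x ∈ A /\ y ∈ A /\ z = pair x y) /\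
  forall x y x' y', pair x y ∈ p -> pair x' y' ∈ p ->
    (x = x' <-> y = y') /\ (pair x x' ∈ E <-> pair y y' ∈ E).

Lemma Dfn_partial : Dfn (fun e => partial (e 0)).
Proof. by rewrite /partial; dfn. Qed.

(** [b] may be the value at [a] of an extension of [p]. *)
Definition good p a b : Prop :=
  forall x y, pair x y ∈ p -> (x = a <-> y = b) /\ (pair x a ∈ E <-> pair y b ∈ E).

Lemma partial_dom p x y : partial p -> pair x y ∈ p -> x ∈ A /\ y ∈ A.
Proof. by move=> [_ [_ [H _]]] /H [x' [y' [Hx [Hy /(pair_inj HZ) [-> ->]]]]]. Qed.

(** The extension property, applied to the values of [p] at the neighbours and
    the non-neighbours of [a]; the values among the latter keep [b] out of the
    range of [p]. *)
Lemma good_new p a Z : partial p -> a ∈ A -> (forall y, ~ pair a y ∈ p) ->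
  is_set Z -> is_finite Z -> subset Z A -> exists b, b ∈ A /\ ~ b ∈ Z /\ good p a b.
Proof.
  move=> Hp Ha Hap HZs HZf HZA; have [Hps [Hpf [Hpp Hpi]]] := Hp.
  pose P y := exists x, pair x y ∈ p /\ pair x a ∈ E.
  pose Q y := exists x, pair x y ∈ p /\ ~ pair x a ∈ E.
  have DP : Dfn (fun e => P (e 0)) by rewrite /P; dfn.
  have DQ : Dfn (fun e => Q (e 0)) by rewrite /Q; dfn.
  have DnP : Dfn (fun e => ~ P (e 0)) by dfn.
  pose U := sep A P; pose W := cup (sep A Q) (sep Z (fun y => ~ P y)).
  have Hsnd Y : is_set Y -> (forall y, y ∈ Y -> exists x, pair x y ∈ p) -> is_finite Y.
  { move=> HY H; apply: (fin_image HM (R := fun z y => exists x, z = pair x y) _ _ Hps) => //.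
    - by dfn.
    - by move=> z y y' [x ->] [x' /(pair_inj HZ) []].
    - by move=> y /H [x Hx]; exists (pair x y); split=> //; exists x. }
  have [|||||||b [Hb [HbU [HbW [H1 H2]]]]] := @extension U W.
  - exact: sep_set.
  - exact: cup_set.
  - by move=> y; rewrite sepP // => -[].
  - by move=> y; rewrite cupP // !sepP // => -[[]|[/HZA]].
  - by apply: Hsnd => [|y]; [exact: sep_set | rewrite sepP // => -[_ [x [H _]]]; exists x].
  - apply: fin_cup => //; try exact: sep_set.
      by apply: Hsnd => [|y]; [exact: sep_set | rewrite sepP // => -[_ [x [H _]]]; exists x].
    by apply: (fin_sub HM HZs HZf) => [|y]; [exact: sep_set | rewrite sepP // => -[]].
  - move=> y; rewrite cupP // !sepP // => -[[_ HPy] [[_ [x [Hx Hn]]]|[_ //]]].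
    have [x' [Hx' HE]] := HPy; apply: Hn.
    by have [[_ E1] _] := Hpi _ _ _ _ Hx Hx'; rewrite E1.
  - exists b; split=> //.
    have HnP : ~ P b by move=> H; apply: HbU; rewrite sepP.
    have HnQ : ~ Q b by move=> H; apply: HbW; rewrite cupP // sepP; auto.
    split; first by move=> H; apply: HbW; rewrite cupP // !sepP; auto.
    move=> x y Hxy; have [Hx Hy] := partial_dom Hp Hxy; split.
    + split=> [Ex|Ey]; first by subst; case: (Hap _ Hxy).
      subst; have [HE|HE] := classic (pair x a ∈ E).
        by case: HnP; exists x.
      by case: HnQ; exists x.
    + split=> HE.
        by apply: E_sym; apply: H1; rewrite sepP //; split=> //; exists x.
      apply: NNPP => Hn; apply: (H2 y); last exact: E_sym.
      by rewrite cupP // sepP //; left; split=> //; exists x.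
Qed.

Lemma good_exists p a : partial p -> a ∈ A -> exists b, b ∈ A /\ good p a b.
Proof.
  move=> Hp Ha; have [[b Hab]|Hn] := classic (exists b, pair a b ∈ p).
  - have [_ Hb] := partial_dom Hp Hab; exists b; split=> // x y Hxy.
    by have [_ [_ [_ H]]] := Hp; exact: H.
  - have [||||b [Hb [_ H]]] := good_new (Z := emp HZ) Hp Ha.
    + by move=> y H; apply: Hn; exists y.
    + exact: emp_set.
    + exact: fin_empty.
    + by move=> y /(empP (HN := HZ)).
    + by exists b.
Qed.

Definition converse p := graph A A (fun y x => pair x y ∈ p).
Lemma converseP p x y : partial p -> pair y x ∈ converse p <-> pair x y ∈ p.
Proof.
  move=> Hp; rewrite graphP //; first by dfn.
  split=> [[_ [_ //]]|H]; by have [] := partial_dom Hp H.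
Qed.

Lemma converse_partial p : partial p -> partial (converse p).
Proof.
  move=> Hp; have [Hps [Hpf [Hpp Hpi]]] := Hp.
  have DR : Dfn (fun e => pair (e 1) (e 0) ∈ p) by dfn.
  have Hcs : is_set (converse p) by exact: (graph_set HZ (R := fun y x => pair x y ∈ p)).
  have Hcp z : z ∈ converse p -> exists x y, x ∈ A /\ y ∈ A /\ z = pair x y.
    by move/(graph_pairs HZ (R := fun y x => pair x y ∈ p)); apply.
  split=> //; split; last split=> //.
  - apply: (fin_image HM (R := fun z z' => exists x y, z = pair x y /\ z' = pair y x) _ _ Hps) => //.
    + by dfn.
    + by move=> z u u' [x [y [-> ->]]] [x' [y' [/(pair_inj HZ) [-> ->] ->]]].
    + move=> z Hz; have [y [x [Hy [Hx E1]]]] := Hcp _ Hz; subst z.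
      by exists (pair x y); rewrite -converseP //; split=> //; exists x, y.
  - move=> x y x' y'; rewrite !converseP // => H H'.
    by have [-> ->] := Hpi _ _ _ _ H H'.
Qed.

Lemma good_exists' p b : partial p -> b ∈ A -> exists a, a ∈ A /\ good p a b.
Proof.
  move=> Hp Hb; have [a [Ha H]] := good_exists (converse_partial Hp) Hb.
  exists a; split=> // x y; rewrite -converseP // => Hyx.
  by have [E1 E2] := H y x Hyx; rewrite E1 E2.
Qed.

Lemma partial_adjoin p a b : partial p -> a ∈ A -> b ∈ A -> good p a b ->
  partial (adjoin p (pair a b)).
Proof.
  move=> Hp Ha Hb Hg; have [Hps [Hpf [Hpp Hpi]]] := Hp.
  split; first exact: adjoin_set.
  split; first exact: fin_adjoin.
  split.
    by move=> z; rewrite adjoinP // => -[/Hpp //|->]; exists a, b.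
  have HE x y : pair x y ∈ E <-> pair y x ∈ E by split; exact: E_sym.
  move=> x y x' y'; rewrite !adjoinP // => -[H|/(pair_inj HZ) [-> ->]] [H'|/(pair_inj HZ) [-> ->]].
  - exact: Hpi.
  - exact: Hg.
  - have [H1 H2] := Hg _ _ H'; rewrite (HE a) (HE b) H2.
    by split=> //; split=> E1; apply: eq_sym; apply H1.
  - split; first by split.
    by split=> H; case: (E_irr H).
Qed.

(** Choices are made along the enumeration, so that each step of the
    construction is determined by the preceding one. *)
Definition before x y : Prop :=
  exists i j, pair i x ∈ enum /\ pair j y ∈ enum /\ i ∈ j.
Definition least (P : M -> Prop) b : Prop :=
  b ∈ A /\ P b /\ forall b', b' ∈ A -> P b' -> ~ before b' b.

Lemma least_exists (P : M -> Prop) : Dfn (fun e => P (e 0)) ->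
  (exists b, b ∈ A /\ P b) -> exists b, least P b.
Proof.
  move=> DP [b [Hb HPb]].
  have [||i [Hi [[x [Hx HPx]] Hmin]]] := @om_least _ HM (fun i => exists x, pair i x ∈ enum /\ P x).
  - by dfn; apply: (Dfn1_app DP); dfn.
  - have [i Hib] := bs_onto enum_bij Hb; exists i.
    by have [? _] := bs_dom HZ enum_bij Hib; split=> //; exists b.
  - exists x; split; first by have [] := bs_dom HZ enum_bij Hx.
    split=> // b' Hb' HPb' [j [i' [Hj [Hi' Hji]]]].
    have Ei := bs_inj enum_bij Hi' Hx; subst i'.
    apply: (Hmin j) => //; first by have [] := bs_dom HZ enum_bij Hj.
    by exists b'.
Qed.

Lemma least_unique (P : M -> Prop) b b' : least P b -> least P b' -> b = b'.
Proof.
  move=> [Hb [HPb H]] [Hb' [HPb' H']].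
  have [i Hi] := bs_onto enum_bij Hb; have [j Hj] := bs_onto enum_bij Hb'.
  have [Hio _] := bs_dom HZ enum_bij Hi; have [Hjo _] := bs_dom HZ enum_bij Hj.
  case: (om_trichotomy Hio Hjo) => [Hij|[Eij|Hji]].
  - by case: (H' b Hb HPb); exists i, j.
  - by subst; exact: (bs_fun enum_bij Hi Hj).
  - by case: (H b' Hb' HPb'); exists j, i.
Qed.

(** One step puts the [n]-th point into the domain and into the range. *)
Definition step n p q : Prop :=
  exists c b a, pair n c ∈ enum /\ least (fun b => good p c b) b /\
    least (fun a => good (adjoin p (pair c b)) a c) a /\
    q = adjoin (adjoin p (pair c b)) (pair a c).

Lemma Dfn_step : Dfn (fun e => step (e 0) (e 1) (e 2)).
Proof. by rewrite /step /least /before /good; dfn. Qed.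

Lemma step_fun n p q q' : n ∈ om -> step n p q -> step n p q' -> q = q'.
Proof.
  move=> _ [c [b [a [Hc [Hb [Ha ->]]]]]] [c' [b' [a' [Hc' [Hb' [Ha' ->]]]]]].
  have Ec := bs_fun enum_bij Hc Hc'; subst c'.
  have Eb := least_unique Hb Hb'; subst b'.
  by have Ea := least_unique Ha Ha'; subst a'.
Qed.

Lemma step_exists n p : n ∈ om -> partial p -> exists q, step n p q /\ partial q.
Proof.
  move=> Hn Hp; have [c Hc] := bs_ex enum_bij Hn; have [_ HcA] := bs_dom HZ enum_bij Hc.
  have [|b Hb] := @least_exists (fun b => good p c b) _ (good_exists Hp HcA).
    by rewrite /good; dfn.
  have [HbA [Hgb _]] := Hb; have Hp1 := partial_adjoin Hp HcA HbA Hgb.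
  have [|a Ha] := @least_exists (fun a => good (adjoin p (pair c b)) a c) _ (good_exists' Hp1 HcA).
    by rewrite /good; dfn.
  have [HaA [Hga _]] := Ha; have Hp2 := partial_adjoin Hp1 HaA HcA Hga.
  by exists (adjoin (adjoin p (pair c b)) (pair a c)); split=> //; exists c, b, a.
Qed.

(** The steps form an increasing chain of finite partial isomorphisms, whose
    union is total and onto. *)
Lemma partial_extends p0 : partial p0 -> exists sigma, aut_spec sigma A E /\ subset p0 sigma.
Proof.
  move=> Hp0; pose Rc := @Rec _ HM p0 step.
  have DRc : Dfn (fun e => Rc (e 0) (e 1)) by exact: Dfn_Rec Dfn_step.
  have Hex := Rec_inv Dfn_step Dfn_partial Hp0 step_exists.
  have Hfun n q q' : n ∈ om -> Rc n q -> Rc n q' -> q = q'.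
    by move=> Hn; exact: (Rec_fun Dfn_step step_fun Hn).
  have Hpart n q : n ∈ om -> Rc n q -> partial q.
    by move=> Hn Hq; have [q' [Hq' H]] := Hex n Hn; rewrite (Hfun _ _ _ Hn Hq Hq').
  have Hmono n k q q' : n ∈ om -> k ∈ om -> n ∈ k -> Rc n q -> Rc k q' -> subset q q'.
  { move=> Hn Hk Hnk Hq; move: k Hk Hnk q'.
    apply: (om_ind (HM := HM) (P := fun k => n ∈ k -> forall q', Rc k q' -> subset q q')).
    - apply: Dfn_imp; first by dfn.
      apply: Dfn_all; apply: Dfn_imp; last by dfn.
      by apply: (Dfn2_app DRc); dfn.
    - by move/zeroP.
    - move=> k Hk IH; rewrite (succP HM) => Hnk q' /(Rec_succ_inv (HM := HM)) [u [Hu Hstep]].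
      have Hqu : subset q u.
        by case: Hnk => [/IH|E1]; [apply | subst k; rewrite (Hfun _ _ _ Hn Hq Hu)].
      case: Hstep => [c [b [a [_ [_ [_ ->]]]]]] z /Hqu Hz.
      by rewrite !adjoinP //; auto. }
  pose S x y := exists n q, n ∈ om /\ Rc n q /\ pair x y ∈ q.
  have DS : Dfn (fun e => S (e 0) (e 1)).
    rewrite /S; do 2!apply: Dfn_ex; apply: Dfn_and; first by dfn.
    by apply: Dfn_and; [apply: (Dfn2_app DRc); dfn | dfn].
  have Hboth x y x' y' : S x y -> S x' y' -> exists q, partial q /\ pair x y ∈ q /\ pair x' y' ∈ q.
  { move=> [n [q [Hn [Hq Hxy]]]] [k [q' [Hk [Hq' Hxy']]]].
    case: (om_trichotomy Hn Hk) => [H|[H|H]].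
    - by exists q'; split; [exact: Hpart Hq' | split=> //; exact: Hmono H Hq Hq' _ Hxy].
    - subst k; rewrite (Hfun _ _ _ Hn Hq Hq') in Hxy.
      by exists q'; split=> //; exact: Hpart Hq'.
    - by exists q; split; [exact: Hpart Hq | split=> //; exact: Hmono H Hq' Hq _ Hxy']. }
  have Hpoint x : x ∈ A -> (exists y, S x y) /\ (exists y, S y x).
  { move=> Hx; have [n Hnx] := bs_onto enum_bij Hx; have [Hn _] := bs_dom HZ enum_bij Hnx.
    have [q [Hq Hqp]] := Hex n Hn; have [q' [Hst _]] := step_exists Hn Hqp.
    have [c [b [a [Hc [_ [_ Eq']]]]]] := Hst.
    have Ec := bs_fun enum_bij Hc Hnx; subst c.
    have Hq' := Rec_succ Hn Hq Hst.
    have Hsn := om_succ Hn.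
    by split; [exists b | exists a]; exists (succ n), q'; do !split=> //;
      rewrite Eq' !adjoinP //; auto. }
  have HSA x y : S x y -> x ∈ A /\ y ∈ A.
    by move=> [n [q [Hn [Hq]]]]; apply: partial_dom; exact: Hpart Hq.
  exists (graph A A S); split; first split.
  - apply: graph_bij => //.
    + by move=> x /Hpoint [[y Hy] _]; exists y; have [] := HSA _ _ Hy.
    + move=> x y y' _ _ _ H H'; have [q [[_ [_ [_ Hq]]] [H1 H2]]] := Hboth _ _ _ _ H H'.
      by apply/(proj1 (Hq _ _ _ _ H1 H2)).
    + move=> x y y' _ _ _ H H'; have [q [[_ [_ [_ Hq]]] [H1 H2]]] := Hboth _ _ _ _ H H'.
      by apply/(proj1 (Hq _ _ _ _ H1 H2)).
    + by move=> x /Hpoint [_ [y Hy]]; exists y; have [] := HSA _ _ Hy.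
  - move=> x y x' y'; rewrite !graphP // => -[_ [_ H]] [_ [_ H']].
    have [q [[_ [_ [_ Hq]]] [H1 H2]]] := Hboth _ _ _ _ H H'.
    exact: (proj2 (Hq _ _ _ _ H1 H2)).
  - move=> z Hz; have [_ [_ [Hpp _]]] := Hp0; have [x [y [Hx [Hy Ez]]]] := Hpp _ Hz; subst z.
    rewrite graphP //; do !split=> //; exists (zero HM), p0; split; first exact: om_zero.
    by split=> //; exact: Rec_zero.
Qed.

(** The identity on [e] extends to a partial isomorphism sending [a] to a
    different point with the same neighbours in [e]. *)
Lemma moving_automorphism e a : is_set e -> is_finite e -> subset e A -> a ∈ A -> ~ a ∈ e ->
  exists sigma, aut_spec sigma A E /\ (forall x, x ∈ e -> pair x x ∈ sigma) /\
    ~ pair a a ∈ sigma.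
Proof.
  move=> Hes Hef HeA Ha Hae.
  pose p := sep (prod e e) (fun z => exists x, z = pair x x).
  have DP : Dfn (fun e => exists x, e 0 = pair x x) by dfn.
  have Hp z : z ∈ p <-> exists x, x ∈ e /\ z = pair x x.
    rewrite sepP //; split=> [[/(prodP HZ) [x [y [Hx [Hy ->]]]] [x' /(pair_inj HZ) [E1 E2]]]|].
      by subst; exists x'.
    by move=> [x [Hx ->]]; rewrite pair_prod //; split=> //; exists x.
  have Hpp x y : pair x y ∈ p <-> x ∈ e /\ x = y.
    rewrite Hp; split=> [[x' [Hx /(pair_inj HZ) [-> ->]]]|[Hx <-]] //.
    by exists x.
  have Hpart : partial p.
  { split; first exact: sep_set.
    split.
    { apply: (fin_image HM (R := fun x z => z = pair x x) _ _ Hes) => //.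
      - by dfn.
      - by move=> x y y' -> ->.
      - exact: sep_set.
      - by move=> z /Hp [x [Hx ->]]; exists x. }
    split=> [z /Hp [x [/HeA Hx ->]]|x y x' y']; first by exists x, x.
    by rewrite !Hpp => -[_ <-] [_ <-]. }
  have [||||b [Hb [Hba Hg]]] := good_new (Z := upair a a) Hpart Ha.
  - by move=> y; rewrite Hpp => -[].
  - exact: upair_set.
  - have -> : upair a a = adjoin (zero HM) a; last by apply: (fin_adjoin HM); exact: (fin_empty HM).
    apply: (set_ext HZ); [exact: upair_set | exact: adjoin_set | move=> z].
    by rewrite upairP // adjoinP //; have := @zeroP _ HM z; tauto.
  - by move=> z; rewrite upairP // => -[] ->.
  - have [sigma [Hs Hsub]] := partial_extends (partial_adjoin Hpart Ha Hb Hg).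
    exists sigma; split=> //; split.
    + by move=> x Hx; apply: Hsub; rewrite adjoinP // Hpp; auto.
    + move=> Haa; apply: Hba; rewrite upairP //; left.
      apply: (bs_fun (as_bij Hs) _ Haa); apply: Hsub; rewrite adjoinP //; auto.
Qed.

End BackForth.

(** * The action of permutations of the atoms *)

Section Action.
Variable M : structure.
Hypothesis HM : ZFA M.
Let HZ := ZFA_Zer HM.
Let Htc := ZFA_closures HM.
Variable A : M.
Hypothesis AP : forall x, x ∈ A <-> atom x.
Implicit Types x y z u v r s t h pi g : M.

Definition act pi x : M := the x (acts pi x).

Section OnePermutation.
Variable pi : M.
Hypothesis Hpi : bij_spec pi A A.

(** [h] carries out the recursion on the transitive set [t]. *)
Definition attempt t h : Prop :=
  is_transitive t /\
  (forall s, s ∈ t -> exists! r : M, inrel h s r) /\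
  (forall s r : M, s ∈ t -> inrel h s r ->
     (atom s -> inrel pi s r) /\
     (is_set s ->
        is_set r /\ forall z, z ∈ r <-> exists v, v ∈ s /\ inrel h v z)).

Lemma attempt_acts t h x y : attempt t h -> x ∈ t -> inrel h x y -> acts pi x y.
Proof. by move=> [H1 [H2 H3]] Hx Hxy; exists t, h. Qed.

Lemma acts_attempt x y : acts pi x y -> exists t h, attempt t h /\ x ∈ t /\ inrel h x y.
Proof. by move=> [t [h [H1 [H2 [H3 [H4 H5]]]]]]; exists t, h. Qed.

Lemma attempt_ex t h x : attempt t h -> x ∈ t -> exists y, inrel h x y.
Proof. by move=> [_ [H _]] /H [y [Hy _]]; exists y. Qed.

(** Two attempts agree at [x] if they do at the elements of [x]. *)
Lemma acts_fun x y y' : acts pi x y -> acts pi x y' -> y = y'.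
Proof.
  move: x y y'; apply: (eps_induction HZ Htc); first by dfn.
  move=> x IH y y' /acts_attempt [t [h [Ht [Hxt Hxy]]]] /acts_attempt [t' [h' [Ht' [Hxt' Hxy']]]].
  have [Htr [_ Hval]] := Ht; have [Htr' [_ Hval']] := Ht'.
  have [Ha Hs] := Hval _ _ Hxt Hxy; have [Ha' Hs'] := Hval' _ _ Hxt' Hxy'.
  have [Hx|Hx] := classic (atom x).
  - by move: (Ha Hx) (Ha' Hx); rewrite !inrelE // => H H'; exact: (bs_fun Hpi H H').
  - have [Hy HyP] := Hs Hx; have [Hy' HyP'] := Hs' Hx.
    apply: (set_ext HZ) => // z; rewrite HyP HyP'; split=> -[v [Hv Hvz]]; exists v; split=> //.
    + have [r Hr] := attempt_ex Ht' (Htr' _ Hxt' _ Hv).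
      rewrite (IH _ Hv z r) //; first exact: (attempt_acts Ht (Htr _ Hxt _ Hv) Hvz).
      exact: (attempt_acts Ht' (Htr' _ Hxt' _ Hv) Hr).
    + have [r Hr] := attempt_ex Ht (Htr _ Hxt _ Hv).
      rewrite (IH _ Hv z r) //; first exact: (attempt_acts Ht' (Htr' _ Hxt' _ Hv) Hvz).
      exact: (attempt_acts Ht (Htr _ Hxt _ Hv) Hr).
Qed.

Lemma acts_sub x y v : acts pi x y -> v ∈ x -> exists r, acts pi v r.
Proof.
  move=> /acts_attempt [t [h [Ht [Hxt _]]]] Hv.
  have Hvt : v ∈ t by case: Ht => Htr _; exact: (Htr _ Hxt _ Hv).
  by have [r Hr] := attempt_ex Ht Hvt; exists r; exact: (attempt_acts Ht Hvt Hr).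
Qed.

Lemma acts_inv x y : acts pi x y -> (atom x -> pair x y ∈ pi) /\
  (is_set x -> is_set y /\ forall z, z ∈ y <-> exists v, v ∈ x /\ acts pi v z).
Proof.
  move=> /acts_attempt [t [h [Ht [Hxt Hxy]]]]; have [Htr [_ Hval]] := Ht.
  have [Ha Hs] := Hval _ _ Hxt Hxy; split=> [/Ha|/Hs [Hy HyP]]; first by rewrite inrelE.
  split=> // z; rewrite HyP; split=> -[v [Hv Hvz]]; exists v; split=> //.
  - exact: (attempt_acts Ht (Htr _ Hxt _ Hv) Hvz).
  - have [r Hr] := attempt_ex Ht (Htr _ Hxt _ Hv).
    by rewrite (acts_fun Hvz (attempt_acts Ht (Htr _ Hxt _ Hv) Hr)).
Qed.

(** If [pi] acts on the elements of [x], it acts on all elements of a transitive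
    set [T] including [x]; the values on [T] together with the value at [x] form
    an attempt. *)
Lemma acts_ex x : exists y, acts pi x y.
Proof.
  move: x; apply: (eps_induction HZ Htc); first by dfn.
  move=> x IH.
  have [Hx|Hx] := classic (atom x).
  - have /(bs_ex Hpi) [y Hy] : x ∈ A by rewrite AP.
    exists y; apply: (@attempt_acts (upair x x) (upair (pair x y) (pair x y))).
    + have Hin s r : inrel (upair (pair x y) (pair x y)) s r <-> s = x /\ r = y.
        rewrite inrelE // upairP //; split=> [[]/(pair_inj HZ)|[-> ->]]; auto.
      split; [|split].
      * by move=> z; rewrite upairP // => -[] -> u /(z_atoms_empty HZ Hx).
      * move=> s; rewrite upairP // => Hs; exists y; split; first by rewrite Hin; case: Hs.
        by move=> r; rewrite Hin => -[_ ->].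
      * move=> s r _; rewrite Hin => -[-> ->]; split=> [_|/(_ Hx) //].
        by rewrite inrelE.
    + by rewrite upairP; auto.
    + by rewrite inrelE // upairP; auto.
  - have [|Hno] := classic (exists y, acts pi x y); first by [].
    have [T0 [_ [HT0 HxT0]]] := Htc x.
    have DT0 : Dfn (fun e => exists r, acts pi (e 0) r) by dfn.
    pose T := sep T0 (fun u => exists r, acts pi u r).
    have HT u : u ∈ T <-> u ∈ T0 /\ exists r, acts pi u r by rewrite sepP.
    have HTr : is_transitive T.
      move=> u; rewrite HT => -[Hu [r Hr]] z Hz; rewrite HT.
      by split; [exact: (HT0 _ Hu _ Hz)| exact: (acts_sub Hr Hz)].
    have HxT : subset x T by move=> z Hz; rewrite HT; split; [exact: HxT0 | exact: IH].
    have Hxn : ~ x ∈ T by rewrite HT => -[].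
    have [||h0 [_ Hh0]] := replacement HM (x := T)
      (R := fun u p => exists r, acts pi u r /\ p = pair u r).
    { by dfn. }
    { by move=> u p p' _ [r [H ->]] [r' [H' ->]]; rewrite (acts_fun H H'). }
    have [||y [Hy HyP]] := replacement HM (x := x) (R := acts pi).
    { by dfn. }
    { by move=> u v v' _; exact: acts_fun. }
    exists y; apply: (@attempt_acts (adjoin T x) (adjoin h0 (pair x y))); last first.
    + by rewrite inrelE // adjoinP; auto.
    + by rewrite adjoinP; auto.
    + have Hin s r : inrel (adjoin h0 (pair x y)) s r <->
          (s ∈ T /\ acts pi s r) \/ (s = x /\ r = y).
      { rewrite inrelE // adjoinP // Hh0; split=> [[[u [Hu [r' [Hr /(pair_inj HZ) [-> ->]]]]]|/(pair_inj HZ)]|[[Hs H]|[-> ->]]]; auto.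
        by left; exists s; split=> //; exists r. }
      have HinT s r : s ∈ T -> (inrel (adjoin h0 (pair x y)) s r <-> acts pi s r).
        by move=> Hs; rewrite Hin; split=> [[[]|[E _]]|] //; [subst s; case: Hxn | auto].
      split; [|split].
      * move=> s; rewrite adjoinP // => Hs z Hz; rewrite adjoinP //; left.
        by case: Hs => [Hs|Es]; [exact: (HTr _ Hs _ Hz)| subst s; exact: HxT].
      * move=> s; rewrite adjoinP // => -[Hs|->].
        -- have [_ [r Hr]] := proj1 (HT s) Hs; exists r; split; first by rewrite HinT.
           by move=> r'; rewrite HinT //; exact: (acts_fun Hr).
        -- exists y; split; first by rewrite Hin; auto.
           by move=> r; rewrite Hin => -[[/Hxn]|[_ ->]].
      * move=> s r _; rewrite Hin => -[[Hs Hr]|[-> ->]].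
        -- have [Ha Hset] := acts_inv Hr; split=> [/Ha|/Hset [H1 H2]]; first by rewrite inrelE.
           split=> // z; rewrite H2; split=> -[v [Hv Hvz]]; exists v; split=> //;
             move: Hvz; rewrite HinT //; exact: (HTr _ Hs _ Hv).
        -- split=> // _; split=> // z; rewrite HyP.
           split=> -[v [Hv Hvz]]; exists v; split=> //;
             move: Hvz; rewrite HinT //; exact: HxT.
Qed.

Lemma act_acts x : acts pi x (act pi x).
Proof. exact: (epsilon_spec (inhabits x) _ (acts_ex x)). Qed.

Lemma actsE x y : acts pi x y <-> y = act pi x.
Proof. by split=> [H|->]; [exact: acts_fun H (act_acts x) | exact: act_acts]. Qed.

Lemma DT_act (t : (nat -> M) -> M) : DT t -> DT (fun e => act pi (t e)).
Proof.
  apply: (DT_fun1 (S := fun y x => acts pi x y)) => [y x|]; first by rewrite actsE.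
  by dfn.
Qed.

Lemma act_atom x : atom x -> pair x (act pi x) ∈ pi.
Proof. by have [H _] := acts_inv (act_acts x). Qed.

Lemma act_atomE x y : pair x y ∈ pi -> act pi x = y.
Proof.
  move=> H; have [/AP Hx _] := bs_dom HZ Hpi H.
  exact: (bs_fun Hpi (act_atom Hx) H).
Qed.

Lemma act_is_set x : is_set x -> is_set (act pi x).
Proof. by have [_ H] := acts_inv (act_acts x) => /H []. Qed.

Lemma act_is_atom x : atom x -> atom (act pi x).
Proof. by move=> /act_atom /(bs_dom HZ Hpi) []; rewrite -!AP. Qed.

Lemma act_elements x z : is_set x -> (z ∈ act pi x <-> exists v, v ∈ x /\ z = act pi v).
Proof.
  have [_ H] := acts_inv (act_acts x) => /H [_ ->].
  by split=> -[v [Hv Hz]]; exists v; split=> //; apply/actsE.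
Qed.

Lemma act_mem x y : x ∈ y -> act pi x ∈ act pi y.
Proof. by move=> H; rewrite act_elements; [exact: (mem_set HZ H)| exists x]. Qed.

Lemma act_upair x y : act pi (upair x y) = upair (act pi x) (act pi y).
Proof.
  apply: (set_ext HZ); [apply: act_is_set; exact: upair_set | exact: upair_set | move=> z].
  rewrite act_elements ?upairP //; first exact: upair_set.
  split=> [[v []]|[->|->]].
  - by rewrite upairP // => -[->|->]; auto.
  - by exists x; rewrite upairP; auto.
  - by exists y; rewrite upairP; auto.
Qed.

Lemma act_pair x y : act pi (pair x y) = pair (act pi x) (act pi y).
Proof. by rewrite /pair !act_upair. Qed.

End OnePermutation.

Lemma act_comp g h k : bij_spec g A A -> bij_spec h A A -> bij_spec k A A ->
  (forall a b c, pair a b ∈ h -> pair b c ∈ g -> pair a c ∈ k) ->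
  forall x, act g (act h x) = act k x.
Proof.
  move=> Hg Hh Hk H; apply: (eps_induction HZ Htc).
    dfn; [do 2!apply: DT_act => // | apply: DT_act => //]; dfn.
  move=> x IH; have [Hx|Hx] := classic (atom x).
  - apply: eq_sym; apply: act_atomE => //; apply: H (act_atom Hh Hx) (act_atom Hg _).
    exact: act_is_atom.
  - have Hhx := act_is_set Hh Hx.
    apply: (set_ext HZ); [exact: act_is_set | exact: act_is_set | move=> z].
    rewrite !act_elements //; split=> [[v []]|[v [Hv ->]]].
    + by rewrite act_elements // => -[u [Hu ->]] ->; exists u; rewrite IH.
    + by exists (act h v); rewrite IH //; split=> //; exact: act_mem.
Qed.

Lemma act_id i : bij_spec i A A -> (forall a b, pair a b ∈ i -> a = b) ->
  forall x, act i x = x.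
Proof.
  move=> Hi H; apply: (eps_induction HZ Htc).
    by dfn; apply: DT_act => //; dfn.
  move=> x IH; have [Hx|Hx] := classic (atom x).
  - by apply: eq_sym; exact: (H _ _ (act_atom Hi Hx)).
  - apply: (set_ext HZ) => // [|z]; first exact: act_is_set.
    rewrite act_elements //; split=> [[v [Hv ->]]|Hz]; first by rewrite IH.
    by exists z; rewrite IH.
Qed.

Definition idA := graph A A (fun x y => x = y).
Lemma idA_bij : bij_spec idA A A.
Proof.
  apply: graph_bij => //; first by dfn.
  - by move=> x Hx; exists x.
  - by move=> x y y' _ _ _ <-.
  - by move=> x y y' _ _ _ ->.
  - by move=> x Hx; exists x.
Qed.
Lemma idAP x y : pair x y ∈ idA <-> x ∈ A /\ x = y.
Proof.
  rewrite graphP //; first by dfn.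
  by split=> [[? [? ?]]|[? <-]].
Qed.
Lemma act_idA x : act idA x = x.
Proof. by apply: act_id; [exact: idA_bij | move=> a b /idAP []]. Qed.

Definition invA pi := inverse pi A A.

Section Inverse.
Variable pi : M.
Hypothesis Hpi : bij_spec pi A A.
Lemma invA_bij : bij_spec (invA pi) A A. Proof. exact: inverse_bij. Qed.
Lemma act_invA x : act (invA pi) (act pi x) = x.
Proof.
  rewrite -[RHS]act_idA; apply: act_comp => //; [exact: invA_bij | exact: idA_bij |].
  move=> a b c H; rewrite (inverseP HZ) // idAP => H'.
  by have [? _] := bs_dom HZ Hpi H; split=> //; exact: (bs_inj Hpi H H').
Qed.
Lemma act_invA' x : act pi (act (invA pi) x) = x.
Proof.
  rewrite -[RHS]act_idA; apply: act_comp => //; [exact: invA_bij | exact: idA_bij |].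
  move=> a b c; rewrite (inverseP HZ) // idAP => H H'.
  by have [_ ?] := bs_dom HZ Hpi H; split=> //; exact: (bs_fun Hpi H H').
Qed.
Lemma act_memE x y : act pi x ∈ act pi y <-> x ∈ y.
Proof.
  split=> [H|]; last exact: act_mem.
  by rewrite -(act_invA x) -(act_invA y); apply: act_mem => //; exact: invA_bij.
Qed.
Lemma act_atomP x : atom (act pi x) <-> atom x.
Proof.
  split=> [H|]; last exact: act_is_atom.
  by rewrite -(act_invA x); apply: act_is_atom => //; exact: invA_bij.
Qed.
End Inverse.

End Action.

(** * The permutation model *)

Lemma sat_agree (N : structure) phi : exists n, forall e e' : nat -> N,
  (forall k, k < n -> e k = e' k) -> (sat e phi <-> sat e' phi).
Proof.
  elim: phi => [i j|i j|i||p [n Hn] q [k Hk]|p [n Hn] q [k Hk]|p [n Hn] q [k Hk]|p [n Hn]|p [n Hn]].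
  - by exists (S (i + j)) => e e' H /=; rewrite !H //; lia.
  - by exists (S (i + j)) => e e' H /=; rewrite !H //; lia.
  - by exists (S i) => e e' H /=; rewrite !H //; lia.
  - by exists 0.
  - by exists (n + k) => e e' H /=; rewrite (Hn e e') ?(Hk e e') // => l Hl; apply: H; lia.
  - by exists (n + k) => e e' H /=; rewrite (Hn e e') ?(Hk e e') // => l Hl; apply: H; lia.
  - by exists (n + k) => e e' H /=; rewrite (Hn e e') ?(Hk e e') // => l Hl; apply: H; lia.
  - exists n => e e' H /=; have Hx x : sat (scons x e) p <-> sat (scons x e') p.
      by apply: Hn => -[|l] Hl //=; apply: H; lia.
    by split=> Hp x; apply/Hx.
  - exists n => e e' H /=; have Hx x : sat (scons x e) p <-> sat (scons x e') p.
      by apply: Hn => -[|l] Hl //=; apply: H; lia.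
    by split=> -[x Hp]; exists x; apply/Hx.
Qed.

Lemma sat_automorphism (N : structure) (j j' : N -> N) :
  (forall x, j (j' x) = x) -> (forall x, j' (j x) = x) ->
  (forall x y, j x ∈ j y <-> x ∈ y) -> (forall x, atom (j x) <-> atom x) ->
  forall phi e, sat (fun n => j (e n)) phi <-> sat e phi.
Proof.
  move=> jj' j'j jmem jatom.
  have jscons x e : scons (j x) (fun n => j (e n)) = fun n => j (scons x e n).
    by apply: functional_extensionality => -[].
  elim=> //= [i k e|p IHp q IHq e|p IHp q IHq e|p IHp q IHq e|p IHp e|p IHp e].
  - by split=> [E|-> //]; rewrite -(j'j (e i)) E j'j.
  - by rewrite IHp IHq.
  - by rewrite IHp IHq.
  - by rewrite IHp IHq.
  - split=> H x; first by have := H (j x); rewrite jscons IHp.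
    by rewrite -(jj' x) jscons IHp.
  - split=> -[x H]; last by exists (j x); rewrite jscons IHp.
    by exists (j' x); move: H; rewrite -{1}(jj' x) jscons IHp.
Qed.

Section PermutationModel.
Variable M : structure.
Hypothesis HM : ZFA M.
Let HZ := ZFA_Zer HM.
Let Htc := ZFA_closures HM.
Variables A E Sigma c F : M.
Hypothesis AP : forall x, x ∈ A <-> atom x.
Hypothesis HSigma : is_aut_group A E Sigma c.
Hypothesis HF : is_atom_stab_filter F A Sigma c.
Implicit Types x y z u v s t K : M.

Lemma SigmaP s : s ∈ Sigma <-> aut_spec s A E.
Proof. by have [_ [-> _]] := HSigma; rewrite is_automorphismE. Qed.

Lemma Sigma_bij s : s ∈ Sigma -> bij_spec s A A.
Proof. by move=> /SigmaP []. Qed.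

Lemma Sigma_inv s : s ∈ Sigma -> invA A s ∈ Sigma.
Proof.
  move=> Hs; have Hb := Sigma_bij Hs; move/SigmaP: Hs => [_ He]; apply/SigmaP; split.
    exact: invA_bij.
  by move=> u v u' v'; rewrite !(inverseP HZ) // => H1 H2; rewrite (He _ _ _ _ H1 H2).
Qed.

Lemma Sigma_comp s t : s ∈ Sigma -> t ∈ Sigma -> comp t s A A ∈ Sigma.
Proof. by rewrite !SigmaP; exact: comp_aut. Qed.

Lemma Sigma_id : idA A ∈ Sigma.
Proof.
  apply/SigmaP; split; first exact: idA_bij.
  by move=> u v u' v'; rewrite !(idAP HM) => -[_ ->] [_ ->].
Qed.

Lemma opapp_c s t k : opapp c s t k <->
  s ∈ Sigma /\ t ∈ Sigma /\ k ∈ Sigma /\ is_composite k s t.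
Proof.
  have [_ [_ [[P [/(is_productE HZ) -> /(is_functionE HZ) [Hrel Hex Hfun]]] Hcomp]]] := HSigma.
  split=> [H|[Hs [Ht [Hk Hc]]]].
  - have Hc := Hcomp _ _ _ H; move: H; rewrite opappE // => /(rel_dom HZ Hrel) [].
    by rewrite pair_prod // => -[].
  - have [|k' Hk'] := Hex (pair s t); first by rewrite pair_prod.
    have -> : k = k'; last by rewrite opappE.
    have [_ Hk'S] := rel_dom HZ Hrel Hk'.
    have Hc' : is_composite k' s t by apply: Hcomp; rewrite opappE.
    apply: (rel_ext HZ (bs_rel (Sigma_bij Hk)) (bs_rel (Sigma_bij Hk'S))) => x y.
    by move/(is_compositeE HZ): Hc => ->; move/(is_compositeE HZ): Hc' => ->.
Qed.

Lemma opapp_c_intro s t k : s ∈ Sigma -> t ∈ Sigma -> k ∈ Sigma ->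
  (forall a b, pair a b ∈ k <-> exists d, pair a d ∈ t /\ pair d b ∈ s) -> opapp c s t k.
Proof. by move=> Hs Ht Hk H; apply/opapp_c; rewrite is_compositeE. Qed.

Definition fixes s e : Prop := forall a, a ∈ e -> act s a = a.

Definition support x e : Prop :=
  is_set e /\ subset e A /\ is_finite e /\
  forall s, s ∈ Sigma -> fixes s e -> act s x = x.

Lemma stab_exists x : exists K, is_stab K Sigma x.
Proof.
  have D : Dfn (fun e => acts (e 0) x x) by dfn.
  exists (sep Sigma (fun s => acts s x x)); split; first exact: sep_set.
  by move=> s; rewrite sepP.
Qed.

(** Membership of the stabilizer in the filter amounts to a finite support; the
    stabilizer is a subgroup since the action is compatible with composition. *)
Lemma symmetricE x : symmetric Sigma F x <-> exists e, support x e.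
Proof.
  split=> [[K [[HK HKx] HKF]]|[e [He1 [He2 [He3 He4]]]]].
  - have [_ /(_ K) [/(_ HKF) [_ [e [He1 [He2 [He3 He4]]]]] _]] := HF.
    exists e; split=> //; split=> //; split=> // s Hs Hfix.
    have /HKx [_] : s ∈ K; last by rewrite (actsE HM AP (Sigma_bij Hs)) => <-.
    apply: He4 => // a K' Ha [_ ->]; split=> //.
    by rewrite (actsE HM AP (Sigma_bij Hs)) Hfix.
  - have [K HK] := stab_exists x; exists K; split=> //.
    have [HKs HKP] := HK.
    have HKP' s : s ∈ K <-> s ∈ Sigma /\ act s x = x.
      rewrite HKP; split=> -[Hs H]; split=> //; move: H;
        by rewrite (actsE HM AP (Sigma_bij Hs)).
    have [_ ->] := HF; split; last first.
    { exists e; split=> //; split=> //; split=> // s Hs Hfix; apply/HKP'; split=> //; apply: He4 => // a Ha.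
      have [Ka [HKa1 HKa]] := stab_exists a.
      have := Hfix a Ka Ha (conj HKa1 HKa); rewrite HKa => -[_].
      by rewrite (actsE HM AP (Sigma_bij Hs)). }
    split=> //; split; first by move=> s /HKP' [].
    split; last first.
    { move=> s t k /HKP' [Hs Hsx] /HKP' [Ht Htx] /opapp_c [_ [_ [Hk Hc]]]; apply/HKP'; split=> //.
      rewrite -(@act_comp _ HM A AP s t k) ?Htx //; try exact: Sigma_bij.
      move=> a b d Hab Hbd; move/(is_compositeE HZ): Hc => ->; by exists b. }
    exists (idA A); split.
      by apply/HKP'; split; [exact: Sigma_id | exact: act_idA].
    split=> [s Hs|s /HKP' [Hs Hsx]].
    + have Hb := Sigma_bij Hs; split; apply: opapp_c_intro => //; try exact: Sigma_id; move=> a b.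
      * split=> [H|[d [H]]]; last by rewrite (idAP HM) => -[_ <-].
        exists b; split=> //; apply/(idAP HM); split=> //.
        by have [] := bs_dom HZ Hb H.
      * split=> [H|[d []]]; last by rewrite (idAP HM) => -[_ ->].
        exists a; split=> //; apply/(idAP HM); split=> //.
        by have [] := bs_dom HZ Hb H.
    + have Hb := Sigma_bij Hs; have Hi := Sigma_inv Hs.
      exists (invA A s); split.
        by apply/HKP'; split=> //; rewrite -{1}Hsx (act_invA HM AP).
      split; apply: opapp_c_intro => //; try exact: Sigma_id;
        move=> a b; rewrite (idAP HM).
      * split=> [[Ha <-]|[d []]].
          have [d Hd] := bs_onto Hb Ha; exists d; by rewrite (inverseP HZ).
        rewrite (inverseP HZ) // => H H'; have [_ Ha] := bs_dom HZ Hb H.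
        by split=> //; exact: (bs_fun Hb H H').
      * split=> [[Ha <-]|[d []]].
          have [d Hd] := bs_ex Hb Ha; exists d; by rewrite (inverseP HZ).
        rewrite (inverseP HZ) // => H H'; have [Ha _] := bs_dom HZ Hb H.
        by split=> //; exact: (bs_inj Hb H H').
Qed.

Let HS x := hereditarily_symmetric Sigma F x.

Lemma Dfn_HS : Dfn (fun e => HS (e 0)).
Proof. by rewrite /HS; dfn. Qed.

Lemma HS_support x : HS x -> exists e, support x e.
Proof. by move=> [/symmetricE]. Qed.

Lemma HS_mem x y : HS y -> x ∈ y -> HS x.
Proof.
  move=> [_ Hy] Hx; split; first by apply: Hy => t _; exact.
  by move=> z Hz; apply: Hy => t Ht Hyt; apply: Hz => //; exact: (Ht _ (Hyt _ Hx)).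
Qed.

(** The hereditarily symmetric elements of a transitive set including [y] form a
    transitive set. *)
Lemma HS_build y : symmetric Sigma F y -> (forall z, z ∈ y -> HS z) -> HS y.
Proof.
  move=> Hy Hel; split=> // z Hz; have [t [_ [Ht Hyt]]] := Htc y.
  have DHS := Dfn_HS.
  suff : z ∈ sep t HS by rewrite sepP // => -[_ []].
  apply: Hz => [u|u Hu]; rewrite sepP //; last by split; [exact: Hyt | exact: Hel].
  move=> [Hu HSu] w Hw; rewrite sepP //; split; first exact: (Ht _ Hu).
  exact: (HS_mem HSu).
Qed.

Lemma fixes_inv s e : s ∈ Sigma -> fixes s e -> fixes (invA A s) e.
Proof. by move=> Hs Hfix a Ha; rewrite -{1}(Hfix a Ha) (act_invA HM AP) //; exact: Sigma_bij. Qed.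

(** Invariance under inclusion suffices, as the inverse of [s] fixes [e] too. *)
Lemma HS_intro y e : is_set y -> is_set e -> subset e A -> is_finite e ->
  (forall z, z ∈ y -> HS z) ->
  (forall s, s ∈ Sigma -> fixes s e -> forall z, z ∈ y -> act s z ∈ y) -> HS y.
Proof.
  move=> Hy He HeA Hef Hel Hinv; apply: HS_build => //; apply/symmetricE; exists e.
  split=> //; split=> //; split=> // s Hs Hfix; have Hb := Sigma_bij Hs.
  apply: (set_ext HZ) => // [|z]; first exact: (act_is_set HM AP).
  rewrite (act_elements HM AP) //; split=> [[v [Hv ->]]|Hz]; first exact: Hinv.
  exists (act (invA A s) z); rewrite (act_invA' HM AP) //; split=> //.
  by apply: Hinv => //; [exact: Sigma_inv | exact: fixes_inv].
Qed.

(** Normality of the filter: the image of a support of [x] supports [act s x]. *)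
Lemma symmetric_act s x : s ∈ Sigma -> symmetric Sigma F x -> symmetric Sigma F (act s x).
Proof.
  move=> Hs /symmetricE [e [He [HeA [Hef Hfix]]]]; apply/symmetricE.
  have Hb := Sigma_bij Hs; have Hib := Sigma_bij (Sigma_inv Hs).
  exists (act s e); split; first exact: (act_is_set HM AP).
  split.
    by move=> a; rewrite (act_elements HM AP) // => -[v [/HeA /AP Hv ->]]; apply/AP; exact: (act_is_atom HM AP).
  split.
  { apply: (fin_image HM (R := fun a b => b = act s a) _ _ He) => //.
    - by dfn; apply: (DT_act HM AP) => //; dfn.
    - by move=> a b b' -> ->.
    - exact: (act_is_set HM AP).
    - by move=> b; rewrite (act_elements HM AP). }
  move=> t Ht Htfix; have Htb := Sigma_bij Ht.
  have H1 : comp s t A A ∈ Sigma by exact: Sigma_comp.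
  have H2 : comp (comp s t A A) (invA A s) A A ∈ Sigma by apply: Sigma_comp => //; exact: Sigma_inv.
  have Eact z : act (comp (comp s t A A) (invA A s) A A) z = act (invA A s) (act t (act s z)).
    rewrite -(@act_comp _ HM A AP (invA A s) (comp s t A A) _) //; try exact: Sigma_bij.
      by move=> a b d Hab Hbd; rewrite (compP HZ _ _ (Sigma_bij H1) Hib); exists b.
    rewrite -(@act_comp _ HM A AP t s (comp s t A A)) //; first exact: Sigma_bij.
    by move=> a b d Hab Hbd; rewrite (compP HZ _ _ Hb Htb); exists b.
  have : act (comp (comp s t A A) (invA A s) A A) x = x.
    apply: Hfix => // a Ha; rewrite Eact Htfix ?(act_invA HM AP) //.
    exact: (act_mem HM AP).
  by rewrite Eact => {2}<-; rewrite (act_invA' HM AP).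
Qed.

Lemma HS_act s x : s ∈ Sigma -> HS x -> HS (act s x).
Proof.
  move=> Hs; have Hb := Sigma_bij Hs; move: x; apply: (eps_induction HZ Htc).
    apply: Dfn_imp; first exact: Dfn_HS.
    by apply: (Dfn1_app Dfn_HS); apply: (DT_act HM AP) => //; dfn.
  move=> x IH Hx; apply: HS_build; first by apply: symmetric_act => //; case: Hx.
  move=> z Hz; have Hxs : is_set x.
    by move=> Ha; apply: (mem_set HZ Hz); exact: (act_is_atom HM AP).
  by move: Hz; rewrite (act_elements HM AP) // => -[v [Hv ->]]; apply: IH => //; exact: (HS_mem Hx Hv).
Qed.

(** ** Axioms in the permutation model *)

Let M' := permutation_model Sigma F.
Implicit Types X Y Z : M'.
Let val : M' -> M := @proj1_sig _ _.

Lemma val_HS X : HS (val X). Proof. exact: (proj2_sig X). Qed.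

Lemma val_inj X Y : val X = val Y -> X = Y. Proof. exact: sig_eq. Qed.

Lemma val_mem X u : u ∈ val X -> exists U : M', val U = u /\ U ∈ X.
Proof. by move=> H; exists (exist _ u (HS_mem (val_HS X) H)). Qed.

Lemma val_ext X (y : M) : is_set X -> is_set y -> (forall z, z ∈ y -> HS z) ->
  (forall Z, Z ∈ X <-> val Z ∈ y) -> val X = y.
Proof.
  move=> HX Hy Hel H; apply: (set_ext HZ) => // z; split=> Hz.
  - by have [Z [<- HZ']] := val_mem Hz; apply/H.
  - by have := H (exist _ z (Hel _ Hz)) => -[_]; exact.
Qed.

(** The action on the permutation model. *)
Definition jmap s (Hs : s ∈ Sigma) X : M' := exist _ (act s (val X)) (HS_act Hs (val_HS X)).

Lemma sat_jmap s (Hs : s ∈ Sigma) phi (e : nat -> M') :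
  sat (fun n => jmap Hs (e n)) phi <-> sat e phi.
Proof.
  have Hb := Sigma_bij Hs.
  apply: (sat_automorphism (j := jmap Hs) (j' := jmap (Sigma_inv Hs))).
  - by move=> X; apply: val_inj; exact: (act_invA' HM AP).
  - by move=> X; apply: val_inj; exact: (act_invA HM AP).
  - by move=> X Y; exact: (act_memE HM AP).
  - by move=> X; exact: (act_atomP HM AP).
Qed.

(** Quantifiers are relativized to the hereditarily symmetric elements, a class
    that is definable in [M]. *)
Lemma relativize phi : exists Q : (nat -> M) -> Prop, Dfn Q /\
  forall e : nat -> M', Q (fun n => val (e n)) <-> sat e phi.
Proof.
  have Hsc (e : nat -> M) : scons (e 0) (fun n => e (S n)) = e.
    by apply: functional_extensionality => -[].
  have Hval X (e : nat -> M') : scons (val X) (fun n => val (e n)) = fun n => val (scons X e n).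
    by apply: functional_extensionality => -[].
  have DHS := Dfn_HS.
  elim: phi => [i j|i j|i||p [P [DP HP]] q [Q [DQ HQ]]|p [P [DP HP]] q [Q [DQ HQ]]|
    p [P [DP HP]] q [Q [DQ HQ]]|p [P [DP HP]]|p [P [DP HP]]].
  - by exists (fun e => e i ∈ e j); split=> //; dfn.
  - exists (fun e => e i = e j); split=> [|e]; first by dfn.
    by split=> [/val_inj|/= ->].
  - by exists (fun e => atom (e i)); split=> //; dfn.
  - by exists (fun _ => False); split=> //; dfn.
  - by exists (fun e => P e -> Q e); split=> [|e]; [dfn | rewrite HP HQ].
  - by exists (fun e => P e /\ Q e); split=> [|e]; [dfn | rewrite HP HQ].
  - by exists (fun e => P e \/ Q e); split=> [|e]; [dfn | rewrite HP HQ].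
  - exists (fun e => forall x, HS x -> P (scons x e)); split=> [|e].
      apply: Dfn_all; apply: Dfn_imp => //.
      by apply: (Dfn_ext _ DP) => e; rewrite Hsc.
    split=> [H X|H x Hx].
      by have := H _ (val_HS X); rewrite Hval HP.
    by have /HP := H (exist _ x Hx); rewrite -Hval.
  - exists (fun e => exists x, HS x /\ P (scons x e)); split=> [|e].
      apply: Dfn_ex; apply: Dfn_and => //.
      by apply: (Dfn_ext _ DP) => e; rewrite Hsc.
    split=> [[x [Hx H]]|[X H]].
      by exists (exist _ x Hx); apply/HP; rewrite -Hval.
    by exists (val X); split; [exact: val_HS | rewrite Hval HP].
Qed.

Lemma support_cup x y e e' : support x e -> support y e' ->
  support x (cup e e') /\ support y (cup e e').
Proof.
  move=> [H1 [H2 [H3 H4]]] [H1' [H2' [H3' H4']]].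
  have Hs : is_set (cup e e') by exact: cup_set.
  have HA : subset (cup e e') A by move=> z; rewrite cupP // => -[/H2|/H2'].
  have Hf : is_finite (cup e e') by exact: fin_cup.
  split; (split; [done | split; [done | split; [done | move=> s Hs' Hfix]]]);
    [apply: H4 => // a Ha | apply: H4' => // a Ha];
    by apply: Hfix; rewrite cupP //; auto.
Qed.

Lemma common_support n (e : nat -> M') : exists w, is_set w /\ subset w A /\ is_finite w /\
  forall s k, k < n -> s ∈ Sigma -> fixes s w -> act s (val (e k)) = val (e k).
Proof.
  elim: n => [|n [w [H1 [H2 [H3 H4]]]]].
  - exists (zero HM); split; first exact: emp_set.
    split; first by move=> z /(zeroP (HM := HM)).
    by split; [exact: fin_empty | move=> s k; lia].
  - have [w' [H1' [H2' [H3' H4']]]] := HS_support (val_HS (e n)).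
    exists (cup w w'); split; first exact: cup_set.
    split; first by move=> z; rewrite cupP // => -[/H2|/H2'].
    split; first exact: fin_cup.
    move=> s k Hk Hs Hfix.
    have [->|Hkn] : k = n \/ k < n by lia.
    + by apply: H4' => // a Ha; apply: Hfix; rewrite cupP //; auto.
    + by apply: H4 => // a Ha; apply: Hfix; rewrite cupP //; auto.
Qed.

Lemma atom_HS a : atom a -> HS a.
Proof.
  move=> Ha; apply: HS_build; last by move=> z /(z_atoms_empty HZ Ha).
  apply/symmetricE; exists (upair a a); split; first exact: upair_set.
  split; first by move=> z; rewrite upairP // => -[] ->; apply/AP.
  split; last by move=> s Hs; apply; rewrite upairP //; auto.
  have -> : upair a a = adjoin (zero HM) a; last by apply: (fin_adjoin HM); exact: (fin_empty HM).
  apply: (set_ext HZ); [exact: upair_set | exact: adjoin_set | move=> z].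
  by rewrite upairP // adjoinP //; have := @zeroP _ HM z; tauto.
Qed.

(** The subset of [X] is separated in [M] by the relativized formula. A common
    support of [X] and of the finitely many parameters of the formula supports it,
    because the automorphisms fixing this support preserve satisfaction. *)
Lemma model_separation (P : M' -> Prop) : Dfn (fun e => P (e 0)) -> forall X, exists Y,
  is_set Y /\ forall Z, Z ∈ Y <-> Z ∈ X /\ P Z.
Proof.
  move=> DP X; have [phi [env HP]] := Dfn_formula1 DP X.
  have [Q [DQ HQ]] := relativize phi.
  pose e0 n := val (env n).
  have DQ' := Dfn_freeze e0 DQ.
  have HQP Z : Q (scons (val Z) e0) <-> P Z.
    rewrite HP -HQ.
    by have -> : scons (val Z) e0 = fun n => val (scons Z env n)
      by apply: functional_extensionality => -[].
  pose y := sep (val X) (fun z => Q (scons z e0)).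
  have Hy z : z ∈ y <-> z ∈ val X /\ Q (scons z e0) by rewrite sepP.
  have Hys : is_set y by exact: sep_set.
  have [n Hn] := sat_agree M' phi.
  have [w [Hw1 [Hw2 [Hw3 Hw4]]]] := common_support (S n) (scons X env).
  have HSy : HS y.
  { apply: (HS_intro Hys Hw1 Hw2 Hw3) => [z|s Hs Hfix z].
      by rewrite Hy => -[Hz _]; exact: (HS_mem (val_HS X)).
    rewrite !Hy => -[Hz HQz]; have [Z [EZ HZX]] := val_mem Hz; subst z.
    have Hb := Sigma_bij Hs.
    split.
      have EX : act s (val X) = val X by apply: (Hw4 s 0) => //; lia.
      by rewrite -EX; exact: (act_mem HM AP).
    apply/(HQP (jmap Hs Z)); move/HQP: HQz; rewrite !HP -(sat_jmap Hs).
    apply: (proj1 (Hn _ _ _)) => -[|k] Hk //=; apply: val_inj => /=.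
    by apply: (Hw4 s (S k)) => //; lia. }
  exists (exist _ y HSy); split=> // Z; rewrite -HQP; exact: Hy.
Qed.

Lemma model_Zer : Zer M'.
Proof.
  split.
  - by move=> a X Ha; exact: (z_atoms_empty HZ).
  - move=> X Y HX HY H; apply: val_inj; apply: val_ext => //.
    by move=> z; exact: (HS_mem (val_HS Y)).
  - have H : HS (emp HZ).
    { apply: (HS_intro (e := zero HM)); try exact: emp_set.
      + by move=> z /(zeroP (HM := HM)).
      + exact: fin_empty.
      + by move=> z /(empP (HN := HZ)).
      + by move=> s _ _ z /(empP (HN := HZ)). }
    exists (exist _ (emp HZ) H); split; first exact: emp_set.
    by move=> Z; exact: empP.
  - move=> X Y; have [e He] := HS_support (val_HS X); have [e' He'] := HS_support (val_HS Y).
    have [[H1 [H2 [H3 HX]]] [_ [_ [_ HY]]]] := support_cup He He'.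
    have H : HS (upair (val X) (val Y)).
    { apply: (HS_intro _ H1 H2 H3); first exact: upair_set.
      + by move=> z; rewrite upairP // => -[] ->; exact: val_HS.
      + move=> s Hs Hfix z; rewrite !upairP // => -[] ->; [left; exact: HX | right; exact: HY]. }
    exists (exist _ _ H); split; first exact: upair_set.
    move=> Z; rewrite /= upairP //; split=> -[E1|E1]; [left|right|left|right];
      try exact: val_inj; by rewrite E1.
  - move=> X; have [e [H1 [H2 [H3 HX]]]] := HS_support (val_HS X).
    have H : HS (bigcup (val X)).
    { apply: (HS_intro _ H1 H2 H3); first exact: bigcup_set.
      + move=> z; rewrite bigcupP // => -[u [Hu Hz]].
        exact: (HS_mem (HS_mem (val_HS X) Hu) Hz).
      + move=> s Hs Hfix z; rewrite !bigcupP // => -[u [Hu Hz]]; have Hb := Sigma_bij Hs.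
        exists (act s u); split; last exact: (act_mem HM AP).
        by rewrite -(HX _ Hs Hfix); exact: (act_mem HM AP). }
    exists (exist _ _ H); split; first exact: bigcup_set.
    move=> Z; rewrite /= bigcupP //; split=> [[u [Hu Hz]]|[U [HU Hz]]].
      by have [U [EU HU]] := val_mem Hu; exists U; split=> //; move: Hz; rewrite -EU.
    by exists (val U).
  - move=> X; have [e [H1 [H2 [H3 HX]]]] := HS_support (val_HS X); have DHS := Dfn_HS.
    have H : HS (sep (pow (val X)) HS).
    { apply: (HS_intro _ H1 H2 H3); first exact: sep_set.
      + by move=> z; rewrite sepP // => -[].
      + move=> s Hs Hfix z; rewrite !sepP // !powP // => -[[Hz Hsub] HSz]; have Hb := Sigma_bij Hs.
        split; last exact: HS_act.
        split; first exact: (act_is_set HM AP).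
        move=> u; rewrite (act_elements HM AP) // => -[v [Hv ->]].
        by rewrite -(HX _ Hs Hfix); apply: (act_mem HM AP) => //; exact: Hsub. }
    exists (exist _ _ H); split; first exact: sep_set.
    move=> Z; rewrite /= sepP // powP //; split=> [[[HZs Hsub] _]|[HZs Hsub]].
      by split=> // U; exact: Hsub.
    split; last exact: val_HS.
    by split=> // u Hu; have [U [<- HU]] := val_mem Hu; exact: Hsub.
  - move=> X [Y HY]; have [|u [Hu Hmin]] := z_found HZ (x := val X); first by exists (val Y).
    have [U [EU HU]] := val_mem Hu; exists U; split=> // Z HZX HZU.
    by apply: (Hmin (val Z)) => //; rewrite -EU.
  - exact: model_separation.
Qed.

(** The transitive closure in [M] is fixed by whatever fixes the set, and its
    elements are hereditarily symmetric. *)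
Lemma model_closures : has_closures M'.
Proof.
  move=> X; have [e [H1 [H2 [H3 HX]]]] := HS_support (val_HS X).
  have [t0 [_ [Ht0 Hsub]]] := Htc (val X).
  have D : Dfn (fun e => in_trcl (e 0) (val X)) by dfn.
  pose t := sep t0 (fun y => in_trcl y (val X)).
  have Ht y : y ∈ t <-> in_trcl y (val X).
    by rewrite sepP //; split=> [[]//|H]; split=> //; exact: H.
  have H : HS t.
  { apply: (HS_intro _ H1 H2 H3); first exact: sep_set.
    - move=> z; rewrite Ht => Hz; have [_ Hsym] := val_HS X; split; first exact: Hsym.
      move=> w Hw; apply: Hsym => T HT HXT; apply: Hw => //; exact: (HT _ (Hz T HT HXT)).
    - move=> s Hs Hfix z; rewrite !Ht => Hz T HT HXT.
      have Hi := Sigma_inv Hs; have Hb := Sigma_bij Hs; have Hib := Sigma_bij Hi.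
      have HTs : is_set T by exact: (mem_set HZ (Hz T HT HXT)).
      have := Hz (act (invA A s) T); rewrite (act_elements HM AP) // => -[||v [Hv ->]].
      + move=> u; rewrite (act_elements HM AP) // => -[v [Hv ->]] w Hw.
        rewrite (act_elements HM AP) //; exists (act s w); rewrite (act_invA HM AP) //; split=> //.
        apply: (HT _ Hv); rewrite -[v](act_invA' HM AP Hb).
        exact: (act_mem HM AP).
      + move=> u Hu; rewrite -[val X](HX _ Hi (fixes_inv Hs Hfix)) in Hu.
        have HXs : is_set (val X).
          by move=> Hat; exact: (z_atoms_empty HZ (act_is_atom HM AP Hib Hat) Hu).
        move: Hu; rewrite (act_elements HM AP) //.
        move=> [v [Hv ->]]; rewrite (act_elements HM AP) //; exists v; split=> //; exact: HXT.
      + by rewrite (act_invA' HM AP). }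
  exists (exist _ t H); split; first exact: sep_set.
  split.
  - move=> Y /Ht HY Z HZY; apply/Ht => T HT HXT; exact: (HT _ (HY T HT HXT)).
  - by move=> Z HZX; apply/Ht => T HT; apply.
Qed.

Lemma val_upair X Y : val (upair X Y) = upair (val X) (val Y).
Proof.
  apply: val_ext; [exact: (upair_set model_Zer) | exact: upair_set | |].
  - by move=> z; rewrite upairP // => -[] ->; exact: val_HS.
  - move=> Z; rewrite (upairP model_Zer) upairP //; split=> -[E1|E1]; [left|right|left|right];
      try exact: val_inj; by rewrite E1.
Qed.

Lemma val_pair X Y : val (pair X Y) = pair (val X) (val Y).
Proof. by rewrite /pair !val_upair. Qed.

End PermutationModel.

(** * The random graph model *)

Section RandomGraph.
Variable M : structure.
Hypothesis HM : ZFA M.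
Let HZ := ZFA_Zer HM.
Variables A E V R f : M.
Hypothesis HE : is_relation E A A.
Hypothesis HR : is_random_graph V R.
Hypothesis Hf : is_graph_iso f A E V R.
Implicit Types x y z u v : M.

Lemma iso_bij : bij_spec f A V.
Proof. by case: Hf => /(is_bijectionE HZ). Qed.

Lemma iso_edge x y x' y' : pair x x' ∈ f -> pair y y' ∈ f -> (pair x y ∈ E <-> pair x' y' ∈ R).
Proof. by case: Hf => _ H; have := H x y x' y'; rewrite !inrelE. Qed.

Lemma iso_dom x y : pair x y ∈ E -> x ∈ A /\ y ∈ A.
Proof. exact: (rel_dom HZ HE). Qed.

Lemma random_sym x y : pair x y ∈ E -> pair y x ∈ E.
Proof.
  move=> H; have [Hx Hy] := iso_dom H.
  have [x' Hx'] := bs_ex iso_bij Hx; have [y' Hy'] := bs_ex iso_bij Hy.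
  move: H; rewrite (iso_edge Hx' Hy') (iso_edge Hy' Hx').
  by have [[_ [_ [H _]]] _] := HR; have := H x' y'; rewrite !inrelE.
Qed.

Lemma random_irr x : ~ pair x x ∈ E.
Proof.
  move=> H; have [Hx _] := iso_dom H; have [x' Hx'] := bs_ex iso_bij Hx.
  move: H; rewrite (iso_edge Hx' Hx').
  by have [[_ [_ [_ H]]] _] := HR; have := H x'; rewrite inrelE.
Qed.

Lemma random_enum : exists enum, bij_spec enum (om HM) A.
Proof.
  have [_ [[w [g [/(is_omegaE HM) -> /(is_bijectionE HZ) Hg]]] _]] := HR.
  exists (comp g (inverse f A V) (om HM) A).
  by apply: comp_bij Hg _ => //; apply: inverse_bij => //; exact: iso_bij.
Qed.

Lemma random_extension U W : is_set U -> is_set W -> subset U A -> subset W A ->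
  is_finite U -> is_finite W -> (forall x, ~ (x ∈ U /\ x ∈ W)) ->
  exists v, v ∈ A /\ ~ v ∈ U /\ ~ v ∈ W /\
    (forall u, u ∈ U -> pair v u ∈ E) /\ (forall w, w ∈ W -> ~ pair v w ∈ E).
Proof.
  move=> HU HW HUA HWA HUf HWf Hdisj; have Hb := iso_bij.
  have D X : Dfn (fun e => exists u, u ∈ X /\ pair u (e 0) ∈ f) by dfn.
  pose im X := sep V (fun y => exists u, u ∈ X /\ pair u y ∈ f).
  have imP X y : y ∈ im X <-> exists u, u ∈ X /\ pair u y ∈ f.
    rewrite (sepP HZ (D X)); split=> [[] //|H]; split=> //.
    by case: H => u [_ /(bs_dom HZ Hb) []].
  have ims X : is_set (im X) by exact: (sep_set HZ (D X)).
  have imV X : subset (im X) V by move=> y /imP [u [_ /(bs_dom HZ Hb) []]].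
  have imf X : is_set X -> is_finite X -> is_finite (im X).
  { move=> HX HXf; apply: (fin_image HM (R := fun u y => pair u y ∈ f) _ _ HX) => //.
    - by dfn.
    - by move=> x y y'; exact: (bs_fun Hb).
    - by move=> y /imP. }
  have [_ [_ Hext]] := HR.
  have [|v' [Hv' [HvU [HvW [H1 H2]]]]] := Hext (im U) (im W) (ims U) (ims W) (imV U) (imV W)
    (imf U HU HUf) (imf W HW HWf).
    move=> y [/imP [u [Hu Huy]] /imP [w [Hw Hwy]]].
    by apply: (Hdisj u); split=> //; rewrite (bs_inj Hb Huy Hwy).
  have [v Hv] := bs_onto Hb Hv'; have [HvA _] := bs_dom HZ Hb Hv.
  exists v; split=> //.
  split; first by move=> H; apply: HvU; apply/imP; exists v.
  split; first by move=> H; apply: HvW; apply/imP; exists v.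
  split=> [u Hu|w Hw].
  - have [u' Hu'] := bs_ex Hb (HUA _ Hu); rewrite (iso_edge Hv Hu').
    by apply/(inrelE HZ); apply: H1; apply/imP; exists u.
  - have [w' Hw'] := bs_ex Hb (HWA _ Hw); rewrite (iso_edge Hv Hw').
    by move/(inrelE HZ); apply: H2; apply/imP; exists w.
Qed.

Hypothesis AP : forall x, x ∈ A <-> atom x.
Variables Sigma c F : M.
Hypothesis HSigma : is_aut_group A E Sigma c.
Hypothesis HF : is_atom_stab_filter F A Sigma c.
Let M' := permutation_model Sigma F.
Let val : M' -> M := @proj1_sig _ _.
Let HZ' := model_Zer HM AP HSigma HF.
Let HS := hereditarily_symmetric Sigma F.

Lemma singleton_fin x : is_finite (upair x x).
Proof.
  have -> : upair x x = adjoin (zero HM) x; last by apply: (fin_adjoin HM); exact: (fin_empty HM).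
  apply: (set_ext HZ); [exact: upair_set | exact: adjoin_set | move=> z].
  by rewrite upairP // adjoinP //; have := @zeroP _ HM z; tauto.
Qed.

Lemma random_neighbour a : a ∈ A -> exists b, pair a b ∈ E /\ pair b a ∈ E.
Proof.
  move=> Ha.
  have [|||||||b [_ [_ [_ [Hb _]]]]] := @random_extension (upair a a) (zero HM).
  - exact: upair_set.
  - exact: emp_set.
  - by move=> x; rewrite upairP // => -[] ->.
  - by move=> x /(zeroP (HM := HM)).
  - exact: singleton_fin.
  - exact: fin_empty.
  - by move=> x [_ /(zeroP (HM := HM))].
  - have Hba : pair b a ∈ E by apply: Hb; rewrite upairP //; auto.
    by exists b; split=> //; exact: random_sym.
Qed.

Lemma HS_A : HS A.
Proof.
  have [enum Hen] := random_enum; have [a Ha] := bs_ex Hen (om_zero HM).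
  have [_ HaA] := bs_dom HZ Hen Ha.
  apply: (HS_intro HM AP HSigma HF (e := zero HM)).
  - exact: (mem_set HZ HaA).
  - exact: emp_set.
  - by move=> z /(zeroP (HM := HM)).
  - exact: fin_empty.
  - by move=> z /AP; exact: (atom_HS HM AP HSigma HF).
  - move=> s Hs _ z /AP Hz; apply/AP; apply: (act_is_atom HM AP) => //.
    exact: (Sigma_bij HM HSigma Hs).
Qed.

Lemma HS_E : HS E.
Proof.
  have /(is_relationE HZ) [HEs HEp] := HE.
  apply: (HS_intro HM AP HSigma HF (e := zero HM)) => //.
  - exact: emp_set.
  - by move=> z /(zeroP (HM := HM)).
  - exact: fin_empty.
  - move=> z /HEp [x [y [/AP Hx [/AP Hy ->]]]].
    pose X : M' := exist _ x (atom_HS HM AP HSigma HF Hx).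
    pose Y : M' := exist _ y (atom_HS HM AP HSigma HF Hy).
    by rewrite -[pair x y](val_pair HM AP HSigma HF X Y); exact: val_HS.
  - move=> s Hs _ z Hz; have [x [y [/AP Hx [/AP Hy Ez]]]] := HEp _ Hz; subst z.
    have Hb := Sigma_bij HM HSigma Hs; rewrite (act_pair HM AP Hb).
    have [_ He] := proj1 (SigmaP HM HSigma s) Hs.
    by apply/(He x y) => //; exact: (act_atom HM AP).
Qed.

Let A' : M' := exist _ A HS_A.
Let E' : M' := exist _ E HS_E.

Lemma mem_pairE (g X Y : M') : pair X Y ∈ g <-> pair (val X) (val Y) ∈ val g.
Proof. by rewrite -(val_pair HM AP HSigma HF). Qed.

(** The random graph is rigid in the permutation model. An automorphism [g] with
    support [e] commutes with the automorphisms that fix [e] pointwise, and these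
    can move any [a] outside [e] while fixing [g a], unless [a] is [g a]. So [g] fixes
    the points outside [e]; and a point [a] of [e] is separated from [g a] by a
    neighbour outside [e]. *)
Lemma random_rigid (g : M') : bij_spec g A' A' ->
  (forall x y x' y' : M', pair x x' ∈ g -> pair y y' ∈ g ->
    (pair x y ∈ E' <-> pair x' y' ∈ E')) ->
  forall x y : M', pair x y ∈ g -> x = y.
Proof.
  move=> Hg HgE.
  have [e [Hes [HeA [Hef Hfix]]]] := HS_support HM AP HSigma HF (val_HS g).
  rewrite -/(val g) in Hfix.
  pose lift a (Ha : a ∈ A) : M' := exist _ a (atom_HS HM AP HSigma HF (proj1 (AP a) Ha)).
  have Hinj a a' b : a ∈ A -> a' ∈ A -> b ∈ A ->
      pair a b ∈ val g -> pair a' b ∈ val g -> a = a'.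
    move=> Ha Ha' Hb H H'.
    have := @bs_inj _ _ _ _ Hg (lift a Ha) (lift a' Ha') (lift b Hb).
    by rewrite !mem_pairE => /(_ H H') [].
  have Hout a b : a ∈ A -> b ∈ A -> ~ a ∈ e -> pair a b ∈ val g -> a = b.
  { move=> Ha Hb Hae Hab; apply: NNPP => Hne.
    have [enum Hen] := random_enum.
    have [||||s [Hs [Hse Hsa]]] := moving_automorphism random_sym random_irr Hen
      random_extension (e := adjoin e b) _ _ _ Ha.
    - exact: adjoin_set.
    - exact: fin_adjoin.
    - by move=> x; rewrite adjoinP // => -[/HeA|->].
    - by rewrite adjoinP // => -[].
    - have HsS : s ∈ Sigma by apply/(SigmaP HM HSigma).
      have Hsb := as_bij Hs.
      have Hact x : x ∈ e \/ x = b -> act s x = x.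
        by move=> Hx; apply: (act_atomE HM AP) => //; apply: Hse; rewrite adjoinP.
      have Egs : act s (val g) = val g by apply: Hfix => // x Hx; apply: Hact; auto.
      have := act_mem HM AP Hsb Hab; rewrite Egs (act_pair HM AP Hsb) (Hact b (or_intror eq_refl)).
      have HsaA : act s a ∈ A by apply/AP; apply: (act_is_atom HM AP) => //; apply/AP.
      move=> H; apply: Hsa; have Ea := Hinj _ _ _ HsaA Ha Hb H Hab.
      by rewrite -{2}Ea; apply: (act_atom HM AP) => //; apply/AP. }
  move=> X Y HXY; apply: NNPP => HneXY.
  have [HX HY] := bs_dom HZ' Hg HXY.
  have HneXY' : val X <> val Y by move/val_inj.
  have HXe : val X ∈ e.
    apply: NNPP => HXe; apply: HneXY'; apply: Hout => //; exact/mem_pairE.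
  have D : Dfn (fun e => e 0 <> val X) by dfn.
  pose W := sep (adjoin e (val Y)) (fun z => z <> val X).
  have HW z : z ∈ W <-> (z ∈ e \/ z = val Y) /\ z <> val X by rewrite sepP // adjoinP.
  have HWs : is_set W by exact: sep_set.
  have [|||||||v [HvA [HvU [HvW [H1 H2]]]]] := @random_extension (upair (val X) (val X)) W.
  - exact: upair_set.
  - exact: HWs.
  - by move=> z; rewrite upairP // => -[] ->.
  - by move=> z /HW [[/HeA|->]].
  - exact: singleton_fin.
  - apply: (fin_sub HM (X := adjoin e (val Y))) => //; first exact: adjoin_set.
      exact: fin_adjoin.
    by move=> z; rewrite sepP // => -[].
  - by move=> z; rewrite upairP // HW => -[[->|->] []].
  - have HvX : v <> val X by move=> Ev; apply: HvU; rewrite upairP //; auto.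
    have Hve : ~ v ∈ e by move=> Hve; apply: HvW; rewrite HW; auto.
    have [Z HvZ] := bs_ex Hg (x := lift v HvA) HvA.
    have [_ HZA] := bs_dom HZ' Hg HvZ.
    have EvZ : v = val Z by apply: Hout => //; move: HvZ; rewrite mem_pairE.
    have := HgE _ _ _ _ HvZ HXY; rewrite !mem_pairE -EvZ => -[H3 _].
    apply: (H2 (val Y)); first by rewrite HW; auto.
    by apply: H3; apply: H1; rewrite upairP //; auto.
Qed.

Lemma random_frucht : Frucht M'.
Proof.
  apply: (@frucht_of_rigid M' HZ' (model_closures HM AP HSigma HF) A' E').
  - by move=> X; exact: AP.
  - by move=> X Y; rewrite mem_pairE; exact: iso_dom.
  - by move=> X; rewrite mem_pairE; exact: random_irr.
  - move=> X HX; have [b [H1 H2]] := random_neighbour HX.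
    have [_ /AP Hb] := iso_dom H1.
    by exists (exist _ b (atom_HS HM AP HSigma HF Hb)); rewrite !mem_pairE.
  - exact: random_rigid.
Qed.

End RandomGraph.

Theorem mainTheorem6 (M : structure) (HM : ZFA M) (A E : M)
  (HA : forall x : M, x ∈ A <-> atom x)
  (HAcount : is_countable A)
  (HE : is_relation E A A)
  (Hrandom : exists V R f : M,
     is_random_graph V R /\ is_graph_iso f A E V R)
  (Sigma c : M) (HSigma : is_aut_group A E Sigma c)
  (F : M) (HF : is_atom_stab_filter F A Sigma c) :
  Frucht (permutation_model Sigma F).
Proof.
  have [V [R [f [HR Hf]]]] := Hrandom.
  exact: (random_frucht HM HE HR Hf HA HSigma HF).
Qed.
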